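(* Fix $1<s\le 2$ and let $X$ be a Banach space with martingale type $s$. Let $S=(S(t))_{t\ge 0}$ be a bounded $C_0$-semigroup on $X$ and suppose that $S$ has an isometric dilation on a Banach space $Y$ with martingale type $s$. (1) If $s\le p<\infty$, then there is a constant $C$ depending only on $p,s,X,S$ such that every simple, adapted $X$-valued process $\phi$ satisfies, for every $B\in\mathcal{J}$, $$\Big(\mathbb{E}\sup_{t>0}\Big\|\int_{(0,t]\times B}S(t-u)\phi(u)\,\mathrm{d}\tilde N\Big\|_X^p\Big)^{1/p}\le C\,\|\phi\mathbf 1_B\|_{\mathcal{D}^p_{s,X}\cap\mathcal{D}^p_{p,X}}.$$ (2) If $1\le p<s$, then there is a constant $C$ depending only on $p,s,X$ such that every simple, adapted $X$-valued process $\phi$ satisfies, for every $B\in\mathcal{J}$, $$\Big(\mathbb{E}\sup_{t>0}\Big\|\int_{(0,t]\times B}S(t-u)\phi(u)\,\mathrm{d}\tilde N\Big\|_X^p\Big)^{1/p}\le C\,\|\phi\mathbf 1_B\|_{\mathcal{D}^p_{s,X}+\mathcal{D}^p_{p,X}}.$$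
   Context: Martingale type: for $1\le s\le 2$, a Banach space $X$ has martingale type $s$ if there is a constant $C$ depending only on $s$ and $X$ such that every finite martingale difference sequence $(d_i)$ in $L^s(\Omega;X)$ satisfies $(\mathbb{E}\|\sum_i d_i\|_X^s)^{1/s}\le C(\sum_i\mathbb{E}\|d_i\|_X^s)^{1/s}$. Isometric dilation: a strongly continuous semigroup $S$ on $X$ has an isometric dilation on a Banach space $Y$ if there exist an isomorphic embedding $Q:X\to Y$, a bounded projection $P:Y\to QX$ (onto the range of $Q$), and a strongly continuous group of isometries $(U(t))_{t\in\mathbb{R}}$ on $Y$ such that $QS(t)=PU(t)Q$ for all $t>0$. Poisson random measure: let $(\Omega,\mathcal{F},\mathbb{P})$ be a probability space. A Poisson random measure on a measurable space $(E,\mathcal{E})$ with $\sigma$-finite intensity measure $\mu$ is a map $N:\Omega\times\mathcal{E}\to\mathbb{N}\cup\{\infty\}$ such that $N(B)$ is a random variable for each $B\in\mathcal{E}$, $N(\omega,\cdot)$ is a measure for each $\omega$, $N(B)$ is Poisson distributed with parameter $\mu(B)$ for each $B$ ($N(B)=\infty$ a.s. if $\mu(B)=\infty$), and $N(B_1),\dots,N(B_n)$ are independent for pairwise disjoint $B_1,\dots,B_n\in\mathcal{E}$. For $\mu(B)<\infty$ put $\tilde N(B):=N(B)-\mu(B)$. Setting: $(J,\mathcal{J},\nu)$ is a $\sigma$-finite measure space and $N$ is a Poisson random measure on $(\mathbb{R}_+\times J,\mathcal{B}(\mathbb{R}_+)\times\mathcal{J})$ with intensity measure $dt\times\nu$.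 $\mathcal{F}_t$ is the $\sigma$-algebra generated by the random variables $N((s,u]\times A)$, $0\le s<u\le t$, $A\in\mathcal{J}$ (so $\mathcal{F}_0$ is trivial). Simple adapted processes and stochastic integral: a simple, adapted $X$-valued process is a map $\phi:\Omega\times\mathbb{R}_+\times J\to X$ of the form $\phi=\sum_{i=1}^l\sum_{j=1}^m\sum_{k=1}^n F_{ijk}\mathbf 1_{(t_i,t_{i+1}]}\mathbf 1_{A_j}x_{ijk}$ with $0=t_1<t_2<\dots<t_{l+1}<\infty$, $F_{ijk}\in L^\infty(\Omega,\mathcal{F}_{t_i})$, disjoint $A_1,\dots,A_m\in\mathcal{J}$ with $\nu(A_j)<\infty$, and $x_{ijk}\in X$. For $t>0$ and $B\in\mathcal{J}$, $\int_{(0,t]\times B}\phi\,\mathrm{d}\tilde N:=\sum_{i,j,k}F_{ijk}\,\tilde N((t_i\wedge t,t_{i+1}\wedge t]\times(A_j\cap B))\,x_{ijk}$. A process $\psi:\Omega\times\mathbb{R}_+\times J\to X$ is $L^p$-stochastically integrable if there are simple adapted processes $\psi_n$ with $\psi_n\to\psi$ almost everywhere such that for all $B\in\mathcal{J}$, $t>0$ the sequence $\int_{(0,t]\times B}\psi_n\,\mathrm{d}\tilde N$ converges in $L^p(\Omega;X)$; then $\int_{(0,t]\times B}\psi\,\mathrm{d}\tilde N$ is defined as that limit. The stochastic convolution $\int_{(0,t]\times B}S(t-u)\phi(u)\,\mathrm{d}\tilde N$ is, for each $t>0$, the integral in this sense of the process $(\omega,u,j)\mapsto\mathbf 1_{(0,t]}(u)S(t-u)\phi(\omega,u,j)$.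 Norms: for $1\le p,q<\infty$, $\mathcal{D}^p_{q,X}:=L^p(\Omega;L^q(\mathbb{R}_+\times J;X))$, i.e. $\|\phi\|_{\mathcal{D}^p_{q,X}}=\big(\mathbb{E}(\int_{\mathbb{R}_+\times J}\|\phi\|_X^q\,dt\times d\nu)^{p/q}\big)^{1/p}$. The intersection of two such spaces carries the maximum of the two norms, and the sum carries the norm $\|\phi\|_{Y_0+Y_1}=\inf\{\|\phi_0\|_{Y_0}+\|\phi_1\|_{Y_1}:\phi=\phi_0+\phi_1\}$.
   Formalization: In part (2) the constant C may also depend on the semigroup S, as in part (1); a constant depending only on p, s, X is impossible (on R², S(t)=A⁻¹Rot(t)A with A=diag(1,M) forces C ≥ cM). *)

(* Defs.v *)
From HB Require Import structures.
From mathcomp Require Import all_boot all_order all_algebra.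
From mathcomp Require Import all_classical all_reals all_analysis.
From mathcomp Require Import measurable_realfun.

Set Implicit Arguments.
Unset Strict Implicit.
Unset Printing Implicit Defensive.
Import Order.TTheory GRing.Theory Num.Theory.
Import numFieldNormedType.Exports.
Local Open Scope classical_set_scope.
Local Open Scope ring_scope.

(** * Strongly measurable functions and the Bochner integral *)

Section strong_measurability.
Context {R : realType} {X : completeNormedModType R}.

(* [G] is a sigma-algebra on [T], given as a set of sets so that the notion
   also applies to the sub-sigma-algebras of a filtration. *)
Definition simple_fun (T : Type) (G : set (set T)) (f : T -> X) : Prop :=
  finite_set (range f) /\ forall x, G (f @^-1` [set x]).

Definition strongly_measurable (T : Type) (G : set (set T)) (f : T -> X) :
    Prop :=
  exists f_ : nat -> T -> X,
    (forall n, simple_fun G (f_ n)) /\ forall w, f_ ^~ w @ \oo --> f w.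

Context d (T : measurableType d) (P : probability T R).

Definition simple_integral (f : T -> X) : X :=
  \sum_(x \in range f) fine (P (f @^-1` [set x])) *: x.

Definition is_bochner_integral (f : T -> X) (v : X) : Prop :=
  strongly_measurable measurable f /\
  exists f_ : nat -> T -> X,
    [/\ forall n, simple_fun measurable (f_ n),
        (\int[P]_w (`|f w - f_ n w|)%:E)%E @[n --> \oo] --> 0%E &
        simple_integral (f_ n) @[n --> \oo] --> v].

(* E ||f||^p *)
Definition moment (p : R) (f : T -> X) : \bar R :=
  (\int[P]_w (`|f w| `^ p)%:E)%E.

Definition in_Lp (p : R) (f : T -> X) : Prop :=
  strongly_measurable measurable f /\ (moment p f < +oo)%E.

Definition Lp_cvg (p : R) (f_ : nat -> T -> X) (f : T -> X) : Prop :=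
  in_Lp p f /\ moment p (fun w => f_ n w - f w) @[n --> \oo] --> 0%E.

(* [d_ 0, ..., d_ n.-1] is a martingale difference sequence in L^s w.r.t. the
   filtration [F 0 <= F 1 <= ... <= F n]: [d_ i] is [F i.+1]-measurable and its
   conditional expectation given [F i] vanishes, i.e. its Bochner integral over
   each set of [F i] is 0. *)
Definition martingale_difference (s : R) (n : nat) (F : nat -> set (set T))
    (d_ : nat -> T -> X) : Prop :=
  [/\ forall i, (i <= n)%N -> sigma_algebra setT (F i) /\ F i `<=` measurable,
      forall i, (i < n)%N -> F i `<=` F i.+1,
      forall i, (i < n)%N -> strongly_measurable (F i.+1) (d_ i),
      forall i, (i < n)%N -> in_Lp s (d_ i) &
      forall i A, (i < n)%N -> F i A ->
        is_bochner_integral (fun w => \1_A w *: d_ i w) 0].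

End strong_measurability.

Definition martingale_type {R : realType} (s : R) (X : completeNormedModType R)
    : Prop :=
  exists C : R, forall d (T : measurableType d) (P : probability T R)
    (n : nat) (F : nat -> set (set T)) (d_ : nat -> T -> X),
    martingale_difference P s n F d_ ->
    (moment P s (fun w => (\sum_(i < n) d_ i w)%R) `^ s^-1
      <= C%:E * (\sum_(i < n) moment P s (d_ i))%E `^ s^-1)%E.

(** * Semigroups and isometric dilations *)

Section semigroups.
Context {R : realType}.

(* Only the values of [S] on [0, +oo[ matter. *)
Record C0_semigroup (X : completeNormedModType R) (S : R -> {linear X -> X}) :
    Prop := {
  C0_continuous : forall t, 0 <= t -> continuous (S t) ;
  C0_0 : forall x, S 0 x = x ;
  C0_add : forall t u x, 0 <= t -> 0 <= u -> S (t + u) x = S t (S u x) ;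
  C0_strong : forall x, {within `[0, +oo[, continuous (fun t => S t x)} }.

Definition bounded_C0_semigroup (X : completeNormedModType R)
    (S : R -> {linear X -> X}) : Prop :=
  C0_semigroup S /\
  exists M : R, forall t x, 0 <= t -> `|S t x| <= M * `|x|.

Record isometric_C0_group (Y : completeNormedModType R)
    (U : R -> {linear Y -> Y}) : Prop := {
  group_0 : forall y, U 0 y = y ;
  group_add : forall t u y, U (t + u) y = U t (U u y) ;
  group_isometry : forall t y, `|U t y| = `|y| ;
  group_strong : forall y, continuous (fun t => U t y) }.

Definition isomorphic_embedding (X Y : completeNormedModType R)
    (Q : {linear X -> Y}) : Prop :=
  continuous Q /\ exists2 c : R, 0 < c & forall x, c * `|x| <= `|Q x|.

Definition bounded_projection_onto (Y : completeNormedModType R)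
    (P : {linear Y -> Y}) (V : set Y) : Prop :=
  [/\ continuous P, forall y, P (P y) = P y & range P = V].

Definition isometric_dilation (X Y : completeNormedModType R)
    (S : R -> {linear X -> X}) : Prop :=
  exists (Q : {linear X -> Y}) (P : {linear Y -> Y}) (U : R -> {linear Y -> Y}),
    [/\ isomorphic_embedding Q, bounded_projection_onto P (range Q),
        isometric_C0_group U &
        forall t x, 0 < t -> Q (S t x) = P (U t (Q x))].

End semigroups.

(** * Poisson random measures *)

Section poisson_random_measure.
Context {R : realType} dO (O : measurableType dO) (P : probability O R).
Context dE (E : measurableType dE).

(* Probability of [k] under the Poisson distribution of parameter [r >= 0];
   the library's [poisson_pmf] is a junk value at [r = 0]. *)
Definition poisson_mass (r : R) (k : nat) : R :=
  r ^+ k / k`!%:R * expR (- r).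

Record poisson_random_measure (mu : {sigma_finite_measure set E -> \bar R})
    (N : O -> {measure set E -> \bar R}) : Prop := {
  prm_integer : forall w B, measurable B ->
    N w B = +oo%E \/ exists k : nat, N w B = k%:R%:E ;
  prm_measurable : forall B, measurable B ->
    measurable_fun setT (fun w => N w B : \bar R) ;
  prm_poisson : forall B, measurable B -> (mu B < +oo)%E ->
    forall k : nat,
      P [set w | N w B = k%:R%:E] = (poisson_mass (fine (mu B)) k)%:E ;
  prm_infinite : forall B, measurable B -> mu B = +oo%E ->
    {ae P, forall w, N w B = +oo%E} ;
  prm_independent : forall (n : nat) (B : 'I_n -> set E),
    (forall i, measurable (B i)) -> trivIset setT B ->
    forall V : 'I_n -> set (\bar R), (forall i, measurable (V i)) ->
      P (\bigcap_(i in [set: 'I_n]) [set w | V i (N w (B i))])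
      = (\prod_(i < n) P [set w | V i (N w (B i))])%E }.

(* Compensated measure; meant for [mu B < +oo], where [N w B] is finite
   almost surely. *)
Definition compensated (mu : set E -> \bar R)
    (N : O -> {measure set E -> \bar R}) (B : set E) (w : O) : R :=
  fine (N w B) - fine (mu B).

End poisson_random_measure.

(** * Lebesgue measure dt on R_+

  R_+ is embedded in R: a random measure on R_+ x J is a random measure on
  R x J whose intensity does not charge the negative times. *)

Section time_measure.
Context (R : realType).

Definition Rplus : set (measurableTypeR R) := `[0, +oo[%classic.

Lemma measurable_Rplus : measurable Rplus.
Proof. exact: measurable_itv. Qed.

Definition dt : set (measurableTypeR R) -> \bar R :=
  mrestr lebesgue_measure measurable_Rplus.

HB.instance Definition _ := Measure.on dt.

Let dt_sigma_finite : sigma_finite setT dt.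
Proof.
have [F FT Foo] := sigma_finiteT (@lebesgue_measure R).
exists F => // i; have [mF Fioo] := Foo i; split=> //.
apply: le_lt_trans Fioo; apply: le_measure; rewrite ?inE //.
by apply: measurableI => //; exact: measurable_Rplus.
Qed.

HB.instance Definition _ :=
  Measure_isSigmaFinite.Build _ _ _ dt dt_sigma_finite.

End time_measure.

Section intensity.
Context {R : realType} dJ (J : measurableType dJ).
Variable nu : {sigma_finite_measure set J -> \bar R}.

Definition intensity : set (measurableTypeR R * J) -> \bar R :=
  (@dt R \x nu)%E.

HB.instance Definition _ := Measure.on intensity.

Let intensity_sigma_finite : sigma_finite setT intensity.
Proof.
have /sigma_finiteP[F [TF ndF Foo]] := sigma_finiteT (@dt R).
have /sigma_finiteP[G [TG ndG Goo]] := sigma_finiteT nu.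
exists (fun n => F n `*` G n).
  rewrite -setXTT TF TG predeqE => -[x y]; split.
    move=> [/= [n _ Fnx] [k _ Gky]]; exists (maxn n k) => //; split.
    - by move: x Fnx; exact/subsetPset/ndF/leq_maxl.
    - by move: y Gky; exact/subsetPset/ndG/leq_maxr.
  by move=> [n _ []/= ? ?]; split; exists n.
move=> k; have [? ?] := Foo k; have [? ?] := Goo k.
split; first exact: measurableX.
by rewrite /intensity product_measure1E// lte_mul_pinfty// ge0_fin_numE.
Qed.

HB.instance Definition _ :=
  Measure_isSigmaFinite.Build _ _ _ intensity intensity_sigma_finite.

End intensity.

(** * Simple adapted processes and the compensated stochastic integral *)

Section stochastic_integration.
Context {R : realType} {X : completeNormedModType R}.
Context dO (O : measurableType dO) (P : probability O R).
Context dJ (J : measurableType dJ)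
  (nu : {sigma_finite_measure set J -> \bar R}).
Local Notation RJ := (measurableTypeR R * J)%type.
Context (N : O -> {measure set RJ -> \bar R}).


(* F_t *)
Definition natural_filtration (t : R) : set (set O) :=
  <<s [set D | exists (s u : R) (A : set J) (V : set (\bar R)),
         [/\ 0 <= s, s < u, u <= t, measurable A & measurable V] /\
         D = (fun w => N w (`]s, u]%classic `*` A)) @^-1` V] >>.

(* Data of sum_(i < l) sum_(j < m) sum_(k < n)
     F_ijk 1_(t_i, t_i.+1] 1_(A_j) x_ijk, with grid t_0 < ... < t_l. *)
Record step_process : Type := StepProcess {
  sp_l : nat ;
  sp_m : nat ;
  sp_n : nat ;
  sp_t : nat -> R ;
  sp_F : 'I_sp_l -> 'I_sp_m -> 'I_sp_n -> O -> R ;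
  sp_A : 'I_sp_m -> set J ;
  sp_x : 'I_sp_l -> 'I_sp_m -> 'I_sp_n -> X }.
Arguments sp_F phi : rename, clear implicits.
Arguments sp_A phi : rename, clear implicits.
Arguments sp_x phi : rename, clear implicits.

Record simple_adapted (phi : step_process) : Prop := {
  sa_t0 : sp_t phi 0 = 0 ;
  sa_lt : forall i, (i < sp_l phi)%N -> sp_t phi i < sp_t phi i.+1 ;
  sa_adapted : forall (i : 'I_(sp_l phi)) j k (V : set R), measurable V ->
    natural_filtration (sp_t phi i) (sp_F phi i j k @^-1` V) ;
  sa_bounded : forall (i : 'I_(sp_l phi)) j k,
    exists M : R, {ae P, forall w, `|sp_F phi i j k w| <= M} ;
  sa_measurable : forall j, measurable (sp_A phi j) ;
  sa_finite : forall j, (nu (sp_A phi j) < +oo)%E ;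
  sa_disjoint : trivIset setT (sp_A phi) }.

(* Processes O x R_+ x J -> X are functions on O x (R x J) whose values at
   negative times are irrelevant. *)
Definition sp_fun (phi : step_process) (w : O) (z : RJ) : X :=
  \sum_(i < sp_l phi) \sum_(j < sp_m phi) \sum_(k < sp_n phi)
    (sp_F phi i j k w * \1_(`]sp_t phi i, sp_t phi i.+1]%classic) z.1
       * \1_(sp_A phi j) z.2) *: sp_x phi i j k.

Definition sp_integral (phi : step_process) (t : R) (B : set J) (w : O) : X :=
  \sum_(i < sp_l phi) \sum_(j < sp_m phi) \sum_(k < sp_n phi)
    (sp_F phi i j k w *
     compensated (intensity nu) N
       (`]Num.min (sp_t phi i) t, Num.min (sp_t phi i.+1) t]%classic
          `*` (sp_A phi j `&` B)) w) *: sp_x phi i j k.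

Record stoch_approximation (p : R) (psi : O -> RJ -> X)
    (phi_ : nat -> step_process) : Prop := {
  approx_simple : forall n, simple_adapted (phi_ n) ;
  approx_ae : {ae (P \x intensity nu)%E, forall wz,
    sp_fun (phi_ n) wz.1 wz.2 @[n --> \oo] --> psi wz.1 wz.2} ;
  approx_cvg : forall t B, 0 < t -> measurable B ->
    exists I : O -> X, Lp_cvg P p (fun n => sp_integral (phi_ n) t B) I }.

(* [I] is (a representative of) the L^p-stochastic integral of [psi] over
   (0, t] x B; for p >= 1 it does not depend, up to null sets, on the
   approximating sequence. *)
Definition is_stoch_integral (p : R) (psi : O -> RJ -> X) (t : R)
    (B : set J) (I : O -> X) : Prop :=
  exists2 phi_, stoch_approximation p psi phi_ &
    Lp_cvg P p (fun n => sp_integral (phi_ n) t B) I.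

Definition cadlag (f : R -> X) : Prop := forall t, 0 < t ->
  f u @[u --> t^'+] --> f t /\ exists l : X, f u @[u --> t^'-] --> l.

Definition convolution_integrand (S : R -> {linear X -> X})
    (phi : O -> RJ -> X) (t : R) (w : O) (z : RJ) : X :=
  (\1_(`]0, t]%classic) z.1 : R) *: S (t - z.1) (phi w z).

(* The stochastic integrals are only defined up to null sets for each t, so
   the supremum over t > 0 is taken along a version with almost surely cadlag
   paths, which is unique up to indistinguishability. *)
Definition stoch_convolution (p : R) (S : R -> {linear X -> X})
    (phi : O -> RJ -> X) (B : set J) (Z : R -> O -> X) : Prop :=
  (forall t, 0 < t ->
     is_stoch_integral p (convolution_integrand S phi t) t B (Z t)) /\
  {ae P, forall w, cadlag (Z ^~ w)}.

(* (E sup_(t > 0) ||Z_t||^p)^(1/p) *)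
Definition sup_norm (p : R) (Z : R -> O -> X) : \bar R :=
  ((\int[P]_w ereal_sup [set (`|Z t w| `^ p)%:E | t in [set t : R | 0 < t]%R])
     `^ p^-1)%E.

(* Norm of D^p_(q,X) = L^p(O; L^q(R_+ x J; X)) *)
Definition Dnorm (p q : R) (phi : O -> RJ -> X) : \bar R :=
  ((\int[P]_w (\int[intensity nu]_z (`|phi w z| `^ q)%:E) `^ (p / q))
     `^ p^-1)%E.

Definition in_D (p q : R) (phi : O -> RJ -> X) : Prop :=
  strongly_measurable measurable (fun wz : O * RJ => phi wz.1 wz.2) /\
  (Dnorm p q phi < +oo)%E.

Definition Dnorm_cap (p q0 q1 : R) (phi : O -> RJ -> X) : \bar R :=
  maxe (Dnorm p q0 phi) (Dnorm p q1 phi).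

Definition Dnorm_sum (p q0 q1 : R) (phi : O -> RJ -> X) : \bar R :=
  ereal_inf [set r | exists phi0 phi1 : O -> RJ -> X,
    [/\ in_D p q0 phi0, in_D p q1 phi1,
        {ae (P \x intensity nu)%E, forall wz,
           phi wz.1 wz.2 = phi0 wz.1 wz.2 + phi1 wz.1 wz.2} &
        r = (Dnorm p q0 phi0 + Dnorm p q1 phi1)%E]].

Definition restrict_marks (B : set J) (phi : O -> RJ -> X)
    (w : O) (z : RJ) : X :=
  (\1_B z.2 : R) *: phi w z.

End stochastic_integration.

(* Main.v *)
Require Import Defs.
From HB Require Import structures.
From mathcomp Require Import all_boot all_order all_algebra.
From mathcomp Require Import all_classical all_reals all_analysis.
From mathcomp Require Import measurable_realfun.
From mathcomp Require Import ring lra.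
Set Implicit Arguments.
Unset Strict Implicit.
Unset Printing Implicit Defensive.
Import Order.TTheory GRing.Theory Num.Theory.
Import numFieldNormedType.Exports.
Local Open Scope classical_set_scope.
Local Open Scope ring_scope.

(** The dilation gives Q S(t - u) x = P U(t) U(-u) Q x, so the convolution is the
  image under P U(t), up to the isomorphism Q, of the integral I(t) of U(-u) Q phi
  over (0, t], and U(t) is isometric: it suffices to bound E sup_t |I(t)|^p in Y,
  and the paths inherit right continuity and left limits from I.

  On a fine grid, with its cells c enumerated lexicographically in time and mark,
  I is a sum of terms (eta_c - h_c) v_c where eta_c is Poisson of parameter
  h_c <= 1 and independent of the past, to which v_c belongs.  Martingale type s
  and Abel summation (a pathwise Doob inequality) give
  E max |sum|^s <= C sum_c h_c E |v_c|^s.  For p > s, this inequality is applied to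
  the transform of the martingale by a power of its running maximum.  For p < s,
  the v_c are split at an adapted level, comparable to the norm of
  (v_0, ..., v_(c-1)) in l^s(h) + l^p(h): the small ones are handled by a
  weighted version of the case p = s, the large ones by the moments of Poisson
  sums.  This level is dominated through any decomposition phi = phi0 + phi1,
  adapted or not.

  The passage from the grid to I is pathwise: N and its intensity are finite on the
  support of phi, where the left-endpoint approximations of U(-u) Q phi converge
  boundedly, uniformly enough to use Fatou's lemma for the supremum. *)

(** * Inequalities for powers and running maxima *)

(** For [p < s] the obstacle is that a decomposition [phi = phi0 + phi1] need not be adapted, so
    neither part can be integrated by itself. Only [phi] is integrated; the decomposition enters
    through one random number [K], essentially the sum of the pathwise norms of its two parts. The
    minimum of [(y/K)^s] and [(y/K)^p] is at most [2^s ((y0/K)^s + (y1/K)^p)] whenever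
    [y <= y0 + y1], and a Gronwall argument with this modular bounds the adapted level by a multiple
    of [K].

    The condition [h_c <= 1] makes the Poisson moments of order [q >= 1] at most a constant times
    [h_c]; this is how sums over cells become integrals against the intensity. Cells over the same
    time interval are revealed one after the other, so the discrete filtration is indexed by regions
    of time and mark instead of times.

    Several estimates bound a moment of the running maximum by half of itself plus the wanted terms;
    the subtraction is legitimate because on a grid all the moments involved are finite. The
    supremum over [t] is not known to be measurable, so it is only compared with a measurable
    majorant. *)

Section real_inequalities.
Context {R : realType}.
Implicit Types x y a b p q r s K C : R.

Lemma le_powR r x y : 0 <= r -> 0 <= x -> x <= y -> x `^ r <= y `^ r.
Proof.
by move=> r0 x0 xy; apply: ge0_ler_powR => //; rewrite nnegrE// (le_trans x0).
Qed.

Lemma powRK r x : 0 < r -> 0 <= x -> (x `^ r) `^ r^-1 = x.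
Proof. by move=> r0 x0; rewrite -powRrM divff ?gt_eqF// powRr1. Qed.

Lemma powRVK r x : 0 < r -> 0 <= x -> (x `^ r^-1) `^ r = x.
Proof. by move=> r0 x0; rewrite -powRrM mulVf ?gt_eqF// powRr1. Qed.

(** Young's inequality in the form used for absorption. Below the threshold [x = 2 C y] the power of
    [x] becomes a power of [y]; above it [C y < x / 2]. The term with coefficient one half is later
    moved to the other side. *)
Lemma absorb_powR q C : 1 <= q -> 0 <= C -> exists2 C' : R, 0 <= C' &
  forall x y, 0 <= x -> 0 <= y ->
    C * (x `^ (q - 1) * y) <= 2^-1 * x `^ q + C' * y `^ q.
Proof.
move=> q1 C0; have q0 : 0 < q by lra.
have qm : 0 <= q - 1 by lra.
exists (C * (2 * C) `^ (q - 1)); first by rewrite mulr_ge0// powR_ge0.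
move=> x y x0 y0; have [xy|yx] := leP x (2 * C * y).
  have : x `^ (q - 1) <= (2 * C) `^ (q - 1) * y `^ (q - 1).
    by rewrite -powRM ?mulr_ge0//; exact: le_powR.
  move=> /(ler_wpM2r y0)/(ler_wpM2l C0) /le_trans; apply.
  rewrite ler_wpDl ?mulr_ge0 ?powR_ge0//.
  by rewrite -mulrA -(mulr_powRB1 y0 q0) [y * _]mulrC !mulrA.
rewrite ler_wpDr ?mulr_ge0 ?powR_ge0// -(mulr_powRB1 x0 q0).
rewrite [x * _]mulrC mulrCA [leRHS]mulrCA ler_wpM2l ?powR_ge0//.
lra.
Qed.

Lemma powR_addr q x y : 0 <= q -> 0 <= x -> 0 <= y ->
  (x + y) `^ q <= 2 `^ q * (x `^ q + y `^ q).
Proof.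
move=> q0 x0 y0; rewrite mulrDr -!powRM//.
have [xy|yx] := leP x y.
  by rewrite ler_wpDl ?powR_ge0//; apply: le_powR => //; lra.
by rewrite ler_wpDr ?powR_ge0//; apply: le_powR => //; lra.
Qed.

(** The graph of [x^q] lies above its tangent at [y]. For [q > 1] this is Young's inequality with
    exponents [q] and [q / (q - 1)], cleared of denominators. *)
Lemma young_powR q x y : 1 <= q -> 0 <= x -> 0 <= y ->
  q * (x * y `^ (q - 1)) <= x `^ q + (q - 1) * y `^ q.
Proof.
rewrite le_eqVlt => /predU1P[<- x0 y0|q1 x0 y0].
  by rewrite subrr powRr0 mulr1 mul1r mul0r addr0 powRr1.
have q0 : 0 < q by lra.
have qm : 0 < q - 1 by lra.
have := @conjugate_powR _ x (y `^ (q - 1)) q (q / (q - 1)) x0 (powR_ge0 _ _) q0.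
rewrite divr_gt0// => /(_ isT).
have -> : q^-1 + (q / (q - 1))^-1 = 1 by field; rewrite !gt_eqF.
have -> : (y `^ (q - 1)) `^ (q / (q - 1)) = y `^ q.
  by rewrite -powRrM mulrCA divff ?gt_eqF// mulr1.
move=> /(_ erefl) /(ler_wpM2l (ltW q0)) /le_trans; apply.
rewrite le_eqVlt; apply/orP; left; apply/eqP; field; rewrite !gt_eqF//.
Qed.

(** The integral of [t d(t^(q-1))] from [y] to [x] equals [(q-1)/q (x^q - y^q)]; it is compared with
    the one-step Riemann sum taken at [x], and in the next lemma at [y]. The two statements are
    Young's inequality with the roles of [x] and [y] exchanged. *)
Lemma powR_sub_ge q x y : 1 <= q -> 0 <= x -> 0 <= y ->
  (q - 1) * (x `^ q - y `^ q) <= q * (x * (x `^ (q - 1) - y `^ (q - 1))).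
Proof.
move=> q1 x0 y0; rewrite [x * (_ - _)]mulrBr mulr_powRB1 ?(lt_le_trans _ q1)//.
by have := young_powR q1 x0 y0; lra.
Qed.

Lemma powR_sub_le q x y : 1 <= q -> 0 <= x -> 0 <= y ->
  q * (y * (x `^ (q - 1) - y `^ (q - 1))) <= (q - 1) * (x `^ q - y `^ q).
Proof.
move=> q1 x0 y0; rewrite [y * (_ - _)]mulrBr mulr_powRB1 ?(lt_le_trans _ q1)//.
by have := young_powR q1 y0 x0; lra.
Qed.

Lemma powR_addl q a b : 1 <= q -> 0 <= a -> 0 <= b ->
  (a + b) `^ q <= a `^ q + q * (b * (a + b) `^ (q - 1)).
Proof.
move=> q1 a0 b0; have ab0 : 0 <= a + b by rewrite addr_ge0.
have := young_powR q1 a0 ab0.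
have /(congr1 (fun z => q * z)) : (a + b) * (a + b) `^ (q - 1) = (a + b) `^ q.
  by rewrite mulr_powRB1// (lt_le_trans _ q1).
lra.
Qed.

(* Increments of [t |-> t^r] dominate those of the Riemann sum of [r t^(r-1)]
   taken at the right endpoint. *)
Lemma concave_powR_sub r a b : 0 < r <= 1 -> 0 <= a -> a <= b -> 0 < b ->
  r * ((b - a) * b `^ (r - 1)) <= b `^ r - a `^ r.
Proof.
move=> /andP[r0 r1] a0 ab b0; have q1 : 1 <= r^-1 by rewrite invf_ge1.
have := young_powR q1 (powR_ge0 a r) (powR_ge0 b r).
rewrite !powRK ?(ltW b0)// -powRrM.
have -> : r * (r^-1 - 1) = 1 - r by field; rewrite gt_eqF.
have bb : b `^ (1 - r) * b `^ (r - 1) = 1.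
  rewrite -powRD; last by rewrite (gt_eqF b0) implybT.
  by rewrite (_ : 1 - r + (r - 1) = 0) ?powRr0//; lra.
have bb2 : b * b `^ (r - 1) = b `^ r by rewrite mulr_powRB1// ltW.
move=> /(ler_wpM2l (ltW r0)) /(ler_wpM2r (powR_ge0 b (r - 1))).
have -> : r * (r^-1 * (a `^ r * b `^ (1 - r))) * b `^ (r - 1) =
    a `^ r * (b `^ (1 - r) * b `^ (r - 1)) by field; rewrite gt_eqF.
have -> : r * (a + (r^-1 - 1) * b) * b `^ (r - 1) =
    r * a * b `^ (r - 1) + (1 - r) * (b * b `^ (r - 1)) by field; rewrite gt_eqF.
rewrite bb bb2 -[in X in _ -> _ <= X]bb2; have := congr1 (fun z => r * z) bb2 => /=.
move: bb2; lra.
Qed.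

End real_inequalities.

(** * Running maxima and a pathwise Doob inequality *)

Section running_maximum.
Context {R : realType}.
Implicit Types (u : nat -> R).

Fixpoint rmax u k : R :=
  if k is k'.+1 then Num.max (rmax u k') (u k) else u 0.

Lemma rmax_ge u i k : (i <= k)%N -> u i <= rmax u k.
Proof.
elim: k => [|k IH]; first by rewrite leqn0 => /eqP ->.
by rewrite leq_eqVlt => /predU1P[->|/IH ui] /=; rewrite le_max ?lexx ?orbT ?ui.
Qed.

Lemma rmax_ndecr u i k : (i <= k)%N -> rmax u i <= rmax u k.
Proof.
elim: k => [|k IH]; first by rewrite leqn0 => /eqP ->.
by rewrite leq_eqVlt => /predU1P[->//|/IH ui] /=; rewrite le_max ui.
Qed.

Lemma rmax_ex u k : exists2 i, (i <= k)%N & u i = rmax u k.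
Proof.
elim: k => [|k [i ik e]] /=; first by exists 0%N.
have [h|h] := leP (u k.+1) (rmax u k); first by exists i => //; exact: leqW.
by exists k.+1.
Qed.

Lemma rmax_ge0 u k : (forall i, 0 <= u i) -> 0 <= rmax u k.
Proof. by move=> u0; rewrite (le_trans (u0 k))// rmax_ge. Qed.

Lemma rmax_le u k r : (forall i, (i <= k)%N -> u i <= r) -> rmax u k <= r.
Proof. by move=> h; have [i ik <-] := rmax_ex u k; exact: h. Qed.

(** By induction on [n]: when no new maximum is reached both sides grow by the same term, and at a
    new maximum [powR_sub_ge] applies with [x = u n.+1]. For a nonnegative submartingale the two
    sums compare in expectation and leave Doob's inequality. Both sums are kept with a plus sign so
    that both sides can be integrated as nonnegative functions. *)
Lemma doob_pathwise q u n : 1 <= q -> (forall i, 0 <= u i) -> u 0 = 0 ->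
  (q - 1) * rmax u n `^ q + q * \sum_(k < n) rmax u k `^ (q - 1) * u k.+1 <=
  q * (rmax u n `^ (q - 1) * u n) + q * \sum_(k < n) rmax u k `^ (q - 1) * u k.
Proof.
move=> q1 u0 u00; elim: n => [|n IH].
  by rewrite !big_ord0 /= u00 powR0 ?mulr0 ?addr0//; lra.
rewrite !big_ord_recr /=.
have Mn0 := rmax_ge0 n u0.
have [h|h] := leP (u n.+1) (rmax u n); first by move: IH; lra.
have := powR_sub_ge q1 (u0 n.+1) Mn0.
by move: IH; lra.
Qed.

End running_maximum.

(** * Deterministic comparison of a sequence with its transforms *)

Section martingale_transforms.
Context {R : realType} {Y : normedModType R}.
Implicit Types (f : nat -> Y).

Definition transform (w : nat -> R) f k : Y :=
  \sum_(i < k) w i *: (f i.+1 - f i).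

(* Abel summation: [g_k = M_k^(q-1) f_k - sum_(i <= k) (M_i^(q-1) - M_(i-1)^(q-1)) f_i],
   and the last sum is an upper Riemann sum of [t d(t^(q-1))]. *)
Lemma rmax_transform q f n D G : 1 <= q -> f 0 = 0 -> 0 <= D ->
  (forall k, (k < n)%N -> `|f k.+1 - f k| <= D) ->
  let M := rmax (fun k => `|f k|) in
  (forall k, (k <= n)%N -> `|transform (fun k => M k `^ (q - 1)) f k| <= G) ->
  M n `^ q <= q * G + q * (D * M n `^ (q - 1)).
Proof.
move=> q1 f0 D0 fD M hG; set w := fun k => M k `^ (q - 1).
have M0 k : 0 <= M k by apply: rmax_ge0.
have MD k : (k < n)%N -> M k.+1 - M k <= D.
  move=> kn; rewrite lerBlDr /M /= ge_max; apply/andP; split; first by rewrite lerDr.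
  rewrite -(subrK (f k) (f k.+1)); apply: (le_trans (ler_normD _ _)).
  by apply: lerD; [exact: fD|exact: (rmax_ge (fun k => `|f k|))].
have wm k : w k <= w k.+1.
  by apply: le_powR => //; [lra|exact: rmax_ndecr].
(* The remainder of the Abel summation. Replacing [M k.+1] by [M k] in each term turns the upper
   Riemann sum into a lower one, which [powR_sub_le] bounds; the replacement costs at most [D] per
   unit of increase of [w], hence [D * w k] in total. *)
have main k : (k <= n)%N -> q * `|w k *: f k - transform w f k| <=
    (q - 1) * M k `^ q + q * (D * w k).
  elim: k => [_|k IH kn].
    rewrite /transform big_ord0 f0 scaler0 subr0 normr0 mulr0.
    by rewrite addr_ge0// ?mulr_ge0 ?powR_ge0//; lra.
  have -> : w k.+1 *: f k.+1 - transform w f k.+1 =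
      (w k *: f k - transform w f k) + (w k.+1 - w k) *: f k.+1.
    rewrite /transform big_ord_recr /= scalerBr scalerBl opprD opprB.
    rewrite -/(transform w f k) addrA [LHS]addrACA [RHS]addrACA.
    by rewrite [w k *: f k + _]addrC.
  have q0 : 0 <= q by lra.
  apply: (@le_trans _ _ (q * `|w k *: f k - transform w f k| +
      q * ((w k.+1 - w k) * M k.+1))).
    rewrite -mulrDr ler_wpM2l//; apply: (le_trans (ler_normD _ _)).
    rewrite lerD2l normrZ ger0_norm ?subr_ge0//; apply: ler_wpM2l.
      by rewrite subr_ge0.
    exact: (rmax_ge (fun k => `|f k|)).
  have := IH (ltnW kn); have := powR_sub_le q1 (M0 k.+1) (M0 k).
  have : q * ((w k.+1 - w k) * (M k.+1 - M k)) <= q * ((w k.+1 - w k) * D).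
    by rewrite ler_wpM2l// ler_wpM2l ?subr_ge0// MD.
  rewrite -/(w k) -/(w k.+1); lra.
(* At the index where the maximum is attained, [w k * |f k|] is exactly [M n ^ q], so the term
   [(q - 1) * M n ^ q] of [main] leaves one copy of [M n ^ q]. *)
have [k kn Mk] := rmax_ex (fun k => `|f k|) n.
have MkM : M k = M n.
  apply/eqP; rewrite eq_le rmax_ndecr// [X in X <= _](_ : _ = `|f k|)//.
  exact: (rmax_ge (fun k => `|f k|)).
have := main k kn; have := hG k kn.
have : w k * `|f k| - `|transform w f k| <= `|w k *: f k - transform w f k|.
  by rewrite -[w k in X in X <= _](ger0_norm (powR_ge0 _ _)) -normrZ lerB_dist.
rewrite /w MkM -/M Mk -/(M n) mulrC mulr_powRB1//; last by lra.
have q0 : 0 <= q by lra.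
move=> h1 h2 h3; have := ler_wpM2l q0 h1; have := ler_wpM2l q0 h2.
rewrite mulrBr; lra.
Qed.

(** Multiplying the transform back by the weights, Abel summation gives [f_(k+1) = b_k g_(k+1) - sum
    (b_(i+1) - b_i) g_(i+1)]. As [b] is nondecreasing and positive, each of the two terms is at most
    [b_k G]. *)
Lemma norm_transform_inv (b : nat -> R) f n G : f 0 = 0 ->
  (forall k, 0 < b k) -> (forall k, b k <= b k.+1) ->
  (forall k, (k <= n)%N -> `|transform (fun k => (b k)^-1) f k| <= G) ->
  forall k, (k < n)%N -> `|f k.+1| <= 2 * (b k * G).
Proof.
move=> f0 b0 bm hG k kn; set g := transform _ f in hG.
have gS i : b i *: (g i.+1 - g i) = f i.+1 - f i.
  rewrite /g /transform big_ord_recr /= addrAC subrr add0r scalerA.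
  by rewrite divff ?scale1r ?gt_eqF.
have main : `|f k.+1 - b k *: g k.+1| <= b k * G.
  elim: k kn => [|k IH] kn.
    have := gS 0%N; rewrite f0 subr0 [g 0%N]big_ord0 subr0 => ->.
    rewrite subrr normr0 mulr_ge0//; first exact: ltW.
    exact: le_trans (normr_ge0 _) (hG 0%N _).
  have -> : f k.+2 - b k.+1 *: g k.+2 =
      (f k.+1 - b k *: g k.+1) - (b k.+1 - b k) *: g k.+1.
    have -> : f k.+2 = f k.+1 + (b k.+1 *: g k.+2 - b k.+1 *: g k.+1).
      by rewrite -scalerBr gS addrC subrK.
    by rewrite scalerBl opprB [RHS]addrA subrK -addrA [_ - _ - _]addrAC subrr add0r.
  apply: (le_trans (ler_normB _ _)); rewrite normrZ ger0_norm ?subr_ge0//.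
  have := IH (ltnW kn); have := ler_wpM2l _ (hG k.+1 (ltnW kn)).
  by move=> /(_ (b k.+1 - b k)); rewrite subr_ge0 bm => /(_ isT); lra.
have -> : f k.+1 = (f k.+1 - b k *: g k.+1) + b k *: g k.+1 by rewrite subrK.
apply: (le_trans (ler_normD _ _)); rewrite normrZ gtr0_norm//.
have := ler_wpM2l (ltW (b0 k)) (hG k.+1 kn); lra.
Qed.

End martingale_transforms.

(** * An adapted substitute for the norm of [l^s + l^p] *)

Section adapted_level.
Context {R : realType} (s p : R) (hps : 1 <= p <= s).
Implicit Types (h x : nat -> R) (K : R).

Let p1 : 1 <= p. Proof. by have /andP[] := hps. Qed.
Let ps : p <= s. Proof. by have /andP[] := hps. Qed.
Let p0 : 0 < p. Proof. by have := p1; lra. Qed.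
Let s1 : 1 <= s. Proof. by have := p1; have := ps; lra. Qed.
Let s0 : 0 < s. Proof. by have := s1; lra. Qed.

(* [level h x c] is comparable with the norm of [x_0, ..., x_(c-1)] in
   [l^s + l^p] (with weights [h]), but its recursion only looks at the past;
   [x_c] goes to the [l^s] part when it is below the current level. *)
Fixpoint level h x c : R :=
  if c is c'.+1 then
    let L := level h x c' in
    if x c' <= L then (L `^ s + h c' * x c' `^ s) `^ s^-1
    else (L `^ p + h c' * x c' `^ p) `^ p^-1 + h c' * x c'
  else 0.

Lemma levelS h x c : level h x c.+1 =
  if x c <= level h x c then (level h x c `^ s + h c * x c `^ s) `^ s^-1
  else (level h x c `^ p + h c * x c `^ p) `^ p^-1 + h c * x c.
Proof. by []. Qed.

Arguments level : simpl never.

Lemma level_ge0 h x c : (forall c, 0 <= h c) -> (forall c, 0 <= x c) ->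
  0 <= level h x c.
Proof.
move=> h0 x0; elim: c => // c IH; rewrite levelS; case: ifPn => _; first exact: powR_ge0.
by rewrite addr_ge0 ?powR_ge0// mulr_ge0.
Qed.

Variables (h x : nat -> R).
Hypotheses (h0 : forall c, 0 <= h c) (x0 : forall c, 0 <= x c).
Local Notation L := (level h x).

Let L0 c : 0 <= L c. Proof. exact: level_ge0. Qed.

Let small_step c : x c <= L c -> L c.+1 `^ s = L c `^ s + h c * x c `^ s.
Proof.
by move=> xL; rewrite levelS xL powRVK// addr_ge0 ?mulr_ge0 ?powR_ge0.
Qed.

Let large_eq c : L c < x c ->
  L c.+1 = (L c `^ p + h c * x c `^ p) `^ p^-1 + h c * x c.
Proof. by move=> Lx; rewrite levelS leNgt Lx. Qed.

Let large_step c : L c < x c -> L c `^ p + h c * x c `^ p <= L c.+1 `^ p.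
Proof.
move=> Lx; rewrite large_eq//; set A := _ + _ * _ `^ p.
have A0 : 0 <= A by rewrite addr_ge0 ?mulr_ge0 ?powR_ge0.
rewrite -[leLHS](powRVK p0 A0); apply: le_powR; rewrite ?powR_ge0 ?(ltW p0)//.
by rewrite lerDl mulr_ge0.
Qed.

Lemma level_ndecr c : L c <= L c.+1.
Proof.
have [xL|Lx] := leP (x c) (L c).
  rewrite -(powRK s0 (L0 c)) -(powRK s0 (L0 c.+1)) small_step//.
  apply: le_powR; rewrite ?powR_ge0 ?invr_ge0 ?(ltW s0)//.
  by rewrite lerDl mulr_ge0 ?powR_ge0.
rewrite -(powRK p0 (L0 c)) -(powRK p0 (L0 c.+1)).
apply: le_powR; rewrite ?powR_ge0 ?invr_ge0 ?(ltW p0)//.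
by apply: le_trans (large_step Lx); rewrite lerDl mulr_ge0 ?powR_ge0.
Qed.

(** Small steps raise the [s]-th power of the level by exactly the summand, and the other steps do
    not lower it. The next lemma is the same argument with [p]-th powers and large steps. *)
Lemma level_small n :
  \sum_(c < n) (x c <= L c)%R%:R * (h c * x c `^ s) <= L n `^ s.
Proof.
elim: n => [|n IH]; first by rewrite big_ord0 powR_ge0.
rewrite big_ord_recr /=; have [xL|Lx] := leP (x n) (L n).
  by rewrite small_step// mul1r lerD2r.
rewrite mul0r addr0 (le_trans IH)//.
by apply: le_powR; rewrite ?(ltW s0)// level_ndecr.
Qed.

Lemma level_large n :
  \sum_(c < n) (L c < x c)%R%:R * (h c * x c `^ p) <= L n `^ p.
Proof.
elim: n => [|n IH]; first by rewrite big_ord0 powR_ge0.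
rewrite big_ord_recr /=; have [Lx|xL] := ltP (L n) (x n).
  by rewrite mul1r (le_trans _ (large_step Lx))// lerD2r.
rewrite mul0r addr0 (le_trans IH)//.
by apply: le_powR; rewrite ?(ltW p0)// level_ndecr.
Qed.

(** This estimate is the reason for the extra summand [h c * x c] in a large step: the [p]-th moment
    of a Poisson sum is governed by the weighted [l^1] norm of its coefficients together with their
    [l^p] norm. *)
Lemma level_large1 n : \sum_(c < n) (L c < x c)%R%:R * (h c * x c) <= L n.
Proof.
elim: n => [|n IH]; first by rewrite big_ord0.
rewrite big_ord_recr /=; have [Lx|xL] := ltP (L n) (x n).
  rewrite mul1r large_eq//; apply: lerD => //; apply: (le_trans IH).
  rewrite -[leLHS](powRK p0)//; apply: le_powR; rewrite ?powR_ge0//.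
    by rewrite invr_ge0 ltW.
  by rewrite lerDl mulr_ge0 ?powR_ge0.
by rewrite mul0r addr0 (le_trans IH)// level_ndecr.
Qed.

(** Since [p <= s], this is the minimum of the two powers of [y / K]. Its weighted sum is the
    modular describing the unit ball of [l^s + l^p] at scale [K]. *)
Definition modular K y : R := if y <= K then (y / K) `^ s else (y / K) `^ p.

Lemma modular_ge0 K y : 0 <= modular K y.
Proof. by rewrite /modular; case: ifPn => _; exact: powR_ge0. Qed.

Let powR_le_modular (K T y : R) : 0 < K -> 0 <= y -> y <= T -> K <= T ->
  y `^ s <= T `^ s * modular K y.
Proof.
move=> K0 y0 yT KT; have T0 : 0 < T by lra.
rewrite /modular; case: ifPn => [yK|].
  rewrite -powRM ?divr_ge0 ?(ltW K0)// ?(ltW T0)//.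
  apply: le_powR; rewrite ?(ltW s0)// mulrCA ler_peMr// ler_pdivlMr// mul1r//.
rewrite -ltNge => Ky; have y0' : 0 < y by lra.
have -> : y = T * (y / T) by field; rewrite gt_eqF.
rewrite powRM ?divr_ge0 ?(ltW T0)//.
apply: ler_wpM2l; first exact: powR_ge0.
have -> : T * (y / T) = y by field; rewrite gt_eqF.
apply: (@le_trans _ _ ((y / T) `^ p)).
  by apply: ger_powR => //; rewrite divr_gt0// ler_pdivrMr// mul1r.
apply: le_powR; rewrite ?(ltW p0) ?divr_ge0 ?(ltW T0)//.
by rewrite ler_wpM2l// lef_pV2.
Qed.

(** One step of a discrete Gronwall inequality. The level is compared with the floor [3 * K],
    because below that floor a step may multiply the level by an arbitrarily large factor. *)
Let level_growth K c : 0 < K -> h c <= 1 ->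
  Num.max (L c.+1) (3 * K) <=
  Num.max (L c) (3 * K) * (1 + 2 * (h c * modular K (x c))).
Proof.
move=> K0 hc1; set T := Num.max (L c) _.
have KT : 3 * K <= T by rewrite le_max lexx orbT.
have LT : L c <= T by rewrite le_max lexx.
have T0 : 0 < T by lra.
have F0 := modular_ge0 K (x c); have hF0 : 0 <= h c * modular K (x c) by rewrite mulr_ge0.
have grow : T <= T * (1 + 2 * (h c * modular K (x c))).
  by rewrite ler_peMr//; lra.
rewrite ge_max (le_trans KT grow) andbT.
have [xL|Lx] := leP (x c) (L c).
  rewrite -(powRK s0 (L0 c.+1)) small_step//.
  set e := h c * _ in hF0 grow *.
  rewrite -[leRHS](@powRK _ s)//; last by rewrite mulr_ge0 ?(ltW T0)//; lra.
  apply: le_powR; rewrite ?invr_ge0 ?(ltW s0)// ?addr_ge0 ?mulr_ge0 ?powR_ge0//.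
  apply: (@le_trans _ _ (T `^ s * (1 + e))).
    rewrite mulrDr mulr1; apply: lerD; first exact: le_powR (ltW s0) _ _.
    rewrite /e mulrCA ler_wpM2l//.
    by apply: powR_le_modular => //; [exact: le_trans LT|lra].
  rewrite powRM ?(ltW T0)//; last by lra.
  rewrite ler_wpM2l ?powR_ge0//; apply: (@le_trans _ _ (1 + 2 * e)); first by lra.
  by apply: le1r_powR => //; lra.
(* When [L c < x c <= K] and [h c <= 1], the root in the large step is at most [2 * K] and the extra
   summand at most [K]. This is where the floor [3 * K] comes from. *)
rewrite large_eq//; have [xK|Kx] := leP (x c) K.
  apply: (le_trans _ grow); apply: (le_trans _ KT).
  have -> : 3 * K = 2 * K + K by lra.
  apply: lerD; last by rewrite -[leRHS]mul1r ler_pM.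
  rewrite -[leRHS](@powRK _ p)//; last by lra.
  apply: le_powR; rewrite ?invr_ge0 ?(ltW p0)// ?addr_ge0 ?mulr_ge0 ?powR_ge0//.
  rewrite powRM ?(ltW K0)//.
  apply: (@le_trans _ _ (2 * K `^ p)).
    have -> : 2 * K `^ p = K `^ p + K `^ p by lra.
    apply: lerD; first by apply: le_powR; rewrite ?(ltW p0)//; lra.
    rewrite -[leRHS]mul1r ler_pM ?powR_ge0//.
    by apply: le_powR; rewrite ?(ltW p0).
  by rewrite ler_wpM2r ?powR_ge0//; apply: le1r_powR => //; lra.
have F_ge : x c `^ p <= T `^ p * modular K (x c).
  rewrite /modular (lt_geF Kx) -powRM ?divr_ge0 ?(ltW T0) ?(ltW K0)//.
  apply: le_powR; rewrite ?(ltW p0)// mulrCA ler_peMr// ler_pdivlMr// mul1r//.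
  by lra.
have F_ge1 : x c <= T * modular K (x c).
  rewrite /modular (lt_geF Kx); apply: (@le_trans _ _ (T * (x c / K))).
    by rewrite mulrCA ler_peMr// ler_pdivlMr// mul1r; lra.
  rewrite ler_wpM2l ?(ltW T0)//; apply: le1r_powR => //.
  by rewrite ler_pdivlMr// mul1r ltW.
(* The factor [1 + 2 * e] pays once for the root and once for the extra summand of a large step. *)
set e := h c * _ in hF0 grow *.
have -> : T * (1 + 2 * e) = T * (1 + e) + T * e by ring.
apply: lerD; last by rewrite /e mulrCA ler_wpM2l.
rewrite -[leRHS](@powRK _ p)//; last by rewrite mulr_ge0 ?(ltW T0)//; lra.
apply: le_powR; rewrite ?invr_ge0 ?(ltW p0)// ?addr_ge0 ?mulr_ge0 ?powR_ge0//.
apply: (@le_trans _ _ (T `^ p * (1 + e))).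
  rewrite mulrDr mulr1; apply: lerD; first exact: le_powR (ltW p0) _ _.
  by rewrite /e mulrCA ler_wpM2l.
rewrite powRM ?(ltW T0)//; last by lra.
by rewrite ler_wpM2l ?powR_ge0//; apply: le1r_powR => //; lra.
Qed.

(** Iterating [level_growth] and using [1 + y <= expR y]. The statement is pathwise and [K] is any
    positive number, so it can later be evaluated at a random [K] that looks into the future. *)
Lemma level_le K n : 0 < K -> (forall c, (c < n)%N -> h c <= 1) ->
  L n <= 3 * K * expR (2 * \sum_(c < n) h c * modular K (x c)).
Proof.
move=> K0 h1; apply: (@le_trans _ _ (Num.max (L n) (3 * K))).
  by rewrite le_max lexx.
elim: n h1 => [|n IH] h1.
  by rewrite big_ord0 mulr0 expR0 mulr1 max_r// /level; lra.
apply: (le_trans (level_growth K0 (h1 _ _))) => //.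
rewrite big_ord_recr /= [2 * (\sum_(_ < _) _ + _)]mulrDr expRD [leRHS]mulrA ler_pM//.
- by rewrite le_max L0.
- by rewrite addr_ge0// !mulr_ge0// modular_ge0.
- by apply: IH => c cn; apply: h1; rewrite ltnS ltnW.
- exact: expR_ge1Dx.
Qed.

(** The larger of [y0] and [y1] is at least [y / 2]. Being the minimum of the two powers, the
    modular may be estimated by whichever power belongs to that part, and doubling costs at most
    [2^s]. *)
Lemma modular_le_sum K y y0 y1 : 0 < K -> 0 <= y -> 0 <= y0 -> 0 <= y1 ->
  y <= y0 + y1 -> modular K y <= 2 `^ s * ((y0 / K) `^ s + (y1 / K) `^ p).
Proof.
move=> K0 yge0 y00 y10 yy.
have d z : 0 <= z -> 0 <= z / K by move=> ?; rewrite divr_ge0// ltW.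
have dbl z r : 0 <= r -> r <= s -> 0 <= z -> y <= 2 * z ->
    (y / K) `^ r <= 2 `^ s * (z / K) `^ r.
  move=> r0 rs z0 yz; apply: (@le_trans _ _ ((2 * (z / K)) `^ r)).
    by apply: le_powR => //; [exact: d|rewrite mulrA ler_wpM2r// invr_ge0 ltW].
  rewrite powRM ?d// ler_wpM2r ?powR_ge0//; apply: ler_powR => //; lra.
rewrite mulrDr /modular; have [yK|Ky] := leP y K.
  have [y01|y10'] := leP y0 y1.
    rewrite ler_wpDl ?mulr_ge0 ?powR_ge0//; apply: (@le_trans _ _ ((y / K) `^ p)).
      have [->|yn0] := eqVneq y 0; first by rewrite mul0r !powR0 ?gt_eqF.
      have y_gt0 : 0 < y by rewrite lt_def yn0.
      apply: ger_powR => //; rewrite divr_gt0//=.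
      by rewrite ler_pdivrMr// mul1r.
    by apply: dbl => //; [exact: ltW p0|lra].
  by rewrite ler_wpDr ?mulr_ge0 ?powR_ge0//; apply: dbl => //; [exact: ltW s0|lra].
have [y01|y10'] := leP y0 y1.
  by rewrite ler_wpDl ?mulr_ge0 ?powR_ge0//; apply: dbl => //; [exact: ltW p0|lra].
rewrite ler_wpDr ?mulr_ge0 ?powR_ge0//; apply: (@le_trans _ _ ((y / K) `^ s)).
  by apply: ler_powR => //; rewrite ler_pdivlMr// mul1r ltW.
by apply: dbl => //; [exact: ltW s0|lra].
Qed.

End adapted_level.

(** * Strongly measurable functions *)

Section simple_functions.
Context {R : realType} d (T : measurableType d).

(** Same content as [simple_fun measurable], but the target is an arbitrary type, so that pairs and
    booleans can be used as intermediate values. *)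
Definition finitely_valued (A : Type) (f : T -> A) : Prop :=
  finite_set (range f) /\ forall x, measurable (f @^-1` [set x]).

Lemma finitely_valued_preimage (A : Type) (f : T -> A) (V : set A) :
  finitely_valued f -> measurable (f @^-1` V).
Proof.
move=> [fr mf]; have -> : f @^-1` V = \bigcup_(a in range f `&` V) (f @^-1` [set a]).
  apply/seteqP; split => [x Vx|x [a [_ Va] /= ->//]].
  by exists (f x) => //; split=> //; exists x.
by apply: fin_bigcup_measurable => [|a _]; [exact: finite_setIl|exact: mf].
Qed.

Lemma finitely_valued_cst (A : Type) (a : A) : finitely_valued (fun=> a).
Proof.
split=> [|x]; last by rewrite preimage_cst; case: ifPn.
by apply: (@sub_finite_set _ _ [set a]) => // _ [x _ <-].
Qed.

Lemma finitely_valued2 (A B C : Type) (op : A -> B -> C) f g :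
  finitely_valued f -> finitely_valued g ->
  finitely_valued (fun x => op (f x) (g x)).
Proof.
move=> ff fg; have [fr _] := ff; have [gr _] := fg; split.
  apply: (sub_finite_set _ (finite_image2 op fr gr)) => _ [x _ <-].
  by exists (f x); [exists x|exists (g x) => //; exists x].
move=> c; have -> : (fun x => op (f x) (g x)) @^-1` [set c] =
   \bigcup_(a in range f) (f @^-1` [set a] `&` g @^-1` [set b | op a b = c]).
  apply/seteqP; split=> [x /= <-|x [a _ [/= -> //]]].
  by exists (f x) => //; exists x.
apply: fin_bigcup_measurable => // a _.
by apply: measurableI; exact: finitely_valued_preimage.
Qed.

Lemma finitely_valued_comp (A B : Type) (h : A -> B) (f : T -> A) :
  finitely_valued f -> finitely_valued (h \o f).
Proof.
by move=> ff; exact: (finitely_valued2 (fun a _ => h a) ff (finitely_valued_cst tt)).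
Qed.

Lemma finitely_valued_if (A : Type) (D : T -> bool) (f g : T -> A) :
  measurable_fun setT D -> finitely_valued f -> finitely_valued g ->
  finitely_valued (fun x => if D x then f x else g x).
Proof.
move=> mD ff fg.
have fD : finitely_valued D.
  by split=> [//|b]; rewrite -[X in measurable X]setTI; exact: mD.
have := finitely_valued2 (fun (b : bool) (ac : A * A) => if b then ac.1 else ac.2)
  fD (finitely_valued2 pair ff fg).
by [].
Qed.

Lemma finitely_valued_mfun (f : T -> R) : finitely_valued f -> measurable_fun setT f.
Proof. by move=> ff _ V mV; rewrite setTI; exact: finitely_valued_preimage. Qed.

Import HBSimple.

Lemma finitely_valued_approx (g : T -> R) : measurable_fun setT g ->
  exists2 g_ : nat -> T -> R, forall n, finitely_valued (g_ n) &
    forall x, g_ n x @[n --> \oo] --> g x.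
Proof.
move=> mg; have /approximation_sfun -/(_ measurableT) [h hg] :
    measurable_fun setT (EFin \o g) by exact: measurableT_comp.
exists (fun n => h n) => [n|x].
  by split=> // y; exact: measurable_sfunP.
by have := hg x I; move/fine_cvgP => [_].
Qed.

End simple_functions.

Section strongly_measurable_functions.
Context {R : realType} d (T : measurableType d).
Implicit Types (X : completeNormedModType R).
Local Notation sm := (strongly_measurable measurable).

Lemma strongly_measurable_simple X (f : T -> X) : finitely_valued f -> sm f.
Proof. by move=> ff; exists (fun=> f); split=> // w; exact: cvg_cst. Qed.

Lemma strongly_measurable_cst X (x : X) : sm (fun _ : T => x).
Proof. exact/strongly_measurable_simple/finitely_valued_cst. Qed.

Lemma strongly_measurableD X (f g : T -> X) : sm f -> sm g ->
  sm (fun w => f w + g w).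
Proof.
move=> [f_ [ff fc]] [g_ [gf gc]]; exists (fun n w => f_ n w + g_ n w).
by split=> [n|w]; [exact: (finitely_valued2 +%R (ff n) (gf n))|apply: cvgD; [exact: fc|exact: gc]].
Qed.

Lemma strongly_measurableN X (f : T -> X) : sm f -> sm (fun w => - f w).
Proof.
move=> [f_ [ff fc]]; exists (fun n w => - f_ n w).
by split=> [n|w]; [exact: (finitely_valued_comp -%R (ff n))|apply: cvgN; exact: fc].
Qed.

Lemma strongly_measurableB X (f g : T -> X) : sm f -> sm g ->
  sm (fun w => f w - g w).
Proof. by move=> sf sg; apply: strongly_measurableD => //; exact: strongly_measurableN. Qed.

Lemma strongly_measurableZ X (g : T -> R) (f : T -> X) :
  measurable_fun setT g -> sm f -> sm (fun w => g w *: f w).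
Proof.
move=> /finitely_valued_approx[g_ gf gc] [f_ [ff fc]].
exists (fun n w => g_ n w *: f_ n w).
split=> [n|w]; first exact: (finitely_valued2 (fun (a : R) (x : X) => a *: x) (gf n) (ff n)).
by apply: cvgZ; [exact: gc|exact: fc].
Qed.

Lemma strongly_measurable_sum X (I : Type) (r : seq I) (f : I -> T -> X) :
  (forall i, sm (f i)) -> sm (fun w => \sum_(i <- r) f i w).
Proof.
move=> sf; elim: r => [|i r IH].
  rewrite (_ : (fun _ => _) = fun=> 0); first exact: strongly_measurable_cst.
  by apply/funext => w; rewrite big_nil.
rewrite (_ : (fun _ => _) = fun w => f i w + \sum_(j <- r) f j w).
  exact: strongly_measurableD.
by apply/funext => w; rewrite big_cons.
Qed.

Lemma strongly_measurable_norm X (f : T -> X) : sm f ->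
  measurable_fun setT (fun w => `|f w|).
Proof.
move=> [f_ [ff fc]].
apply: (@measurable_fun_cvg _ _ _ _ (fun n w => `|f_ n w|)) => //.
  move=> n; apply: finitely_valued_mfun.
  exact: (finitely_valued_comp (fun x : X => `|x|) (ff n)).
by move=> w _; apply: cvg_norm; exact: fc.
Qed.

(* No separability is assumed on [X]: at each point the [n]-th approximant is
   the best one among the first [n] simple functions of an enumeration of all
   the simple functions approximating all the [f_ n]. *)
Lemma strongly_measurable_lim X (f_ : nat -> T -> X) (f : T -> X) :
  (forall n, sm (f_ n)) -> (forall w, f_ n w @[n --> \oo] --> f w) -> sm f.
Proof.
move=> /choice[g gP] fc.
pose e i := if @unpickle (nat * nat)%type i is Some nk then g nk.1 nk.2 else fun=> 0.
have efin i : finitely_valued (e i).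
  rewrite /e; case: unpickle => [[n k]|]; last exact: finitely_valued_cst.
  exact: (gP n).1.
pose fix b i := if i is j.+1 then
  fun w => if `|f w - e j w| < `|f w - b j w| then e j w else b j w
  else fun=> (0 : X).
(* Strong measurability of [f] is the goal, but the distance from [f] to a simple function is
   already measurable, as a limit of distances from the [f_ n]. The comparisons that define [b] only
   use these distances. *)
have mnorm (h : T -> X) : finitely_valued h -> measurable_fun setT (fun w => `|f w - h w|).
  move=> fh; apply: (@measurable_fun_cvg _ _ _ _ (fun n w => `|f_ n w - h w|)) => //.
    move=> n; apply: strongly_measurable_norm.
    apply: strongly_measurableB; last exact: strongly_measurable_simple.
    by exists (g n).
  by move=> w _; apply: cvg_norm; apply: cvgB; [exact: fc|exact: cvg_cst].
have bfin i : finitely_valued (b i).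
  elim: i => [|i IH]; first exact: finitely_valued_cst.
  apply: (@finitely_valued_if _ _ _ (fun w => `|f w - e i w| < `|f w - b i w|)) => //.
  by apply: measurable_fun_ltr; exact: mnorm.
have bS i w : `|f w - b i.+1 w| <= `|f w - b i w| /\
    `|f w - b i.+1 w| <= `|f w - e i w|.
  by rewrite /=; case: ltP => // h; rewrite ltW.
have bmono i j w : (i <= j)%N -> `|f w - b j w| <= `|f w - b i w|.
  elim: j => [|j IH]; first by rewrite leqn0 => /eqP ->.
  rewrite leq_eqVlt => /predU1P[->//|/IH]; apply: le_trans.
  exact: (bS j w).1.
exists b; split=> [|w]; first exact: bfin.
apply/cvgrPdist_lt => r r0.
have r2 : 0 < r / 2 by rewrite divr_gt0.
have /cvgrPdist_lt/(_ _ r2)[n _ /(_ n (leqnn n)) fn] := fc w.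
have /cvgrPdist_lt/(_ _ r2)[k _ /(_ k (leqnn k)) gk] := (gP n).2 w.
have dist : `|f w - e (pickle (n, k)) w| < r.
  rewrite /e pickleK /= -(subrKA (f_ n w)).
  by rewrite (splitr r) (le_lt_trans (ler_normD _ _))// ltrD.
exists (pickle (n, k)).+1 => // i /= ki; apply: le_lt_trans dist.
by apply: le_trans (bS _ w).2; exact: bmono.
Qed.

(** An approximant is reset to 0 wherever its norm exceeds [2 * |f|]. Where [f] is nonzero this
    happens only finitely often, and where [f] vanishes the approximants become 0. The bound serves
    dominated convergence. *)
Lemma strongly_measurable_dom X (f : T -> X) : sm f ->
  exists f_ : nat -> T -> X, [/\ forall n, finitely_valued (f_ n),
    forall w, f_ n w @[n --> \oo] --> f w &
    forall n w, `|f_ n w| <= 2 * `|f w| ].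
Proof.
move=> sf; have [f_ [ff fc]] := sf.
have mn n : measurable_fun setT (fun w => `|f_ n w|).
  by apply: strongly_measurable_norm; apply: strongly_measurable_simple; exact: ff.
have mf := strongly_measurable_norm sf.
exists (fun n w => if `|f_ n w| <= 2 * `|f w| then f_ n w else 0); split.
- move=> n; apply: (@finitely_valued_if _ _ _ (fun w => `|f_ n w| <= 2 * `|f w|)) => //.
  + by apply: measurable_fun_ler => //; exact: measurable_funM.
  + exact: ff.
  + exact: finitely_valued_cst.
- move=> w; have [fw0|fw0] := eqVneq (f w) 0.
    rewrite fw0; under eq_fun do rewrite normr0 mulr0 normr_le0.
    rewrite (_ : (fun n => _) = fun=> 0); first exact: cvg_cst.
    by apply/funext => n; case: ifPn => // /eqP.
  apply: cvg_trans (fc w); apply: near_eq_cvg.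
  have fw : 0 < `|f w| by rewrite normr_gt0.
  have /cvgrPdist_lt/(_ _ fw) := fc w; apply: filterS => n fn.
  rewrite ifT//; have -> : f_ n w = f w - (f w - f_ n w) by rewrite opprB addrC subrK.
  apply: le_trans (ler_normB _ _) _.
  by rewrite mulr_natl mulr2n lerD2l ltW.
- by move=> n w; case: ifPn => // _; rewrite normr0 mulr_ge0.
Qed.

End strongly_measurable_functions.

Lemma strongly_measurable_sub {R : realType} (X : completeNormedModType R)
    (T : Type) (G G' : set (set T)) (f : T -> X) :
  G `<=` G' -> strongly_measurable G f -> strongly_measurable G' f.
Proof.
move=> GG' [f_ [ff fc]]; exists f_; split=> // n; split; first exact: (ff n).1.
by move=> x; apply: GG'; exact: (ff n).2.
Qed.

(** * Poisson moments *)

Section restricted_integrals.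
Context {R : realType} d (O : measurableType d) (P : {measure set O -> \bar R}).
Local Open Scope ereal_scope.

Lemma ge0_integral_mrestr (E : set O) (mE : measurable E) (f : O -> \bar R) :
  measurable_fun setT f -> (forall w, 0 <= f w) ->
  \int[mrestr P mE]_w f w = \int[P]_(w in E) f w.
Proof.
move=> mf f0; rewrite (@ge0_negligible_integral _ _ _ _ setT (~` E))//.
- rewrite setTD setCK; apply: eq_measure_integral => A mA AE.
  by rewrite /= /mrestr setIidl.
- exact: measurableC.
- by rewrite /= /mrestr setICl measure0.
Qed.

(** On the sub-sigma-algebra the measures [A |-> P (A]&[E)] and [r * P] coincide, hence so do the
    integrals of functions measurable for it. Both are transported there as images under the
    identity map. *)
Lemma integral_indep_event (gen : set (set O)) (E : set O) (r : R) :
  <<s gen >> `<=` measurable -> measurable E -> (0 <= r)%R ->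
  (forall A, <<s gen >> A -> P (A `&` E) = P A * r%:E) ->
  forall f : O -> \bar R,
    measurable_fun setT (f : g_sigma_algebraType gen -> \bar R) ->
    (forall w, 0 <= f w) ->
    \int[P]_(w in E) f w = r%:E * \int[P]_w f w.
Proof.
move=> sub mE r0 indep f mf f0.
pose idc : O -> g_sigma_algebraType gen := id.
have midc : measurable_fun setT idc by move=> _ B mB; rewrite setTI; exact: sub.
have mfO : measurable_fun setT f by move=> _ B mB; apply: sub; exact: mf.
rewrite -(ge0_integral_mrestr mE mfO f0).
have push (m : {measure set O -> \bar R}) :
    \int[m]_w f w = \int[pushforward m idc]_w f w.
  by rewrite (ge0_integral_pushforward midc).
rewrite !push.
have pm (m : {measure set O -> \bar R}) : exists m' : {measure set (g_sigma_algebraType gen) -> \bar R},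
    m' = pushforward m idc :> (set _ -> \bar R).
  by eexists; last by []; exact: midc.
have [m1 m1E] := pm (mrestr P mE).
have [m2 m2E] := pm P.
rewrite -m1E -m2E -(@ge0_integral_mscale _ _ _ m2 _ measurableT (NngNum r0))//.
apply: eq_measure_integral => A mA _.
rewrite m1E /mscale /pushforward /= /mrestr.
transitivity (r%:E * P A); first by rewrite muleC; exact: indep.
by congr (_ * _); rewrite [RHS](_ : _ = pushforward P idc A)// -m2E.
Unshelve. exact: midc.
Qed.

End restricted_integrals.

Section poisson_mass_theory.
Context {R : realType}.
Implicit Types (h : R).

Lemma poisson_mass_ge0 h k : 0 <= h -> 0 <= poisson_mass h k.
Proof.
by move=> h0; rewrite /poisson_mass !mulr_ge0 ?exprn_ge0 ?invr_ge0 ?expR_ge0.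
Qed.

Lemma poisson_massS h k : k.+1%:R * poisson_mass h k.+1 = h * poisson_mass h k.
Proof.
rewrite /poisson_mass exprS factS natrM invfM.
by field; rewrite pnatr_eq0 -lt0n fact_gt0 nat1r pnatr_eq0.
Qed.

Lemma poisson_mass_sum1 h : 0 <= h -> (\sum_(m <oo) (poisson_mass h m)%:E = 1)%E.
Proof.
move=> h0.
have : series (poisson_mass h) @ \oo --> (1 : R).
  rewrite [X in X @ _ --> _](_ : _ = fun n => series (exp_coeff h) n * expR (- h)).
    rewrite -(expRxMexpNx_1 h); apply: cvgMr_tmp.
    exact: is_cvg_series_exp_coeff.
  by apply/funext => n; rewrite /series /= mulr_suml.
move=> pc; apply/cvg_lim => //.
rewrite (_ : (fun n => _) = EFin \o series (poisson_mass h)); last first.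
  by apply/funext => n; rewrite /= sumEFin.
by apply: cvg_EFin => //; exact: nearW.
Qed.

Let pm0 h (k : R) m : 0 <= h -> 0 <= k -> (0 <= (k * poisson_mass h m)%:E)%E.
Proof. by move=> h0 k0; rewrite lee_fin mulr_ge0// poisson_mass_ge0. Qed.

Let pm1 h (k : R) m : 0 <= h -> 0 <= k ->
  (0 <= (k * (m%:R * poisson_mass h m))%:E)%E.
Proof.
move=> h0 k0; rewrite lee_fin; apply: mulr_ge0 => //; apply: mulr_ge0 => //.
exact: poisson_mass_ge0.
Qed.

(** The Stein-Chen identity [E (eta k(eta)) = h E k(eta + 1)]. Each use extracts a factor [h]. *)
Lemma poisson_mass_shift h (k : nat -> R) : 0 <= h -> (forall m, 0 <= k m) ->
  (\sum_(m <oo) (k m * (m%:R * poisson_mass h m))%:E =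
   h%:E * \sum_(m <oo) (k m.+1 * poisson_mass h m)%:E)%E.
Proof.
move=> h0 k0; rewrite nneseries_recl//; last first.
  by move=> m _; apply: pm1 => //; exact: k0.
rewrite mul0r mulr0 add0e -nneseries_addn; last first.
  by move=> m; apply: pm1 => //; exact: k0.
rewrite -nneseriesZl; last by move=> m _; apply: pm0 => //; exact: k0.
apply: eq_eseriesr => m _; rewrite addn1 poisson_massS.
by rewrite -EFinM mulrCA.
Qed.

Lemma poisson_mass_mean h : 0 <= h ->
  (\sum_(m <oo) (m%:R * poisson_mass h m)%:E = h%:E)%E.
Proof.
move=> h0; have := @poisson_mass_shift h (fun=> 1) h0 (fun=> ler01).
under eq_eseriesr do rewrite mul1r.
move=> ->; under eq_eseriesr do rewrite mul1r.
by rewrite poisson_mass_sum1// mule1.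
Qed.

(** By [E eta^(n+2) = h E (eta + 1)^(n+1)] and the induction hypothesis, with [h <= H] used for the
    remaining factor. The bound has to be linear in [h], so that summing over small cells gives an
    integral against the intensity. *)
Lemma poisson_mass_moment_nat (H : R) n : 0 <= H ->
  exists2 K : R, 0 <= K & forall h, 0 <= h <= H ->
  (\sum_(m <oo) (m%:R ^+ n.+1 * poisson_mass h m)%:E <= (K * h)%:E)%E.
Proof.
move=> H0; elim: n => [|n [K K0 IH]].
  exists 1 => // h /andP[h0 _]; rewrite mul1r.
  by under eq_eseriesr do rewrite expr1; rewrite poisson_mass_mean.
exists (2 ^+ n.+1 * (K * H + 1)) => [|h h01].
  by rewrite mulr_ge0 ?exprn_ge0// addr_ge0// mulr_ge0.
have /andP[h0 h1] := h01.
under eq_eseriesr do rewrite exprSr -mulrA.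
rewrite poisson_mass_shift//.
rewrite [X in (_ <= X%:E)%E]mulrC EFinM; apply: lee_wpmul2l; first by rewrite lee_fin.
apply: (@le_trans _ _ (\sum_(m <oo) ((2 ^+ n.+1)%:E *
    ((m%:R ^+ n.+1 * poisson_mass h m)%:E + (poisson_mass h m)%:E)))%E).
  apply: lee_nneseries => [m _ _|m _]; first by apply: pm0 => //; exact: exprn_ge0.
  rewrite -EFinD -EFinM lee_fin.
  have -> : forall a p : R, a * p + p = (a + 1) * p by move=> *; ring.
  rewrite [leRHS]mulrA ler_wpM2r ?poisson_mass_ge0//.
  case: m => [|m].
    by rewrite expr1n expr0n add0r mulr1; apply: exprn_ege1; rewrite ler1n.
  rewrite mulrDr mulr1 ler_wpDr ?exprn_ge0// -exprMn lerXn2r ?nnegrE ?mulr_ge0//.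
  by rewrite -natrM ler_nat mul2n -addnn addSn ltnS leq_addl.
rewrite nneseriesZl; last first.
  move=> m _; apply: adde_ge0; last by rewrite lee_fin poisson_mass_ge0.
  by apply: pm0 => //; exact: exprn_ge0.
rewrite EFinM; apply: lee_wpmul2l; first by rewrite lee_fin.
rewrite nneseriesD//; last 2 first.
- by move=> m _ _; apply: pm0 => //; exact: exprn_ge0.
- by move=> m _ _; rewrite lee_fin poisson_mass_ge0.
rewrite poisson_mass_sum1// EFinD; apply: leeD => //.
by apply: le_trans (IH _ h01) _; rewrite lee_fin ler_wpM2l.
Qed.

Lemma poisson_mass_moment (H q : R) : 0 <= H -> 1 <= q ->
  exists2 K : R, 0 <= K & forall h, 0 <= h <= H ->
  (\sum_(m <oo) (m%:R `^ q * poisson_mass h m)%:E <= (K * h)%:E)%E.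
Proof.
move=> H0 q1; have q0 : 0 < q by lra.
pose n := Num.bound q; have qn : q <= n.+1%:R.
  by rewrite (le_trans (ltW (archi_boundP (ltW q0))))// ler_nat.
have [K K0 HK] := poisson_mass_moment_nat n H0.
exists K => // h h01; apply: le_trans (HK _ h01); have /andP[h0 h1] := h01.
apply: lee_nneseries => [m _ _|m _]; first by apply: pm0 => //; exact: powR_ge0.
rewrite lee_fin ler_wpM2r ?poisson_mass_ge0//.
case: m => [|m]; first by rewrite powR0 ?gt_eqF// exprn_ge0.
by rewrite -powR_mulrn// ler_powR// ler1n.
Qed.

Lemma poisson_mass_central q : 1 <= q -> exists2 K : R, 0 <= K &
  forall h, 0 <= h <= 1 ->
  (\sum_(m <oo) (`|m%:R - h| `^ q * poisson_mass h m)%:E <= (K * h)%:E)%E.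
Proof.
move=> q1; have q0 : 0 < q by lra.
have [K K0 HK] := poisson_mass_moment ler01 q1.
exists (2 `^ q * (K + 1)) => [|h h01].
  by rewrite mulr_ge0 ?powR_ge0// addr_ge0.
have /andP[h0 h1] := h01.
apply: (@le_trans _ _ (\sum_(m <oo) ((2 `^ q)%:E *
    ((m%:R `^ q * poisson_mass h m)%:E + h%:E * (poisson_mass h m)%:E)))%E).
  apply: lee_nneseries => [m _ _|m _]; first by apply: pm0 => //; exact: powR_ge0.
  rewrite -(EFinM h) -EFinD -EFinM lee_fin -mulrDl [leRHS]mulrA ler_wpM2r ?poisson_mass_ge0//.
  apply: (@le_trans _ _ ((m%:R + h) `^ q)).
    apply: le_powR; rewrite ?(ltW q0)//.
    by apply: le_trans (ler_normB _ _) _; rewrite !ger0_norm.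
  apply: le_trans (powR_addr (ltW q0) (ler0n _ _) h0) _.
  rewrite ler_wpM2l ?powR_ge0// lerD2l.
  (* Here [h <= 1] is used: [h^q <= h], which keeps the bound linear. *)
  have [->|hn0] := eqVneq h 0; first by rewrite powR0 ?gt_eqF.
  by apply: ge1r_powR => //; rewrite lt_def hn0 h0.
rewrite nneseriesZl; last first.
  move=> m _; apply: adde_ge0; last by rewrite -EFinM; apply: pm0.
  by apply: pm0 => //; exact: powR_ge0.
rewrite -mulrA EFinM; apply: lee_wpmul2l; first by rewrite lee_fin powR_ge0.
rewrite nneseriesD//; last 2 first.
- by move=> m _ _; apply: pm0 => //; exact: powR_ge0.
- by move=> m _ _; rewrite -EFinM; apply: pm0.
rewrite nneseriesZl; last by move=> m _; rewrite lee_fin poisson_mass_ge0.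
rewrite poisson_mass_sum1// mule1 mulrDl mul1r EFinD.
by apply: leeD => //; exact: HK.
Qed.

End poisson_mass_theory.

Section simple_integrals.
Context {R : realType} {X : completeNormedModType R}.
Context d (T : measurableType d) (P : probability T R).

(** Regroups a simple integral along the values of a finer function [g]. It is applied to [g] equal
    to the pair of a truncated count and a simple coefficient, where independence is available value
    by value. *)
Lemma simple_integral_comp (A : choiceType) (g : T -> A) (phi : A -> X)
    (l : seq A) : uniq l -> (forall w, g w \in l) -> finitely_valued g ->
  simple_integral P (phi \o g) =
  \sum_(a <- l) fine (P (g @^-1` [set a])) *: phi a.
Proof.
move=> ul gl fg; set lx := undup [seq phi a | a <- l].
rewrite /simple_integral (fsbig_widen (range (phi \o g)) [set` lx]); last 2 first.
- move=> _ [w _ <-] /=; rewrite mem_undup; apply/mapP.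
  by exists (g w).
- move=> x [_ /= xr]; rewrite (_ : _ @^-1` _ = set0) ?measure0 ?scale0r//.
  by apply/seteqP; split=> // w /= gx; apply: xr; exists w.
rewrite -fsbig_seq ?undup_uniq//.
transitivity (\sum_(x <- lx) \sum_(a <- l | phi a == x)
    fine (P (g @^-1` [set a])) *: x).
  apply: eq_bigr => x _.
  rewrite -scaler_suml -[in RHS]big_filter; congr (_ *: _).
  have -> : (phi \o g) @^-1` [set x] =
      \bigcup_(a in [set` [seq a <- l | phi a == x]]) g @^-1` [set a].
    apply/seteqP; split=> [w /= gx|w [a]] /=.
      by exists (g w) => //=; rewrite mem_filter gl gx eqxx.
    by rewrite mem_filter => /andP[/eqP <- _] ->.
  rewrite measure_fin_bigcup//; last 2 first.
  - by move=> a b _ _ [w [/= <- <-]].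
  - by move=> a _; exact: fg.2.
  rewrite -fsbig_seq ?filter_uniq// -sum_fine// => a _.
  by rewrite fin_num_measure//; exact: fg.2.
rewrite (exchange_big_dep xpredT)//=; apply: eq_big_seq => a al.
rewrite -big_filter (_ : [seq x <- lx | phi a == x] = [:: phi a]) ?big_seq1//.
have alx : phi a \in lx by rewrite mem_undup; apply/mapP; exists a.
apply: perm_small_eq => //; apply: uniq_perm => //.
  by rewrite filter_uniq// undup_uniq.
move=> x; rewrite mem_filter inE eq_sym.
by case: eqVneq => //= ->.
Qed.

End simple_integrals.

Section nonnegative_series.
Context {R : realType}.

Lemma cvg_nneseries_EFin (u : nat -> R) (r : R) : (forall m, 0 <= u m) ->
  (\sum_(m <oo) (u m)%:E = r%:E)%E ->
  \sum_(0 <= m < n) u m @[n --> \oo] --> r.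
Proof.
move=> u0 ur.
have : (fun n => (\sum_(0 <= m < n) (u m)%:E)%E) @ \oo --> r%:E.
  by rewrite -ur; apply: is_cvg_nneseries => m _ _; rewrite lee_fin.
rewrite (_ : (fun n => _) = EFin \o (fun n => \sum_(0 <= m < n) u m)).
  by move/fine_cvgP => [_].
by apply/funext => n; rewrite /= sumEFin.
Qed.

Lemma nneseries_EFin_ge (u : nat -> R) (r : R) n : (forall m, 0 <= u m) ->
  (\sum_(m <oo) (u m)%:E = r%:E)%E -> \sum_(0 <= m < n) u m <= r.
Proof.
move=> u0 ur; rewrite -lee_fin -ur -sumEFin.
by apply: nneseries_lim_ge => m _ _; rewrite lee_fin.
Qed.

(** Jensen's inequality for the norm: since the increment is centered, [a] is the limit of the
    partial sums of [p_m (a + (m - h) v)], and the triangle inequality applies to each of them. *)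
Lemma norm_le_poisson_mean (X : normedModType R) (h : R) (a v : X) : 0 <= h ->
  (`|a|%:E <=
   \sum_(m <oo) (poisson_mass h m * `|a + (m%:R - h) *: v|)%:E)%E.
Proof.
move=> h0; pose p := poisson_mass h.
have p0 m : 0 <= p m by exact: poisson_mass_ge0.
have c1 := cvg_nneseries_EFin p0 (poisson_mass_sum1 h0).
have c2 := cvg_nneseries_EFin (fun m => mulr_ge0 (ler0n R m) (p0 m)) (poisson_mass_mean h0).
pose S n := \sum_(0 <= m < n) p m *: (a + (m%:R - h) *: v).
have SE n : S n = (\sum_(0 <= m < n) p m) *: a +
    ((\sum_(0 <= m < n) m%:R * p m) - h * \sum_(0 <= m < n) p m) *: v.
  rewrite mulr_sumr -sumrB !scaler_suml -big_split; apply: eq_bigr => m _ /=.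
  by rewrite scalerDr scalerA mulrBr [p m * _]mulrC [p m * h]mulrC.
have Sa : S n @[n --> \oo] --> a.
  have -> : S = (fun n => (\sum_(0 <= m < n) p m) *: a +
    ((\sum_(0 <= m < n) m%:R * p m) - h * \sum_(0 <= m < n) p m) *: v) by exact/funext.
  rewrite -[X in _ --> X]addr0 -[X in _ --> X + _]scale1r.
  rewrite [X in _ --> _ + X](_ : 0 = (h - h * 1) *: v); last by rewrite mulr1 subrr scale0r.
  apply: cvgD; first exact: cvgZr_tmp.
  by apply: cvgZr_tmp; apply: cvgB => //; exact: cvgMl_tmp.
apply: (@cvge_le _ \oo _ _ (fun n => `|S n|%:E)); last first.
  by apply: cvg_EFin; [exact: nearW|exact: cvg_norm].
apply: nearW => n; apply: (@le_trans _ _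
    (\sum_(0 <= m < n) (p m * `|a + (m%:R - h) *: v|)%:E)%E).
  rewrite sumEFin lee_fin; apply: le_trans (ler_norm_sum _ _ _) _.
  by apply: ler_sum => m _; rewrite normrZ ger0_norm.
by apply: nneseries_lim_ge => m _ _; rewrite lee_fin mulr_ge0.
Qed.

End nonnegative_series.

(** * Sums of centered Poisson increments *)

(* A filtration [<<s gen 0>> <= <<s gen 1>> <= ...] together with integer
   variables [eta c], known at time [c.+1], independent of [<<s gen c>>] and
   Poisson of parameter [h c <= 1]. *)
Record poisson_increments {R : realType} d (O : measurableType d)
    (P : probability O R) (gen : nat -> set (set O)) (eta : nat -> O -> nat)
    (h : nat -> R) : Prop := {
  incr_sub : forall c, <<s gen c >> `<=` measurable ;
  incr_mono : forall c, <<s gen c >> `<=` <<s gen c.+1 >> ;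
  incr_param : forall c, 0 <= h c <= 1 ;
  incr_measurable : forall c m, <<s gen c.+1 >> (eta c @^-1` [set m]) ;
  incr_indep : forall c m A, <<s gen c >> A ->
    P (A `&` eta c @^-1` [set m]) = (P A * (poisson_mass (h c) m)%:E)%E }.

Definition central_bound {R : realType} (q K : R) : Prop :=
  0 <= K /\ forall h, 0 <= h <= 1 ->
  (\sum_(m <oo) (`|m%:R - h| `^ q * poisson_mass h m)%:E <= (K * h)%:E)%E.

Definition moment_bound {R : realType} (q K : R) : Prop :=
  0 <= K /\ forall h, 0 <= h <= 1 ->
  (\sum_(m <oo) (m%:R `^ q * poisson_mass h m)%:E <= (K * h)%:E)%E.

Section independent_increments.
Context {R : realType} d (O : measurableType d) (P : probability O R).
Context (gen : nat -> set (set O)) (eta : nat -> O -> nat) (h : nat -> R).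
Hypothesis HP : poisson_increments P gen eta h.
Local Notation F c := (g_sigma_algebraType (gen c)).
Local Notation p c := (poisson_mass (h c)).

Definition increment c w : R := (eta c w)%:R - h c.

Let h0 c : 0 <= h c. Proof. by have /andP[] := incr_param HP c. Qed.
Let p0 c m : 0 <= p c m. Proof. exact: poisson_mass_ge0. Qed.

Lemma incr_monoW i j : (i <= j)%N -> <<s gen i >> `<=` <<s gen j >>.
Proof.
elim: j => [|j IH]; first by rewrite leqn0 => /eqP ->.
rewrite leq_eqVlt => /predU1P[->//|/IH ij] A /ij; exact: (incr_mono HP).
Qed.

Lemma incr_mfunW d' (T : measurableType d') i j (f : O -> T) : (i <= j)%N ->
  measurable_fun setT (f : F i -> T) -> measurable_fun setT (f : F j -> T).
Proof. by move=> ij mf _ B mB; apply: (incr_monoW ij); exact: mf. Qed.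

Lemma incr_mfun d' (T : measurableType d') i (f : O -> T) :
  measurable_fun setT (f : F i -> T) -> measurable_fun setT f.
Proof. by move=> mf _ B mB; apply: (incr_sub HP); exact: mf. Qed.

Lemma eta_measurable c m : measurable (eta c @^-1` [set m]).
Proof. exact: (incr_sub HP (incr_measurable HP m)). Qed.

Lemma eta_mfun d' (T : measurableType d') c (k : nat -> T) :
  measurable_fun setT (fun w => k (eta c w) : T) /\
  measurable_fun setT ((fun w => k (eta c w)) : F c.+1 -> T).
Proof.
have E V : (fun w => k (eta c w)) @^-1` V =
    \bigcup_(m in k @^-1` V) eta c @^-1` [set m].
  apply/seteqP; split=> [w /= Vw|w [m /= Vm ->//]].
  by exists (eta c w).
split=> _ V _; rewrite setTI E.
  by apply: bigcup_measurable => m _; exact: eta_measurable.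
by apply: bigcup_measurable => m _; exact: (incr_measurable HP).
Qed.

(** The freezing lemma: the space is cut along the values of [eta c], and on each piece independence
    factors out the probability of that value. *)
Lemma incr_integral c (G : nat -> O -> \bar R) :
  (forall m, measurable_fun setT (G m : F c -> \bar R)) ->
  (forall m w, (0 <= G m w)%E) ->
  (\int[P]_w G (eta c w) w = \sum_(m <oo) ((p c m)%:E * \int[P]_w G m w))%E.
Proof.
move=> mG G0.
have T : setT = \bigcup_m (eta c @^-1` [set m]).
  by apply/seteqP; split=> // w _; exists (eta c w).
have mGe : measurable_fun setT (fun w => G (eta c w) w).
  move=> _ V mV; rewrite setTI.
  have -> : (fun w => G (eta c w) w) @^-1` V =
      \bigcup_m (eta c @^-1` [set m] `&` (G m @^-1` V)).
    apply/seteqP; split=> [w /= Vw|w [m _ [/= <- //]]].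
    by exists (eta c w).
  apply: bigcup_measurable => m _; apply: measurableI; first exact: eta_measurable.
  by rewrite -[X in measurable X]setTI; exact: (incr_mfun (mG m)).
rewrite [in LHS]T ge0_integral_bigcup//; first last.
- by move=> i j _ _ [w [/= <- <-]].
- by rewrite -T.
- by move=> m; exact: eta_measurable.
apply: eq_eseriesr => m _.
rewrite -(@integral_indep_event _ _ _ P (gen c) (eta c @^-1` [set m]))//.
- by apply: eq_integral => w; rewrite inE /= => ->.
- exact: (incr_sub HP).
- exact: eta_measurable.
- by move=> A cA; exact: (incr_indep HP).
Qed.

Lemma incr_integralM c (k : nat -> R) (g : O -> \bar R) :
  (forall m, 0 <= k m) -> measurable_fun setT (g : F c -> \bar R) ->
  (forall w, (0 <= g w)%E) -> (\int[P]_w g w < +oo)%E ->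
  (\int[P]_w ((k (eta c w))%:E * g w) =
   (\sum_(m <oo) (k m * p c m)%:E) * \int[P]_w g w)%E.
Proof.
move=> k0 mg g0 goo.
have mkg m : measurable_fun setT ((fun w => ((k m)%:E * g w)%E) : F c -> \bar R).
  exact: measurable_funeM.
rewrite (incr_integral mkg); last by move=> m w; rewrite mule_ge0// lee_fin.
have I0 : (0 <= \int[P]_w g w)%E by exact: integral_ge0.
have mgO := incr_mfun mg.
have [r rE] : exists r, (\int[P]_w g w = r%:E)%E.
  by exists (fine (\int[P]_w g w)); rewrite fineK// ge0_fin_numE.
rewrite rE muleC -nneseriesZl; last by move=> m _; rewrite lee_fin mulr_ge0.
apply: eq_eseriesr => m _.
rewrite ge0_integralZl_EFin// rE -!EFinM; congr (_%:E); ring.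
Qed.

Lemma incr_moment_le c (k : nat -> R) (K : R) (g : O -> R) :
  (forall m, 0 <= k m) -> (\sum_(m <oo) (k m * p c m)%:E <= (K * h c)%:E)%E ->
  measurable_fun setT (g : F c -> R) -> (forall w, 0 <= g w) ->
  (\int[P]_w (g w)%:E < +oo)%E ->
  (\int[P]_w (k (eta c w) * g w)%:E <= (K * h c)%:E * \int[P]_w (g w)%:E)%E.
Proof.
move=> k0 kK mg g0 goo.
under eq_integral do rewrite EFinM.
rewrite (@incr_integralM c k (fun w => (g w)%:E))//; last exact/measurable_EFinP.
by apply: lee_wpmul2r => //; apply: integral_ge0 => w _; rewrite lee_fin.
Qed.

(** Jensen after freezing the past. The weight [g] is known at time [c]; the Doob argument needs a
    power of the running maximum in its place. *)
Lemma incr_submartingale (Y : completeNormedModType R) c (g : O -> R) (a v : O -> Y) :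
  measurable_fun setT (g : F c -> R) -> (forall w, 0 <= g w) ->
  strongly_measurable <<s gen c>> a -> strongly_measurable <<s gen c>> v ->
  (\int[P]_w (g w * `|a w|)%:E <=
   \int[P]_w (g w * `|a w + increment c w *: v w|)%:E)%E.
Proof.
move=> mg g0 sa sv.
pose G m w := (g w * `|a w + (m%:R - h c) *: v w|)%:E.
have G0 m w : (0 <= G m w)%E by rewrite lee_fin mulr_ge0.
have sm m : @strongly_measurable R Y (F c) measurable (fun w => a w + (m%:R - h c) *: v w).
  apply: strongly_measurableD => //; apply: strongly_measurableZ => //.
have mG m : measurable_fun setT (G m : F c -> \bar R).
  apply/measurable_EFinP; apply: measurable_funM => //.
  exact: strongly_measurable_norm.
rewrite [leRHS](_ : _ = (\int[P]_w G (eta c w) w)%E)// (incr_integral mG)//.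
rewrite (eq_eseriesr (g := fun m => (\int[P]_w ((p c m)%:E * G m w))%E)); last first.
  by move=> m _; rewrite ge0_integralZl_EFin//; exact: incr_mfun.
rewrite -integral_nneseries//; last 2 first.
- by move=> m; apply: measurable_funeM; exact: incr_mfun.
- by move=> m w _; rewrite mule_ge0// lee_fin.
apply: ge0_le_integral => //.
- by move=> w _; rewrite lee_fin mulr_ge0.
- apply/measurable_EFinP; apply: measurable_funM; first exact: (incr_mfun mg).
  apply: (@incr_mfun _ _ c (fun w => `|a w|)).
  exact: (@strongly_measurable_norm _ _ (F c)).
- by apply: ge0_emeasurable_sum => [m w _|m _];
    [rewrite mule_ge0// lee_fin|apply: measurable_funeM; exact: incr_mfun].
move=> w _; under eq_eseriesr do rewrite /G -EFinM mulrCA EFinM.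
rewrite nneseriesZl; last by move=> m _; rewrite lee_fin mulr_ge0.
rewrite EFinM; apply: lee_wpmul2l; first by rewrite lee_fin.
exact: norm_le_poisson_mean.
Qed.

End independent_increments.

(** * Vanishing Bochner integrals of the increments *)

Section increments_are_martingale_differences.
Context {R : realType} d (O : measurableType d) (P : probability O R).
Context (gen : nat -> set (set O)) (eta : nat -> O -> nat) (h : nat -> R).
Hypothesis HP : poisson_increments P gen eta h.
Local Notation F c := (g_sigma_algebraType (gen c)).
Local Notation p c := (poisson_mass (h c)).
Local Notation xi c := (increment eta h c).
Context {Y : completeNormedModType R}.

Let h0 c : 0 <= h c. Proof. by have /andP[] := incr_param HP c. Qed.
Let p0 c m : 0 <= p c m. Proof. exact: poisson_mass_ge0. Qed.
Let pc0 c : 0 < p c 0.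
Proof. by rewrite /poisson_mass expr0 fact0 invr1 !mul1r expR_gt0. Qed.

Let drift c n := \sum_(0 <= m < n.+1) (m%:R - h c) * p c m.

Let driftE c n : drift c n = \sum_(0 <= m < n.+1) m%:R * p c m -
  h c * \sum_(0 <= m < n.+1) p c m.
Proof. by rewrite mulr_sumr -sumrB; apply: eq_bigr => m _; rewrite mulrBl. Qed.

Let drift_cvg c : drift c n @[n --> \oo] --> (0 : R).
Proof.
have c1 := cvg_nneseries_EFin (p0 c) (poisson_mass_sum1 (h0 c)).
have c2 := cvg_nneseries_EFin (fun m => mulr_ge0 (ler0n R m) (p0 c m)) (poisson_mass_mean (h0 c)).
rewrite (_ : drift c = fun n => \sum_(0 <= m < n.+1) m%:R * p c m -
  h c * \sum_(0 <= m < n.+1) p c m); last by apply/funext => n; exact: driftE.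
rewrite -[X in _ --> X](subrr (h c)) -[X in _ --> _ - X]mulr1.
apply: cvgB; first by rewrite -cvg_shiftS in c2.
by apply: cvgMl_tmp; rewrite -cvg_shiftS in c1.
Qed.

Let drift_le c n : `|drift c n| <= h c.
Proof.
have c1 := nneseries_EFin_ge n.+1 (p0 c) (poisson_mass_sum1 (h0 c)).
have c2 := nneseries_EFin_ge n.+1 (fun m => mulr_ge0 (ler0n R m) (p0 c m)) (poisson_mass_mean (h0 c)).
have s1 : 0 <= \sum_(0 <= m < n.+1) p c m by apply: sumr_ge0.
have s2 : 0 <= \sum_(0 <= m < n.+1) m%:R * p c m.
  by apply: sumr_ge0 => m _; rewrite mulr_ge0.
rewrite driftE ler_norml; have := ler_wpM2l (h0 c) c1; have := mulr_ge0 (h0 c) s1.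
by move=> *; apply/andP; split; lra.
Qed.

(* Truncation of the increment, corrected at [0] to keep it centered. *)
Let kappa c n m : R := (if (m <= n)%N then m%:R - h c else 0) -
  (if m == 0%N then drift c n / p c 0 else 0).

Let kappa_center c n : \sum_(0 <= m < n.+2) kappa c n m * p c m = 0.
Proof.
rewrite big_nat_recr//= {2}/kappa ltnn /= subrr mul0r addr0.
rewrite (eq_big_nat _ _ (F2 := fun m => (m%:R - h c) * p c m -
   (if m == 0%N then drift c n / p c 0 else 0) * p c m)); last first.
  by move=> m; rewrite ltnS /kappa => /andP[_ ->]; rewrite mulrBl.
rewrite sumrB [X in _ - X]big_nat_recl//= [X in _ - (_ + X)]big1 => [|i _]; last by rewrite mul0r.
by rewrite addr0 mulfVK ?gt_eqF// subrr.
Qed.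

Let kappa_le c n m : `|kappa c n m| <= m%:R + (h c + h c / p c 0).
Proof.
rewrite addrA; apply: le_trans (ler_normB _ _) _; apply: lerD.
  case: ifPn => _; last by rewrite normr0 addr_ge0.
  by apply: le_trans (ler_normB _ _) _; rewrite !ger0_norm.
case: ifPn => _; last by rewrite normr0 divr_ge0.
by rewrite normrM normfV (ger0_norm (p0 c 0)) ler_wpM2r// invr_ge0.
Qed.

Let kappa_cvg c m : kappa c n m @[n --> \oo] --> (m%:R - h c : R).
Proof.
rewrite -[X in _ --> X]subr0; apply: cvgB.
  apply: cvg_near_cst; exists m => // n /= mn; by rewrite mn.
case: eqP => _; last exact: cvg_cst.
by rewrite -[X in _ --> X](mul0r (p c 0)^-1); exact: cvgMr_tmp.
Qed.

(** The simple functions [kappa c n (eta c) * v_n] converge to [xi c * v] in [L^1] by domination.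
    Their simple integrals are exactly 0, since independence factors the probabilities and [kappa]
    is centered. *)
Lemma increment_bochner c (v : O -> Y) :
  strongly_measurable <<s gen c>> v -> (\int[P]_w (`|v w|)%:E < +oo)%E ->
  is_bochner_integral P (fun w => xi c w *: v w) 0.
Proof.
move=> sv voo.
have svO : strongly_measurable measurable v.
  by apply: strongly_measurable_sub sv; exact: (incr_sub HP).
have mxi : measurable_fun setT (fun w => xi c w).
  exact: (eta_mfun HP c (fun m => m%:R - h c)).1.
have mv : measurable_fun setT (fun w => `|v w|) by exact: strongly_measurable_norm.
have sxv : strongly_measurable measurable (fun w => xi c w *: v w).
  exact: strongly_measurableZ.
split => //.
have [v_ [fv_ cv_ dv_]] := @strongly_measurable_dom _ _ (F c) _ v sv.
(* All counts above [n] are collapsed to [n.+1], where [kappa c n] is 0. This gives finitely many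
   values and does not change the product. *)
pose e n w := minn (eta c w) n.+1.
pose g n w := (e n w, v_ n w).
pose phi n (my : nat * Y) := kappa c n my.1 *: my.2.
have fe n : finitely_valued (e n).
  split.
    apply: (@sub_finite_set _ _ `I_n.+2) => // _ [w _ <-] /=.
    by rewrite /e ltnS geq_minr.
  move=> m; rewrite (_ : _ @^-1` _ = \bigcup_(i in [set i | minn i n.+1 = m]) eta c @^-1` [set i]).
    by apply: bigcup_measurable => i _; exact: (eta_measurable HP).
  apply/seteqP; split=> [w /= wm|w [i /= <- ei]]; first by exists (eta c w).
  by rewrite /= /e ei.
have fvO n : @finitely_valued _ O _ (v_ n).
  by split; [exact: (fv_ n).1|move=> x; apply: (incr_sub HP); exact: (fv_ n).2].
have fg n : finitely_valued (g n) by exact: finitely_valued2.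
exists (fun n => phi n \o g n); split.
- by move=> n; exact: finitely_valued_comp.
(* The factor 3 is 1 for [xi c * v] plus 2 for the truncated product, whose coefficient [v_ n] is
   bounded by [2 * |v|]. *)
- have Bint : P.-integrable setT
      (fun w => (3 * (((eta c w)%:R + (h c + h c / p c 0)) * `|v w|))%:E).
    have meta : measurable_fun setT (fun w => (eta c w)%:R : R).
      exact: (eta_mfun HP c (fun m => m%:R : R)).1.
    apply/integrableP; split.
      apply/measurable_EFinP; apply: measurable_funM => //; apply: measurable_funM => //.
      exact: measurable_funD.
    have B0 : 0 <= h c + h c / p c 0 by rewrite addr_ge0// divr_ge0.
    under eq_integral => w _.
      rewrite gee0_abs; last by rewrite lee_fin !mulr_ge0// addr_ge0.
      rewrite EFinM mulrDl.
      over.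
    have me : measurable_fun setT (fun w => ((eta c w)%:R * `|v w|)%:E).
      by apply/measurable_EFinP; exact: measurable_funM.
    have mb : measurable_fun setT (fun w => ((h c + h c / p c 0) * `|v w|)%:E).
      by apply/measurable_EFinP; exact: measurable_funM.
    rewrite ge0_integralZl_EFin//; first last.
    + by apply/measurable_EFinP; apply: measurable_funD; exact/measurable_EFinP.
    + by move=> w _; rewrite lee_fin addr_ge0// mulr_ge0.
    under eq_integral do rewrite EFinD.
    rewrite ge0_integralD//; last by move=> w _; rewrite lee_fin mulr_ge0.
    rewrite lte_mul_pinfty// lte_add_pinfty//.
    + apply: (@le_lt_trans _ _ ((1 * h c)%:E * \int[P]_w (`|v w|)%:E)%E).
        apply: (@incr_moment_le _ _ _ _ _ _ _ HP c (fun m => m%:R) 1 (fun w => `|v w|)) => //.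
          by rewrite poisson_mass_mean// mul1r.
        exact: (@strongly_measurable_norm _ _ (F c)).
      by rewrite lte_mul_pinfty// lee_fin mul1r.
    + under eq_integral do rewrite EFinM.
      rewrite ge0_integralZl_EFin//; last exact/measurable_EFinP.
      by rewrite lte_mul_pinfty.
  have mn n : measurable_fun setT (fun w => `|xi c w *: v w - (phi n \o g n) w|).
    apply: strongly_measurable_norm; apply: strongly_measurableB => //.
    by apply: strongly_measurable_simple; exact: finitely_valued_comp.
  have gE n w : (phi n \o g n) w = kappa c n (eta c w) *: v_ n w.
    rewrite [LHS]/= /phi /g /e /=; have [//|en] := leqP (eta c w) n.+1.
    rewrite /kappa ltnn (leqNgt (eta c w)) (ltnW en) /=.
    by case: (eta c w) en.
  have := @dominated_convergence _ _ _ P setT measurableT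
    (fun n w => (`|xi c w *: v w - (phi n \o g n) w|)%:E) (fun=> 0%E)
    (fun w => (3 * (((eta c w)%:R + (h c + h c / p c 0)) * `|v w|))%:E)
    (fun n => (measurable_EFinP _ _).2 (mn n)).
  move=> /(_ (measurable_cst _)) [].
  + apply: aeW => w _; apply: cvg_EFin; first exact: nearW.
    rewrite -(normr0 Y); apply: cvg_norm; rewrite -[X in _ --> X](subrr (xi c w *: v w)).
    apply: cvgB; first exact: cvg_cst.
    rewrite (_ : (fun n => _) = (fun n => kappa c n (eta c w) *: v_ n w)).
      by apply: cvgZ; [exact: kappa_cvg|exact: cv_].
    by apply/funext => n; rewrite gE.
  + exact: Bint.
  + apply: aeW => w n _; rewrite gee0_abs ?lee_fin// gE.
    apply: le_trans (ler_normB _ _) _; rewrite !normrZ.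
    have B0 : 0 <= h c / p c 0 by rewrite divr_ge0.
    have x1 : `|xi c w| <= (eta c w)%:R + (h c + h c / p c 0).
      apply: le_trans (ler_normB _ _) _; rewrite !ger0_norm//.
      by have := h0 c; lra.
    have := ler_wpM2r (normr_ge0 (v w)) x1.
    have := ler_pM (normr_ge0 _) (normr_ge0 _) (kappa_le c n (eta c w)) (dv_ n w).
    lra.
  by move=> _ _; under [X in _ --> X -> _]eq_integral do rewrite ?abse0; rewrite integral0.
- rewrite (_ : (fun n => _) = fun=> 0); first exact: cvg_cst.
  apply/funext => n.
  have /finite_seqP[l0 l0E] := (fv_ n).1.
  pose l := undup l0.
  have vl w : v_ n w \in l.
    rewrite mem_undup; have : range (v_ n) (v_ n w) by exists w.
    by rewrite l0E.
  rewrite (@simple_integral_comp _ _ _ _ P _ (g n) (phi n)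
    [seq (m, y) | m <- index_iota 0 n.+2, y <- l])//; first last.
  - move=> w; apply/allpairsP; exists (g n w); split => //=.
    by rewrite mem_index_iota /= /e ltnS geq_minr.
  - rewrite allpairs_uniq// ?iota_uniq ?undup_uniq//.
    by move=> [? ?] [? ?] _ _ /= [-> ->].
  rewrite big_allpairs_dep /=.
  transitivity (\sum_(0 <= m < n.+2) \sum_(y <- l)
     (kappa c n m * p c m) *: (fine (P (v_ n @^-1` [set y])) *: y)).
    apply: eq_big_nat => m /andP[_ mn]; apply: eq_bigr => y _.
    rewrite /phi /=; have [mn1|mn1] := eqVneq m n.+1.
      by rewrite mn1 /kappa ltnn /= subrr scale0r scaler0 mul0r scale0r.
    rewrite (_ : g n @^-1` [set (m, y)] = v_ n @^-1` [set y] `&` eta c @^-1` [set m]).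
      rewrite (incr_indep HP); last exact: (fv_ n).2.
      rewrite fineM ?fin_num_measure//=; last exact: (fvO n).2.
      by rewrite !scalerA; congr (_ *: _); ring.
    have mn' : (m < n.+1)%N by rewrite ltn_neqAle mn1 -ltnS.
    apply/seteqP; split => w; rewrite /g /e /=.
      move=> [em ->]; split=> //; move: em; rewrite /minn; case: ltnP => // _ em.
      by rewrite em ltnn in mn'.
    by move=> [-> ->]; rewrite (minn_idPl (ltnW mn')).
  rewrite exchange_big /=; apply: big1 => y _.
  by rewrite -scaler_suml kappa_center scale0r.
Qed.

End increments_are_martingale_differences.

Section expectations.
Context {R : realType} d (O : measurableType d) (P : probability O R).
Implicit Types f g : O -> R.
Local Notation "''E' f" := (\int[P]_w (f w)%:E)%E (at level 10, f at level 8).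

Lemma expect_ge0 f : (forall w, 0 <= f w) -> (0 <= 'E f)%E.
Proof. by move=> f0; apply: integral_ge0 => w _; rewrite lee_fin. Qed.

Lemma le_expect f g : measurable_fun setT f -> measurable_fun setT g ->
  (forall w, 0 <= f w) -> (forall w, f w <= g w) -> ('E f <= 'E g)%E.
Proof.
move=> mf mg f0 fg; apply: ge0_le_integral => //.
- by move=> w _; rewrite lee_fin.
- exact/measurable_EFinP.
- exact/measurable_EFinP.
- by move=> w _; rewrite lee_fin.
Qed.

Lemma expectD f g : measurable_fun setT f -> measurable_fun setT g ->
  (forall w, 0 <= f w) -> (forall w, 0 <= g w) ->
  (\int[P]_w (f w + g w)%:E = 'E f + 'E g)%E.
Proof.
move=> mf mg f0 g0; under eq_integral do rewrite EFinD.
rewrite ge0_integralD//.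
- by move=> w _; rewrite lee_fin.
- exact/measurable_EFinP.
- by move=> w _; rewrite lee_fin.
- exact/measurable_EFinP.
Qed.

Lemma expectZ (k : R) f : measurable_fun setT f -> (forall w, 0 <= f w) -> 0 <= k ->
  (\int[P]_w (k * f w)%:E = k%:E * 'E f)%E.
Proof.
move=> mf f0 k0; under eq_integral do rewrite EFinM.
rewrite ge0_integralZl_EFin//; first by move=> w _; rewrite lee_fin.
exact/measurable_EFinP.
Qed.

Lemma expect_sum (I : Type) (r : seq I) (f : I -> O -> R) :
  (forall i, measurable_fun setT (f i)) -> (forall i w, 0 <= f i w) ->
  (\int[P]_w (\sum_(i <- r) f i w)%:E = \sum_(i <- r) 'E (f i))%E.
Proof.
move=> mf f0; under eq_integral do rewrite -sumEFin.
rewrite ge0_integral_sum//; first by move=> i; exact/measurable_EFinP.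
by move=> i w _; rewrite lee_fin.
Qed.

Lemma measurable_powR_fun d' (T : measurableType d') (f : T -> R) q :
  measurable_fun setT f -> measurable_fun setT (fun w => f w `^ q).
Proof. by move=> mf; apply: (measurableT_comp (measurable_powR _)). Qed.

Lemma measurable_rmax d' (T : measurableType d') (u : nat -> T -> R) n :
  (forall k, (k <= n)%N -> measurable_fun setT (u k)) ->
  measurable_fun setT (fun w => rmax (u ^~ w) n).
Proof.
elim: n => [|n IH] mu /=; first exact: mu.
apply: measurable_maxr; last exact: mu.
by apply: IH => k kn; apply: mu; exact: leqW.
Qed.

End expectations.

(** * The maximal inequality at the exponent [s] *)

Section maximal_inequality.
Context {R : realType} d (O : measurableType d) (P : probability O R).
Context (gen : nat -> set (set O)) (eta : nat -> O -> nat) (h : nat -> R).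
Hypothesis HP : poisson_increments P gen eta h.
Local Notation F c := (g_sigma_algebraType (gen c)).
Local Notation xi c := (increment eta h c).
Context {Y : completeNormedModType R} (v : nat -> O -> Y).
Hypothesis sv : forall c, strongly_measurable <<s gen c>> (v c).

Definition stoch_sum k w : Y := \sum_(c < k) xi c w *: v c w.

Lemma increment_mfunS c : measurable_fun setT ((fun w => xi c w : R) : F c.+1 -> R).
Proof. exact: (eta_mfun HP c (fun m => m%:R - h c)).2. Qed.

Lemma coef_measurable c : strongly_measurable measurable (v c).
Proof. by apply: strongly_measurable_sub (sv c); exact: (incr_sub HP). Qed.

Lemma term_measurable c :
  strongly_measurable <<s gen c.+1>> (fun w => xi c w *: v c w).
Proof.
apply: (@strongly_measurableZ _ _ (F c.+1)); first exact: increment_mfunS.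
exact: (strongly_measurable_sub (incr_mono HP (c := c)) (sv c)).
Qed.

Lemma stoch_sum_measurable k : strongly_measurable <<s gen k>> (stoch_sum k).
Proof.
apply: (@strongly_measurable_sum _ _ (F k) Y _ _ (fun (c : 'I_k) w => xi c w *: v c w)).
move=> c; apply: (strongly_measurable_sub _ (term_measurable c)).
exact: (incr_monoW HP (ltn_ord c)).
Qed.

Lemma stoch_sum_norm_measurable i k : (i <= k)%N ->
  measurable_fun setT ((fun w => `|stoch_sum i w|) : F k -> R).
Proof.
move=> ik; apply: (incr_mfunW HP ik).
by apply: (@strongly_measurable_norm _ _ (F i)); exact: stoch_sum_measurable.
Qed.

Local Notation M n w := (rmax (fun k => `|stoch_sum k w|) n).

Lemma stoch_max_measurable n : measurable_fun setT ((fun w => M n w) : F n -> R).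
Proof.
by apply: (@measurable_rmax _ _ (F n)) => k; exact: stoch_sum_norm_measurable.
Qed.

Variable (s : R).
Hypothesis s1 : 1 < s.
Hypothesis vs : forall c, (\int[P]_w (`|v c w| `^ s)%:E < +oo)%E.

Lemma term_moment (q K : R) c : 1 <= q -> central_bound q K ->
  (\int[P]_w (`|v c w| `^ q)%:E < +oo)%E ->
  (\int[P]_w (`|xi c w *: v c w| `^ q)%:E <=
     (K * h c)%:E * \int[P]_w (`|v c w| `^ q)%:E)%E.
Proof.
move=> q1 [K0 HK] vq.
under eq_integral do rewrite normrZ powRM//.
apply: (@incr_moment_le _ _ _ _ _ _ _ HP c (fun m => `|m%:R - h c| `^ q) K
  (fun w => `|v c w| `^ q)) => //.
- exact: (HK _ (incr_param HP c)).
- apply: (@measurable_powR_fun _ _ (F c)).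
  by apply: (@strongly_measurable_norm _ _ (F c)); exact: sv.
Qed.

Lemma coef_integrable c : (\int[P]_w (`|v c w|)%:E < +oo)%E.
Proof.
have mv : measurable_fun setT (fun w => `|v c w|).
  by apply: strongly_measurable_norm; exact: coef_measurable.
have mvs : measurable_fun setT (fun w => `|v c w| `^ s) by exact: measurable_powR_fun.
apply: (@le_lt_trans _ _ (\int[P]_w (1 + `|v c w| `^ s)%:E)%E).
  apply: le_expect => //; first exact: measurable_funD.
  move=> w; have [v1|v1] := leP `|v c w| 1.
    by rewrite ler_wpDr ?powR_ge0.
  by rewrite ler_wpDl// le1r_powR// ltW.
rewrite expectD//.
by rewrite integral_cst// mul1e lte_add_pinfty// -ge0_fin_numE// fin_num_measure.
Qed.

Lemma increments_martingale_difference (K : R) n : central_bound s K ->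
  martingale_difference P s n (fun c => <<s gen c>>) (fun c w => xi c w *: v c w).
Proof.
move=> HK; split.
- by move=> i _; split; [exact: smallest_sigma_algebra|exact: (incr_sub HP)].
- by move=> i _; exact: (incr_mono HP).
- by move=> i _; exact: term_measurable.
- move=> i _; split.
    by apply: strongly_measurable_sub (term_measurable i); exact: (incr_sub HP).
  apply: le_lt_trans (term_moment (ltW s1) HK (vs i)) _.
  by rewrite lte_mul_pinfty// lee_fin mulr_ge0 ?HK.1//; have /andP[] := incr_param HP i.
- move=> i A _ GA.
  have sAv : strongly_measurable <<s gen i>> (fun w => \1_A w *: v i w).
    apply: (@strongly_measurableZ _ _ (F i)); last exact: sv.
    exact: (@measurable_indic _ (F i) R setT A GA).
  rewrite (_ : (fun w => _) = (fun w => xi i w *: (\1_A w *: v i w))); last first.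
    by apply/funext => w; rewrite !scalerA mulrC.
  apply: (increment_bochner HP) => //.
  apply: le_lt_trans (coef_integrable i).
  have mv : measurable_fun setT (fun w => `|v i w|).
    by apply: strongly_measurable_norm; exact: coef_measurable.
  apply: le_expect => //.
    apply: strongly_measurable_norm; apply: strongly_measurable_sub sAv.
    exact: (incr_sub HP).
  move=> w; rewrite normrZ ler_piMl// indicE.
  by case: (_ \in _); rewrite ?normr1 ?normr0.
Qed.

(** Integrating [doob_pathwise] and cancelling the two sums by the submartingale property leaves
    [(s - 1) E M_n^s <= s E (M_n^(s-1) |f_n|)]. The hypothesis on [C'], an instance of
    [absorb_powR], then gives half of [E M_n^s] back. *)
Lemma doob_inequality (C' : R) n : 0 <= C' ->
  (forall x y : R, 0 <= x -> 0 <= y ->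
    s / (s - 1) * (x `^ (s - 1) * y) <= 2^-1 * x `^ s + C' * y `^ s) ->
  (forall k, (k <= n)%N -> (\int[P]_w (`|stoch_sum k w| `^ s)%:E < +oo)%E) ->
  (\int[P]_w (M n w `^ s)%:E <= (2 * C')%:E * \int[P]_w (`|stoch_sum n w| `^ s)%:E)%E.
Proof.
move=> C'0 HC fin.
have s0 : 0 < s by exact: lt_trans ltr01 s1.
have sm1 : 0 < s - 1 by rewrite subr_gt0.
have mf k : measurable_fun setT (fun w => `|stoch_sum k w|).
  by apply: (incr_mfun HP); exact: (stoch_sum_norm_measurable (leqnn k)).
have mM k : measurable_fun setT (fun w => M k w).
  by apply: (incr_mfun HP); exact: (stoch_max_measurable (n := k)).
have M0 k w : 0 <= M k w by exact: rmax_ge0.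
have Mfin k : (k <= n)%N -> (\int[P]_w (M k w `^ s)%:E < +oo)%E.
  move=> kn; apply: (@le_lt_trans _ _
      (\int[P]_w (\sum_(i < k.+1) `|stoch_sum i w| `^ s)%:E)%E).
    apply: le_expect => //.
    + exact: measurable_powR_fun.
    + by apply: measurable_sum => i; exact: measurable_powR_fun.
    + by move=> w; exact: powR_ge0.
    + move=> w; have [i ik <-] := rmax_ex (fun k => `|stoch_sum k w|) k.
      rewrite (bigD1 (Ordinal (ik : (i < k.+1)%N)))//= ler_wpDr// sumr_ge0// => j _.
  rewrite expect_sum//.
    by apply: lte_sum_pinfty => i _; apply: fin; exact: (leq_trans (leq_ord i) kn).
  by move=> i; exact: measurable_powR_fun.
have mMp k : measurable_fun setT (fun w => M k w `^ (s - 1)) by exact: measurable_powR_fun.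
pose A k w := M k w `^ (s - 1) * `|stoch_sum k w|.
pose B k w := M k w `^ (s - 1) * `|stoch_sum k.+1 w|.
have mA k : measurable_fun setT (A k) by exact: measurable_funM.
have mB k : measurable_fun setT (B k) by exact: measurable_funM.
have A0 k w : 0 <= A k w by rewrite mulr_ge0// powR_ge0.
have B0 k w : 0 <= B k w by rewrite mulr_ge0// powR_ge0.
have AB k : (\int[P]_w (A k w)%:E <= \int[P]_w (B k w)%:E)%E.
  have := @incr_submartingale _ _ _ _ _ _ _ HP Y k (fun w => M k w `^ (s - 1))
    (stoch_sum k) (v k).
  rewrite /A /B; under [X in _ -> (_ <= X)%E]eq_integral do
    rewrite [stoch_sum _.+1 _]/stoch_sum big_ord_recr /=.
  apply => //.
  + apply: (@measurable_powR_fun _ _ (F k)); exact: stoch_max_measurable.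
  + by move=> w; exact: powR_ge0.
  + exact: stoch_sum_measurable.
have Afin k : (k <= n)%N -> (\int[P]_w (A k w)%:E < +oo)%E.
  move=> kn; apply: le_lt_trans (Mfin k kn); apply: le_expect => //.
    exact: measurable_powR_fun.
  move=> w; rewrite /A -(mulr_powRB1 (M0 k w) s0) mulrC ler_wpM2r ?powR_ge0//.
  exact: (rmax_ge (fun k => `|stoch_sum k w|)).
have u00 w : `|stoch_sum 0 w| = 0 by rewrite /stoch_sum big_ord0 normr0.
have path w : (s - 1) * M n w `^ s + s * \sum_(k < n) B k w <=
   s * A n w + s * \sum_(k < n) A k w.
  exact: (@doob_pathwise _ s (fun k => `|stoch_sum k w|) n (ltW s1)).
have mMs : measurable_fun setT (fun w => M n w `^ s) by exact: measurable_powR_fun.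
have Mp0 w : 0 <= M n w `^ s by exact: powR_ge0.
have sA0 w : 0 <= \sum_(k < n) A k w by apply: sumr_ge0.
have sB0 w : 0 <= \sum_(k < n) B k w by apply: sumr_ge0.
have msA : measurable_fun setT (fun w => \sum_(k < n) A k w) by exact: measurable_sum.
have msB : measurable_fun setT (fun w => \sum_(k < n) B k w) by exact: measurable_sum.
have main : ((s - 1)%:E * \int[P]_w (M n w `^ s)%:E + s%:E * \sum_(k < n) \int[P]_w (B k w)%:E <=
  s%:E * \int[P]_w (A n w)%:E + s%:E * \sum_(k < n) \int[P]_w (A k w)%:E)%E.
  have -> : ((s - 1)%:E * \int[P]_w (M n w `^ s)%:E + s%:E * \sum_(k < n) \int[P]_w (B k w)%:E =
     \int[P]_w ((s - 1) * M n w `^ s + s * \sum_(k < n) B k w)%:E)%E.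
    rewrite (@expectD _ _ _ _ (fun w => (s - 1) * M n w `^ s)); first last.
    + by move=> w; rewrite mulr_ge0 ?powR_ge0 ?(ltW s0) ?(ltW sm1).
    + by move=> w; rewrite mulr_ge0 ?powR_ge0 ?(ltW s0) ?(ltW sm1).
    + exact: measurable_funM.
    + exact: measurable_funM.
    by rewrite !expectZ ?(ltW s0) ?(ltW sm1) ?expect_sum//.
  have -> : (s%:E * \int[P]_w (A n w)%:E + s%:E * \sum_(k < n) \int[P]_w (A k w)%:E =
     \int[P]_w (s * A n w + s * \sum_(k < n) A k w)%:E)%E.
    rewrite (@expectD _ _ _ _ (fun w => s * A n w)); first last.
    + by move=> w; rewrite mulr_ge0 ?powR_ge0 ?(ltW s0) ?(ltW sm1).
    + by move=> w; rewrite mulr_ge0 ?powR_ge0 ?(ltW s0) ?(ltW sm1).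
    + exact: measurable_funM.
    + exact: measurable_funM.
    by rewrite !expectZ ?(ltW s0) ?expect_sum//.
  apply: le_expect => //.
  - by apply: measurable_funD; exact: measurable_funM.
  - by apply: measurable_funD; exact: measurable_funM.
  - by move=> w; rewrite addr_ge0 ?mulr_ge0 ?powR_ge0 ?(ltW s0) ?(ltW sm1).
have sumA : (\sum_(k < n) \int[P]_w (A k w)%:E <= \sum_(k < n) \int[P]_w (B k w)%:E)%E.
  by apply: lee_sum => k _; exact: AB.
(* Cancelling the common sum in the extended reals requires it to be finite; this holds because
   [A k] is at most [M k ^ s]. *)
have sumAfin : (s%:E * \sum_(k < n) \int[P]_w (A k w)%:E)%E \is a fin_num.
  rewrite fin_numM// ge0_fin_numE; last by apply: sume_ge0 => k _; exact: expect_ge0.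
  by apply: lte_sum_pinfty => i _; apply: Afin; exact: ltnW.
have main2 : ((s - 1)%:E * \int[P]_w (M n w `^ s)%:E <= s%:E * \int[P]_w (A n w)%:E)%E.
  rewrite -(leeD2rE _ _ sumAfin); apply: le_trans main.
  by rewrite leeD2l// lee_wpmul2l// lee_fin ltW.
have main3 : (\int[P]_w (M n w `^ s)%:E <=
    (2^-1)%:E * \int[P]_w (M n w `^ s)%:E +
     C'%:E * \int[P]_w (`|stoch_sum n w| `^ s)%:E)%E.
  apply: (@le_trans _ _ (\int[P]_w (s / (s - 1) * A n w)%:E)%E).
    rewrite expectZ//; last by rewrite divr_ge0 ?(ltW s0) ?(ltW sm1).
    have /(_ (s - 1)^-1%:E) := lee_wpmul2l _ main2.
    rewrite lee_fin invr_ge0 (ltW sm1) => /(_ isT).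
    by rewrite !muleA -!EFinM mulVf ?gt_eqF// mul1e [_ * s]mulrC.
  have mfs : measurable_fun setT (fun w => `|stoch_sum n w| `^ s) by exact: measurable_powR_fun.
  have -> : ((2^-1)%:E * \int[P]_w (M n w `^ s)%:E +
     C'%:E * \int[P]_w (`|stoch_sum n w| `^ s)%:E =
     \int[P]_w (2^-1 * M n w `^ s + C' * `|stoch_sum n w| `^ s)%:E)%E.
    rewrite (@expectD _ _ _ _ (fun w => 2^-1 * M n w `^ s)); first last.
    + by move=> w; rewrite mulr_ge0.
    + by move=> w; rewrite mulr_ge0// ?invr_ge0.
    + exact: measurable_funM.
    + exact: measurable_funM.
    by rewrite !expectZ// invr_ge0.
  apply: le_expect => //.
  - exact: measurable_funM.
  - by apply: measurable_funD; exact: measurable_funM.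
  - by move=> w; rewrite mulr_ge0// divr_ge0 ?(ltW s0) ?(ltW sm1).
  - by move=> w; exact: HC.
have := Mfin n (leqnn n); have := fin n (leqnn n).
have I1 : (0 <= \int[P]_w (M n w `^ s)%:E)%E by apply: expect_ge0 => w; exact: powR_ge0.
have I2 : (0 <= \int[P]_w (`|stoch_sum n w| `^ s)%:E)%E.
  by apply: expect_ge0 => w; exact: powR_ge0.
move: I1 I2 main3; case: (\int[P]_w (M n w `^ s)%:E)%E => [a| |]//.
case: (\int[P]_w (`|stoch_sum n w| `^ s)%:E)%E => [b| |]//.
rewrite -!EFinM -EFinD !lee_fin => *; lra.
Qed.

End maximal_inequality.

(** Martingale type [s], raised to the power [s], bounds the last term of the sequence by the
    moments of its increments, each at most [K * h c] times the moment of the coefficient; Doob's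
    inequality then passes to the maximum. *)
Lemma martingale_maximal_inequality {R : realType} (s : R)
    (Y : completeNormedModType R) : 1 < s -> martingale_type s Y ->
  exists2 C : R, 0 <= C &
  forall d (O : measurableType d) (P : probability O R) gen eta h,
  poisson_increments P gen eta h ->
  forall v : nat -> O -> Y,
  (forall c, strongly_measurable <<s gen c>> (v c)) ->
  (forall c, \int[P]_w (`|v c w| `^ s)%:E < +oo)%E ->
  forall n,
  (\int[P]_w (rmax (fun k => `|stoch_sum eta h v k w|) n `^ s)%:E <=
   C%:E * \sum_(c < n) (h c)%:E * \int[P]_w (`|v c w| `^ s)%:E)%E.
Proof.
move=> s1 [C0 HC0]; have s0 : 0 < s by lra.
have [K K0 HK] := @poisson_mass_central R s (ltW s1).
have sm1 : 0 < s - 1 by rewrite subr_gt0.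
have [C' C'0 HC'] := @absorb_powR R s (s / (s - 1)) (ltW s1) (divr_ge0 (ltW s0) (ltW sm1)).
(* The constant in [martingale_type] carries no sign, and the inequality is about to be raised to
   the power [s]. *)
pose C1 := Num.max C0 0; have C10 : 0 <= C1 by rewrite le_max lexx orbT.
exists (2 * C' * (C1 `^ s * K)).
  by rewrite !mulr_ge0// powR_ge0.
move=> d O P gen eta h HP v sv vs.
have h0 c : 0 <= h c by have /andP[] := incr_param HP c.
have key n : (\int[P]_w (`|stoch_sum eta h v n w| `^ s)%:E <=
    (C1 `^ s * K)%:E * \sum_(c < n) (h c)%:E * \int[P]_w (`|v c w| `^ s)%:E)%E.
  have := HC0 d O P n _ _ (increments_martingale_difference HP sv s1 vs n (conj K0 HK)).
  rewrite -/(moment P s (stoch_sum eta h v n)); set mo := moment P s _.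
  set S := (\sum_(i < n) _)%E => le1.
  have mo0 : (0 <= mo)%E by apply: integral_ge0 => w _; rewrite lee_fin powR_ge0.
  have S0 : (0 <= S)%E.
    by apply: sume_ge0 => i _; apply: integral_ge0 => w _; rewrite lee_fin powR_ge0.
  have le2 : (mo `^ s^-1 <= C1%:E * S `^ s^-1)%E.
    apply: le_trans le1 _; apply: lee_wpmul2r; first exact: poweR_ge0.
    by rewrite lee_fin le_max lexx.
  have := @gt0_ler_poweR R s (ltW s0) (mo `^ s^-1)%E (C1%:E * S `^ s^-1)%E.
  rewrite !in_itv /= !leey !andbT poweR_ge0 mule_ge0 ?poweR_ge0 ?lee_fin//.
  move=> /(_ isT isT le2).
  rewrite -poweRrM mulVf ?gt_eqF// poweRe1// poweRM ?poweR_ge0 ?lee_fin//.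
  rewrite -poweRrM mulVf ?gt_eqF// poweRe1// poweR_EFin => /le_trans; apply.
  rewrite EFinM -muleA; apply: lee_wpmul2l; first by rewrite lee_fin powR_ge0.
  rewrite ge0_sume_distrr; last first.
    by move=> c _; rewrite mule_ge0 ?lee_fin// expect_ge0// => w; exact: powR_ge0.
  apply: lee_sum => c _; rewrite muleA -EFinM.
  exact: (term_moment HP sv (ltW s1) (conj K0 HK) (vs c)).
have fin n : (\int[P]_w (`|stoch_sum eta h v n w| `^ s)%:E < +oo)%E.
  apply: le_lt_trans (key n) _; rewrite lte_mul_pinfty//.
  - by rewrite lee_fin mulr_ge0// powR_ge0.
  - by apply: lte_sum_pinfty => c _; rewrite lte_mul_pinfty// lee_fin.
move=> n; apply: le_trans (doob_inequality HP sv s1 C'0 HC' (fun k _ => fin k)) _.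
rewrite (EFinM (2 * C')) -[leRHS]muleA; apply: lee_wpmul2l; last exact: key.
by rewrite lee_fin mulr_ge0.
Qed.

(** * Random variables with moments of all orders *)

Section finite_moments.
Context {R : realType} d (O : measurableType d) (P : probability O R).
Implicit Types f g : O -> R.

(** Finiteness of all moments, because this class is stable under sums, products and positive
    powers. The finiteness needed by each absorption argument then follows from closure properties
    alone. Almost surely bounded factors and Poisson counts belong to it. *)
Definition all_moments f : Prop :=
  [/\ measurable_fun setT f, forall w, 0 <= f w &
    forall q, 1 <= q -> (\int[P]_w (f w `^ q)%:E < +oo)%E].

Lemma all_moments_le f g : measurable_fun setT f -> (forall w, 0 <= f w) ->
  all_moments g -> (forall w, f w <= g w) -> all_moments f.
Proof.
move=> mf f0 [mg g0 gq] fg; split=> // q q1; have q0 : 0 <= q by lra.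
apply: le_lt_trans (gq q q1); apply: le_expect.
- exact: measurable_powR_fun.
- exact: measurable_powR_fun.
- by move=> w; exact: powR_ge0.
- by move=> w; exact: le_powR.
Qed.

Lemma all_moments_cst (r : R) : 0 <= r -> all_moments (fun=> r).
Proof.
move=> r0; split => // q q1; rewrite integral_cst//.
by rewrite lte_mul_pinfty// ?lee_fin ?powR_ge0// -ge0_fin_numE// fin_num_measure.
Qed.

Lemma all_momentsD f g : all_moments f -> all_moments g ->
  all_moments (fun w => f w + g w).
Proof.
move=> [mf f0 fq] [mg g0 gq]; split.
- exact: measurable_funD.
- by move=> w; rewrite addr_ge0.
- move=> q q1; have q0 : 0 <= q by lra.
  have mfq := measurable_powR_fun q mf; have mgq := measurable_powR_fun q mg.
  have p0 w (k : O -> R) : 0 <= k w `^ q by exact: powR_ge0.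
  apply: (@le_lt_trans _ _ (\int[P]_w (2 `^ q * (f w `^ q + g w `^ q))%:E)%E).
    apply: le_expect => //.
    + by apply: measurable_powR_fun; exact: measurable_funD.
    + by apply: measurable_funM => //; exact: measurable_funD.
    + by move=> w; exact: powR_ge0.
    + by move=> w; exact: powR_addr.
  rewrite expectZ ?powR_ge0//; last 2 first.
  + exact: measurable_funD.
  + by move=> w; rewrite addr_ge0.
  rewrite expectD// lte_mul_pinfty// ?lee_fin ?powR_ge0//.
  by rewrite lte_add_pinfty// ?fq ?gq.
Qed.

Lemma all_moments_sum (I : Type) (r : seq I) (f : I -> O -> R) :
  (forall i, all_moments (f i)) -> all_moments (fun w => \sum_(i <- r) f i w).
Proof.
move=> fm; elim: r => [|i r IH].
  under [X in all_moments X]eq_fun do rewrite big_nil.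
  exact: all_moments_cst.
by under [X in all_moments X]eq_fun do rewrite big_cons; exact: all_momentsD.
Qed.

Lemma all_moments_powR r f : 0 < r -> all_moments f ->
  all_moments (fun w => f w `^ r).
Proof.
move=> r0 [mf f0 fq]; split.
- exact: measurable_powR_fun.
- by move=> w; exact: powR_ge0.
- move=> q q1.
  have m1 : measurable_fun setT (fun w => (f w `^ r) `^ q).
    by do 2 apply: measurable_powR_fun.
  (* Orders below 1 are not covered by the definition; there [f^(r q) <= 1 + f]. *)
  have [rq1|rq1] := leP 1 (r * q).
    by under eq_integral do rewrite -powRrM; exact: fq.
  have [mf1 f10 f1q] := all_momentsD (all_moments_cst ler01) (And3 mf f0 fq).
  apply: le_lt_trans (f1q 1 (lexx _)); apply: le_expect => //.
  + exact: measurable_powR_fun.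
  + by move=> w; exact: powR_ge0.
  + move=> w; rewrite powRr1 ?f10// -powRrM.
    have fw := f0 w; have [f1|f1] := leP (f w) 1.
      have : f w `^ (r * q) <= 1 `^ (r * q).
        by apply: le_powR => //; rewrite mulr_ge0 ?(ltW r0)//; lra.
      by rewrite powR1; lra.
    rewrite ler_wpDl//; apply: ler1_powR; exact: ltW.
Qed.

Lemma all_moments_lty f : all_moments f -> (\int[P]_w (f w)%:E < +oo)%E.
Proof.
move=> [mf f0 fq]; have := fq 1 (lexx _).
by under eq_integral do rewrite powRr1//.
Qed.

Lemma all_momentsM f g : all_moments f -> all_moments g ->
  all_moments (fun w => f w * g w).
Proof.
move=> fm gm; have [mf f0 _] := fm; have [mg g0 _] := gm.
apply: (@all_moments_le _ (fun w => f w `^ 2 + g w `^ 2)).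
- exact: measurable_funM.
- by move=> w; rewrite mulr_ge0.
- by apply: all_momentsD; exact: all_moments_powR.
- move=> w; rewrite !powR_mulrn//; have := sqr_ge0 (f w - g w).
  by have := sqr_ge0 (f w); have := sqr_ge0 (g w); rewrite !expr2; lra.
Qed.

Lemma le_expect_moments f g : all_moments f -> all_moments g ->
  (forall w, f w <= g w) -> (\int[P]_w (f w)%:E <= \int[P]_w (g w)%:E)%E.
Proof. by move=> [mf f0 _] [mg _ _]; exact: le_expect. Qed.

Lemma expect_momentsD f g : all_moments f -> all_moments g ->
  (\int[P]_w (f w + g w)%:E = \int[P]_w (f w)%:E + \int[P]_w (g w)%:E)%E.
Proof. by move=> [mf f0 _] [mg g0 _]; exact: expectD. Qed.

Lemma expect_momentsZ (k : R) f : all_moments f -> 0 <= k ->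
  (\int[P]_w (k * f w)%:E = k%:E * \int[P]_w (f w)%:E)%E.
Proof. by move=> [mf f0 _] k0; exact: expectZ. Qed.

Lemma expect_moments_sum (I : Type) (r : seq I) (f : I -> O -> R) :
  (forall i, all_moments (f i)) ->
  (\int[P]_w (\sum_(i <- r) f i w)%:E = \sum_(i <- r) \int[P]_w (f i w)%:E)%E.
Proof. by move=> fm; apply: expect_sum => i; have [] := fm i. Qed.

Lemma all_momentsZ (k : R) f : 0 <= k -> all_moments f ->
  all_moments (fun w => k * f w).
Proof. by move=> k0 fm; exact: (all_momentsM (all_moments_cst k0) fm). Qed.

End finite_moments.

(** * Exponents larger than the martingale type *)

Section moments_of_stochastic_sums.
Context {R : realType} d (O : measurableType d) (P : probability O R).
Context (gen : nat -> set (set O)) (eta : nat -> O -> nat) (h : nat -> R).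
Hypothesis HP : poisson_increments P gen eta h.
Local Notation F c := (g_sigma_algebraType (gen c)).
Local Notation xi c := (increment eta h c).

Lemma coef_norm_measurable (Y : completeNormedModType R) (v : nat -> O -> Y) c k :
  (c <= k)%N -> strongly_measurable <<s gen c>> (v c) ->
  measurable_fun setT ((fun w => `|v c w|) : F k -> R).
Proof.
move=> ck sv; apply: (incr_mfunW HP ck).
exact: (@strongly_measurable_norm _ _ (F c)).
Qed.

Context {Y : completeNormedModType R} (v : nat -> O -> Y).
Hypothesis sv : forall c, strongly_measurable <<s gen c>> (v c).
Hypothesis vm : forall c, all_moments P (fun w => `|v c w|).

Lemma term_all_moments c : all_moments P (fun w => `|xi c w *: v c w|).
Proof.
split => [||q q1]; first 1 last.
- by move=> w; exact: normr_ge0.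
- have [K K0 HK] := @poisson_mass_central R q q1.
  have [_ _ vq] := vm c.
  apply: le_lt_trans (term_moment HP sv q1 (conj K0 HK) (vq _ q1)) _.
  apply: lte_mul_pinfty => //; last exact: vq.
  by rewrite lee_fin mulr_ge0//; have /andP[] := incr_param HP c.
- apply: strongly_measurable_norm.
  by apply: strongly_measurable_sub (term_measurable HP sv c); exact: (incr_sub HP).
Qed.

Lemma stoch_max_all_moments n :
  all_moments P (fun w => rmax (fun k => `|stoch_sum eta h v k w|) n).
Proof.
apply: (@all_moments_le _ _ _ _ _ (fun w => \sum_(c < n) `|xi c w *: v c w|)).
- by apply: (incr_mfun HP); exact: (stoch_max_measurable HP sv (n := n)).
- by move=> w; apply: rmax_ge0.
- by apply: all_moments_sum => c; exact: term_all_moments.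
- move=> w; apply: rmax_le => i ilen; apply: le_trans (ler_norm_sum _ _ _) _.
  rewrite -(big_mkord xpredT (fun c => `|xi c w *: v c w|)).
  rewrite -(big_mkord xpredT (fun c => `|xi c w *: v c w|)).
  by rewrite [leRHS](big_cat_nat (leq0n i) ilen)/= ler_wpDr// sumr_ge0.
Qed.

End moments_of_stochastic_sums.

Lemma stoch_sum_transform {R : realType} d (O : measurableType d)
    (eta : nat -> O -> nat) (h : nat -> R) (Y : completeNormedModType R)
    (v : nat -> O -> Y) (b : nat -> O -> R) k w :
  stoch_sum eta h (fun c w => b c w *: v c w) k w =
  transform (b ^~ w) (fun k => stoch_sum eta h v k w) k.
Proof.
apply: eq_bigr => c _; rewrite [stoch_sum _ _ _ c.+1 w]big_ord_recr /=.
by rewrite addrAC subrr add0r !scalerA mulrC.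
Qed.

(** With [q = p / s], the weights [M_k^(q-1)] are known at time [k], and the inequality at exponent
    [s] applies to the weighted coefficients. [rmax_transform] turns a bound on the transform [G]
    into one on [M^q], up to the largest jump; raising to the power [s] gives [M^p]. *)
Lemma stoch_sum_large_exponent {R : realType} (s p : R)
    (Y : completeNormedModType R) : 1 < s -> s < p -> martingale_type s Y ->
  exists2 C : R, 0 <= C &
  forall d (O : measurableType d) (P : probability O R) gen eta h,
  poisson_increments P gen eta h ->
  forall v : nat -> O -> Y,
  (forall c, strongly_measurable <<s gen c>> (v c)) ->
  (forall c, all_moments P (fun w => `|v c w|)) ->
  forall n,
  (\int[P]_w (rmax (fun k => `|stoch_sum eta h v k w|) n `^ p)%:E <=
   C%:E * (\int[P]_w ((\sum_(c < n) h c * `|v c w| `^ s) `^ (p / s))%:E +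
           \int[P]_w (\sum_(c < n) h c * `|v c w| `^ p)%:E))%E.
Proof.
move=> s1 sp hY; have s0 : 0 < s by lra.
have p0 : 0 < p by lra. have p1 : 1 <= p by lra.
have [Cb Cb0 HCb] := martingale_maximal_inequality s1 hY.
pose q := p / s; have q1 : 1 < q by rewrite ltr_pdivlMr// mul1r.
have q0 : 0 < q by lra. have qm0 : 0 < q - 1 by lra.
have qs : q * s = p by rewrite /q mulfVK ?gt_eqF.
have [C1 C10 HC1] := absorb_powR (ltW q1) (ltW q0).
have [K K0 HK] := @poisson_mass_central R p p1.
pose a1 := 2 `^ s * (2 * q) `^ s; pose a2 := 2 `^ s * (2 * C1) `^ s.
have a10 : 0 <= a1 by rewrite mulr_ge0// powR_ge0.
have a20 : 0 <= a2 by rewrite mulr_ge0// powR_ge0.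
have [C2 C20 HC2] := absorb_powR (ltW q1) (mulr_ge0 a10 Cb0).
exists (2 * (C2 + a2 * K)); first by rewrite mulr_ge0// addr_ge0// mulr_ge0.
move=> d O P gen eta h HP v sv vm n.
have h0 c : 0 <= h c by have /andP[] := incr_param HP c.
pose f k w := stoch_sum eta h v k w.
pose M k w := rmax (fun k => `|f k w|) k.
have M0 k w : 0 <= M k w by exact: rmax_ge0.
have Mm k : all_moments P (M k) by exact: (stoch_max_all_moments HP sv vm k).
pose b c w := M c w `^ (q - 1).
pose v' c w := b c w *: v c w.
have mb c : measurable_fun setT (b c : g_sigma_algebraType (gen c) -> R).
  apply: (@measurable_powR_fun _ _ (g_sigma_algebraType (gen c))).
  exact: (stoch_max_measurable HP sv (n := c)).
have sv' c : strongly_measurable <<s gen c>> (v' c).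
  by apply: (@strongly_measurableZ _ _ (g_sigma_algebraType (gen c))); [exact: mb|exact: sv].
have b0 c w : 0 <= b c w by exact: powR_ge0.
have nv' c w : `|v' c w| = b c w * `|v c w| by rewrite normrZ ger0_norm.
have bm c : all_moments P (b c) by exact: (all_moments_powR qm0 (Mm c)).
have v'm c : all_moments P (fun w => `|v' c w|).
  by under [X in all_moments _ X]eq_fun do rewrite nv'; exact: (all_momentsM (bm c) (vm c)).
pose g k w := stoch_sum eta h v' k w.
pose G w := rmax (fun k => `|g k w|) n.
have Gm : all_moments P G by exact: (stoch_max_all_moments HP sv' v'm n).
(* [D] dominates every jump, as [rmax_transform] needs, and its [p]-th power is a sum over the
   cells, so its expectation is estimated jump by jump. *)
pose D w := (\sum_(c < n) `|increment eta h c w *: v c w| `^ p) `^ p^-1.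
have Dm : all_moments P D.
  apply: all_moments_powR; first by rewrite invr_gt0.
  by apply: all_moments_sum => c; exact: (all_moments_powR p0 (term_all_moments HP sv vm c)).
have D0 w : 0 <= D w by exact: powR_ge0.
have G0 w : 0 <= G w by exact: rmax_ge0.
have Dp w : D w `^ p = \sum_(c < n) `|increment eta h c w *: v c w| `^ p.
  by rewrite /D powRVK// sumr_ge0// => c _; exact: powR_ge0.
have path1 w : M n w `^ q <= q * G w + q * (D w * M n w `^ (q - 1)).
  apply: (@rmax_transform _ Y q (fun k => f k w) n (D w) (G w)) => //.
  - exact: ltW.
  - by rewrite /f /stoch_sum big_ord0.
  - move=> k kn; rewrite /f /stoch_sum big_ord_recr /= addrAC subrr add0r.
    rewrite -[leLHS](powRK p0)//; apply: le_powR; rewrite ?invr_ge0 ?powR_ge0 ?(ltW p0)//.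
    rewrite (bigD1 (Ordinal kn))//= ler_wpDr// sumr_ge0// => c _; exact: powR_ge0.
  - move=> k kn; apply: le_trans (rmax_ge (fun k => `|g k w|) kn).
    by rewrite /g /v' stoch_sum_transform.
have path w : M n w `^ p <= a1 * G w `^ s + a2 * D w `^ p.
  have := path1 w; have := HC1 _ _ (M0 n w) (D0 w).
  rewrite [D w * _]mulrC => e1 e2.
  have e3 : M n w `^ q <= 2 * q * G w + 2 * C1 * D w `^ q by lra.
  rewrite -qs powRrM; apply: (@le_trans _ _ ((2 * q * G w + 2 * C1 * D w `^ q) `^ s)).
    by apply: le_powR; rewrite ?powR_ge0 ?(ltW s0).
  have q20 : 0 <= 2 * q by lra.
  have C120 : 0 <= 2 * C1 by lra.
  have Dq0 : 0 <= D w `^ q by exact: powR_ge0.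
  have := powR_addr (ltW s0) (mulr_ge0 q20 (G0 w)) (mulr_ge0 C120 Dq0).
  move=> /le_trans; apply.
  rewrite (powRM s q20 (G0 w)) (powRM s C120 Dq0) -powRrM.
  by rewrite /a1 /a2 mulrDr !mulrA lexx.
pose A w := \sum_(c < n) h c * `|v c w| `^ s.
pose B w := \sum_(c < n) h c * `|v c w| `^ p.
have hvm r c : 0 < r -> all_moments P (fun w => h c * `|v c w| `^ r).
  move=> r0; apply: all_momentsM; first exact: all_moments_cst.
  exact: (all_moments_powR r0 (vm c)).
have Am : all_moments P A by apply: all_moments_sum => c; exact: hvm.
have Bm : all_moments P B by apply: all_moments_sum => c; exact: hvm.
have A0 w : 0 <= A w by apply: sumr_ge0 => c _; rewrite mulr_ge0// powR_ge0.
have eG : (\int[P]_w (G w `^ s)%:E <=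
    Cb%:E * \int[P]_w ((M n w `^ s) `^ (q - 1) * A w)%:E)%E.
  have vs c : (\int[P]_w (`|v' c w| `^ s)%:E < +oo)%E by have [_ _] := v'm c; apply; exact: ltW.
  apply: le_trans (HCb _ _ _ _ _ _ HP _ sv' vs n) _.
  apply: lee_wpmul2l => //.
  have v's c : all_moments P (fun w => `|v' c w| `^ s).
    exact: (all_moments_powR s0 (v'm c)).
  have Msm := all_momentsM (all_moments_powR qm0 (all_moments_powR s0 (Mm n))) Am.
  rewrite (eq_bigr (fun c : 'I_n => (\int[P]_w (h c * `|v' c w| `^ s)%:E)%E)); last first.
    by move=> c _; rewrite (expect_momentsZ (v's c)).
  have hv's c := all_momentsZ (h0 c) (v's c).
  rewrite -(expect_moments_sum (index_enum 'I_n) (fun c : 'I_n => hv's c)).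
  apply: (le_expect_moments _ Msm); first by apply: all_moments_sum => c; exact: hv's.
  move=> w; rewrite mulr_sumr; apply: ler_sum => c _.
  rewrite nv' (powRM s (b0 c w) (normr_ge0 _)) mulrCA.
  apply: ler_wpM2r; first by rewrite mulr_ge0 ?powR_ge0.
  rewrite /b -powRrM -[leRHS]powRrM [s * _]mulrC; apply: le_powR => //.
    by rewrite mulr_ge0// ltW.
  by apply: rmax_ndecr; exact: ltnW.
have eD : (\int[P]_w (D w `^ p)%:E <= K%:E * \int[P]_w (B w)%:E)%E.
  under eq_integral do rewrite Dp.
  have tm c := all_moments_powR p0 (term_all_moments HP sv vm c).
  rewrite (expect_moments_sum _ (fun c : 'I_n => tm c)).
  rewrite (expect_moments_sum _ (fun c : 'I_n => hvm p c p0)).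
  rewrite ge0_sume_distrr; last first.
    by move=> c _; apply: expect_ge0 => w; rewrite mulr_ge0// powR_ge0.
  apply: lee_sum => c _; rewrite (expect_momentsZ (all_moments_powR p0 (vm c)) (h0 c)).
  rewrite muleA -EFinM; apply: (term_moment HP sv p1 (conj K0 HK)).
  by have [_ _] := vm c; apply.
have Mp := all_moments_powR p0 (Mm n); have Gs := all_moments_powR s0 Gm.
have Dpm := all_moments_powR p0 Dm; have Aq := all_moments_powR q0 Am.
have Msm : all_moments P (fun w => (M n w `^ s) `^ (q - 1) * A w).
  exact: (all_momentsM (all_moments_powR qm0 (all_moments_powR s0 (Mm n))) Am).
have E1 : (\int[P]_w (M n w `^ p)%:E <=
    a1%:E * \int[P]_w (G w `^ s)%:E + a2%:E * \int[P]_w (D w `^ p)%:E)%E.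
  rewrite -(expect_momentsZ Gs a10) -(expect_momentsZ Dpm a20).
  rewrite -(expect_momentsD (all_momentsZ a10 Gs) (all_momentsZ a20 Dpm)).
  exact: (le_expect_moments Mp (all_momentsD (all_momentsZ a10 Gs) (all_momentsZ a20 Dpm))).
have i2 : 0 <= 2^-1 :> R by rewrite invr_ge0.
have E2 : ((a1 * Cb)%:E * \int[P]_w ((M n w `^ s) `^ (q - 1) * A w)%:E <=
    (2^-1)%:E * \int[P]_w (M n w `^ p)%:E + C2%:E * \int[P]_w (A w `^ q)%:E)%E.
  rewrite -(expect_momentsZ Msm (mulr_ge0 a10 Cb0)) -(expect_momentsZ Mp i2).
  rewrite -(expect_momentsZ Aq C20).
  rewrite -(expect_momentsD (all_momentsZ i2 Mp) (all_momentsZ C20 Aq)).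
  apply: le_expect_moments.
  - exact: (all_momentsZ (mulr_ge0 a10 Cb0) Msm).
  - exact: (all_momentsD (all_momentsZ i2 Mp) (all_momentsZ C20 Aq)).
  - move=> w; apply: le_trans (HC2 _ _ (powR_ge0 (M n w) s) (A0 w)) _.
    by rewrite -powRrM [s * q]mulrC qs.
rewrite -/(f _ _) -/(M n _) -/(A _) -/(B _) -/q.
have I1 := all_moments_lty Mp.
have I2 := all_moments_lty Aq; have I3 := all_moments_lty Bm.
move: eD eG E1 E2 I1 I2 I3.
have IG := all_moments_lty Gs; have ID := all_moments_lty Dpm.
have IMA := all_moments_lty Msm.
have X0 (k : O -> R) : all_moments P k -> (0 <= \int[P]_w (k w)%:E)%E.
  by move=> [_ k0 _]; exact: expect_ge0.
have := X0 _ Mp; have := X0 _ Gs; have := X0 _ Dpm; have := X0 _ Aq.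
have := X0 _ Msm; have := X0 _ Bm; move: IG ID IMA.
case: (\int[P]_w (G w `^ s)%:E)%E => [xG| |]//.
case: (\int[P]_w (D w `^ p)%:E)%E => [xD| |]//.
case: (\int[P]_w ((M n w `^ s) `^ (q - 1) * A w)%:E)%E => [xMA| |]//.
case: (\int[P]_w (M n w `^ p)%:E)%E => [xM| |]//.
case: (\int[P]_w (A w `^ q)%:E)%E => [xA| |]//.
case: (\int[P]_w (B w)%:E)%E => [xB| |]//.
rewrite -!EFinM -!EFinD !lee_fin => _ _ _ B0' MA0 A0' D0' G0' M0' lD lG l1 l2 _ _ _.
have l3 := ler_wpM2l a10 lG; have l4 := ler_wpM2l a20 lD.
have l5 := mulr_ge0 C20 B0'; have l6 := mulr_ge0 (mulr_ge0 a20 K0) A0'.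
lra.
Qed.

(** * Exponents smaller than the martingale type *)

Lemma stoch_sum_small_exponent {R : realType} (s p : R)
    (Y : completeNormedModType R) : 1 < s -> 1 <= p < s -> martingale_type s Y ->
  exists2 C : R, 0 <= C &
  forall d (O : measurableType d) (P : probability O R) gen eta h,
  poisson_increments P gen eta h ->
  forall v : nat -> O -> Y,
  (forall c, strongly_measurable <<s gen c>> (v c)) ->
  (forall c, all_moments P (fun w => `|v c w|)) ->
  forall n (e : R), 0 < e ->
  (\int[P]_w (rmax (fun k => `|stoch_sum eta h v k w|) n `^ p)%:E <=
   C%:E * \int[P]_w ((e + \sum_(c < n) h c * `|v c w| `^ s) `^ (p / s))%:E)%E.
Proof.
move=> s1 /andP[p1 ps] hY; have s0 : 0 < s by lra.
have p0 : 0 < p by lra. have sp0 : 0 < s - p by lra.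
have [Cb Cb0 HCb] := martingale_maximal_inequality s1 hY.
pose r := p / s; have r0 : 0 < r by rewrite divr_gt0.
have r1 : r <= 1 by rewrite ler_pdivrMr// mul1r ltW.
have rv0 : 0 <= r^-1 by rewrite invr_ge0 ltW.
have two0 : 0 <= 2 `^ p :> R by exact: powR_ge0.
exists (2 `^ p * (Cb / r + 1)).
  by rewrite mulr_ge0// addr_ge0// mulr_ge0.
move=> d O P gen eta h HP v sv vm n e e0.
have h0 c : 0 <= h c by have /andP[] := incr_param HP c.
have [->|n0] := eqVneq n 0%N.
  under eq_integral do rewrite /= /stoch_sum big_ord0 normr0 powR0 ?gt_eqF//.
  rewrite integral0 mule_ge0//.
    by rewrite lee_fin mulr_ge0// addr_ge0// mulr_ge0.
  by apply: expect_ge0 => w; exact: powR_ge0.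
pose m := n.-1; have nm : n = m.+1 by rewrite prednK// lt0n.
pose B c w := e + \sum_(i < c.+1) h i * `|v i w| `^ s.
pose al := (s - p) / (s * s); have al0 : 0 < al by rewrite divr_gt0// mulr_gt0.
pose b c w := B c w `^ al.
have term0 c w : 0 <= h c * `|v c w| `^ s by rewrite mulr_ge0// powR_ge0.
have eB c w : e <= B c w by rewrite lerDl sumr_ge0.
have B0 c w : 0 < B c w by exact: lt_le_trans e0 (eB c w).
have BS c w : B c.+1 w = B c w + h c.+1 * `|v c.+1 w| `^ s.
  by rewrite /B big_ord_recr /= addrA.
have b0 c w : 0 < b c w by exact: powR_gt0.
have bS c w : b c w <= b c.+1 w.
  by apply: le_powR; [exact: ltW|exact: ltW|rewrite BS lerDl].
have hvm c := all_momentsZ (h0 c) (all_moments_powR s0 (vm c)).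
have Bm c : all_moments P (B c).
  apply: (all_momentsD (all_moments_cst P (ltW e0))).
  by apply: all_moments_sum => i; exact: hvm.
have mB c : measurable_fun setT (B c : g_sigma_algebraType (gen c) -> R).
  apply: measurable_funD => //.
  apply: (@measurable_sum _ (g_sigma_algebraType (gen c)) _ setT 'I_c.+1 _
    (fun (i : 'I_c.+1) w => h i * `|v i w| `^ s)) => i.
  apply: measurable_funM => //; apply: (@measurable_powR_fun _ _ (g_sigma_algebraType (gen c))).
  exact: (coef_norm_measurable HP (leq_ord i) (sv i)).
pose v' c w := (b c w)^-1 *: v c w.
have sv' c : strongly_measurable <<s gen c>> (v' c).
  apply: (@strongly_measurableZ _ _ (g_sigma_algebraType (gen c))); last exact: sv.
  rewrite (_ : (fun w => _) = (fun w => B c w `^ (- al))).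
    by apply: (@measurable_powR_fun _ _ (g_sigma_algebraType (gen c))); exact: mB.
  by apply/funext => w; rewrite powRN.
have nv' c w : `|v' c w| = (b c w)^-1 * `|v c w|.
  by rewrite normrZ ger0_norm// invr_ge0 ltW.
have v'm c : all_moments P (fun w => `|v' c w|).
  have ea0 : 0 <= (e `^ al)^-1 by rewrite invr_ge0 powR_ge0.
  apply: (all_moments_le _ _ (all_momentsZ ea0 (vm c))).
  - apply: strongly_measurable_norm; apply: strongly_measurable_sub (sv' c).
    exact: (incr_sub HP).
  - by move=> w; exact: normr_ge0.
  - move=> w; rewrite nv' ler_wpM2r// lef_pV2 ?posrE ?powR_gt0//.
    by apply: le_powR; [exact: ltW|exact: ltW|exact: eB].
pose M w := rmax (fun k => `|stoch_sum eta h v k w|) n.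
pose G w := rmax (fun k => `|stoch_sum eta h v' k w|) n.
have M0 w : 0 <= M w by exact: rmax_ge0.
have G0 w : 0 <= G w by exact: rmax_ge0.
have Mm : all_moments P M by exact: (stoch_max_all_moments HP sv vm n).
have Gm : all_moments P G by exact: (stoch_max_all_moments HP sv' v'm n).
have bmono c w : (c <= m)%N -> b c w <= b m w.
  move=> cm; have := @homo_leq _ (b ^~ w) <=%R (@lexx _ R) (@le_trans _ R) (bS ^~ w).
  exact.
have path1 w : M w <= 2 * (b m w * G w).
  apply: rmax_le => -[_|k kn].
    by rewrite /stoch_sum big_ord0 normr0 mulr_ge0// mulr_ge0// ltW.
  apply: (@le_trans _ _ (2 * (b k w * G w))); last first.
    by rewrite ler_wpM2l// ler_wpM2r// bmono// -ltnS -nm.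
  apply: (@norm_transform_inv _ Y (b ^~ w) (fun k => stoch_sum eta h v k w) n) => //.
  - by rewrite /stoch_sum big_ord0.
  - move=> i ilen; apply: le_trans (rmax_ge (fun k => `|stoch_sum eta h v' k w|) ilen).
    by rewrite /v' (stoch_sum_transform eta h v (fun c w => (b c w)^-1)).
have path w : M w `^ p <= 2 `^ p * (G w `^ s + B m w `^ r).
  apply: (@le_trans _ _ (2 `^ p * (b m w `^ p * G w `^ p))).
    have bG0 : 0 <= b m w * G w by rewrite mulr_ge0// ltW.
    rewrite -(powRM p (ltW (b0 m w)) (G0 w)) -powRM//.
    by apply: le_powR; [exact: ltW|exact: M0|exact: path1].
  rewrite ler_wpM2l//.
  have := @conjugate_powR _ (b m w `^ p) (G w `^ p) (s / (s - p)) (s / p)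
    (powR_ge0 _ _) (powR_ge0 _ _) (divr_gt0 s0 sp0) (divr_gt0 s0 p0).
  have -> : (s / (s - p))^-1 + (s / p)^-1 = 1.
    by field; rewrite !gt_eqF.
  move=> /(_ erefl); rewrite -!powRrM.
  have -> : p * (s / p) = s by field; rewrite gt_eqF.
  have -> : al * (p * (s / (s - p))) = r by rewrite /al /r; field; rewrite !gt_eqF.
  move=> /le_trans; apply; rewrite addrC; apply: lerD.
    rewrite ler_piMr ?powR_ge0// invf_div ler_pdivrMr// mul1r; exact: ltW.
  by rewrite ler_piMr ?powR_ge0// invf_div ler_pdivrMr// mul1r; lra.
have Gs := all_moments_powR s0 Gm; have Br := all_moments_powR r0 (Bm m).
have v's c := all_moments_powR s0 (v'm c).
have hv's c := all_momentsZ (h0 c) (v's c).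
have riemann w k : \sum_(c < k.+1) h c * `|v' c w| `^ s <= r^-1 * B k w `^ r.
  have step c (x : R) : 0 <= x -> x <= B c w -> h c * `|v c w| `^ s = B c w - x ->
      h c * `|v' c w| `^ s <= r^-1 * (B c w `^ r - x `^ r).
    move=> x0 xB hx; rewrite nv'.
    have bi0 : 0 <= (b c w)^-1 by rewrite invr_ge0 ltW.
    rewrite (powRM s bi0 (normr_ge0 _)).
    rewrite mulrCA hx mulrC.
    have -> : (b c w)^-1 `^ s = B c w `^ (r - 1).
      rewrite -powRN -powRrM; congr (_ `^ _); rewrite /al /r; field; exact: lt0r_neq0.
    have r01 : 0 < r <= 1 by rewrite r0 r1.
    have := concave_powR_sub r01 x0 xB (B0 c w).
    move=> /(ler_wpM2l rv0); rewrite mulKf ?gt_eqF// => /le_trans; apply.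
  elim: k => [|k IH].
    rewrite big_ord_recr big_ord0 /= add0r.
    apply: le_trans (step 0%N e (ltW e0) (eB 0%N w) _) _.
      by rewrite /B big_ord_recr big_ord0 /= add0r addrAC subrr add0r.
    by rewrite ler_wpM2l// gerBl powR_ge0.
  rewrite big_ord_recr /=; apply: le_trans (lerD IH (step k.+1 (B k w) _ _ _)) _.
  - exact: ltW.
  - by rewrite BS lerDl.
  - by rewrite BS addrAC subrr add0r.
  - by rewrite -mulrDr addrC subrK.
have eG : (\int[P]_w (G w `^ s)%:E <= (Cb / r)%:E * \int[P]_w (B m w `^ r)%:E)%E.
  have vs c : (\int[P]_w (`|v' c w| `^ s)%:E < +oo)%E by exact: (all_moments_lty (v's c)).
  apply: le_trans (HCb _ _ _ _ _ _ HP _ sv' vs n) _.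
  rewrite EFinM -muleA; apply: lee_wpmul2l; first by rewrite lee_fin.
  rewrite -(expect_momentsZ Br rv0).
  rewrite (eq_bigr (fun c : 'I_n => (\int[P]_w (h c * `|v' c w| `^ s)%:E)%E)); last first.
    by move=> c _; rewrite (expect_momentsZ (v's c)).
  rewrite -(expect_moments_sum (index_enum 'I_n) (fun c : 'I_n => hv's c)).
  apply: (le_expect_moments _ (all_momentsZ rv0 Br)).
    by apply: all_moments_sum => c; exact: hv's.
  by move=> w; rewrite nm; exact: riemann.
have -> : (\int[P]_w ((e + \sum_(c < n) h c * `|v c w| `^ s) `^ (p / s))%:E =
    \int[P]_w (B m w `^ r)%:E)%E by rewrite nm.
apply: (@le_trans _ _ (\int[P]_w (2 `^ p * (G w `^ s + B m w `^ r))%:E)%E).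
  have GB := all_momentsZ two0 (all_momentsD Gs Br).
  exact: (le_expect_moments (all_moments_powR p0 Mm) GB).
rewrite (expect_momentsZ (all_momentsD Gs Br) two0) (expect_momentsD Gs Br).
rewrite EFinM -muleA; apply: lee_wpmul2l; first by rewrite lee_fin.
have I0 : (0 <= \int[P]_w (B m w `^ r)%:E)%E by apply: expect_ge0 => w; exact: powR_ge0.
rewrite EFinD ge0_muleDl ?lee_fin// ?mulr_ge0//.
by rewrite mul1e; apply: leeD.
Qed.

Lemma poisson_sum_moment {R : realType} (p : R) : 1 <= p ->
  exists2 C : R, 0 <= C &
  forall d (O : measurableType d) (P : probability O R) gen eta h,
  poisson_increments P gen eta h ->
  forall y : nat -> O -> R,
  (forall c, measurable_fun setT (y c : g_sigma_algebraType (gen c) -> R)) ->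
  (forall c, all_moments P (y c)) ->
  forall n, all_moments P (fun w => \sum_(c < n) (eta c w)%:R * y c w) /\
  (\int[P]_w ((\sum_(c < n) (eta c w)%:R * y c w) `^ p)%:E <=
   C%:E * (\int[P]_w ((\sum_(c < n) h c * y c w) `^ p)%:E +
           \int[P]_w (\sum_(c < n) h c * y c w `^ p)%:E))%E.
Proof.
move=> p1; have p0 : 0 < p by lra. have pm0 : 0 <= p - 1 by lra.
pose C5 := p * 2 `^ (p - 1); have C50 : 0 <= C5 by rewrite mulr_ge0 ?powR_ge0// ltW.
have [C' C'0 HC'] := absorb_powR p1 C50.
have [K K0 HK] := poisson_mass_moment ler01 p1.
have i2 : 0 <= 2^-1 :> R by rewrite invr_ge0.
exists (2 * (C' + C5 * K)); first by rewrite mulr_ge0// addr_ge0// mulr_ge0.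
move=> d O P gen eta h HP y my ym n.
have h0 c : 0 <= h c by have /andP[] := incr_param HP c.
have y0 c w : 0 <= y c w by have [_] := ym c.
pose N c w := (eta c w)%:R * y c w.
have mN c : measurable_fun setT (N c : g_sigma_algebraType (gen c.+1) -> R).
  apply: measurable_funM; first exact: (eta_mfun HP c (fun m => m%:R : R)).2.
  by move=> _ B mB; apply: (incr_mono HP); exact: my.
have N0 c w : 0 <= N c w by rewrite mulr_ge0.
have Nq q L c : 1 <= q -> moment_bound q L -> (\int[P]_w (N c w `^ q)%:E <=
    (L * h c)%:E * \int[P]_w (y c w `^ q)%:E)%E.
  move=> q1 [L0 HL].
  under eq_integral do rewrite (powRM q (ler0n _ _) (y0 c _)).
  apply: (@incr_moment_le _ _ _ _ _ _ _ HP c (fun m => m%:R `^ q) L (fun w => y c w `^ q)).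
  - by move=> m; exact: powR_ge0.
  - exact: (HL _ (incr_param HP c)).
  - by apply: (@measurable_powR_fun _ _ (g_sigma_algebraType (gen c))).
  - by move=> w; exact: powR_ge0.
  - by have [_ _] := ym c; apply.
have Nm c : all_moments P (N c).
  split; [exact: (incr_mfun HP (mN c))|exact: N0|move=> q q1].
  have [L L0 HL] := poisson_mass_moment ler01 q1.
  apply: le_lt_trans (Nq q L c q1 (conj L0 HL)) _.
  apply: lte_mul_pinfty => //; first by rewrite lee_fin mulr_ge0.
  by have [_ _] := ym c; apply.
pose a k w := \sum_(c < k) N c w.
have am k : all_moments P (a k) by apply: all_moments_sum => c; exact: Nm.
split; first exact: am.
have a0 k w : 0 <= a k w by apply: sumr_ge0.
have ma k : measurable_fun setT (a k : g_sigma_algebraType (gen k) -> R).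
  apply: (@measurable_sum _ (g_sigma_algebraType (gen k)) _ setT 'I_k _ (fun (c : 'I_k) w => N c w)).
  by move=> c; exact: (incr_mfunW HP (ltn_ord c) (mN c)).
have apm k : all_moments P (fun w => a k w `^ (p - 1)).
  have [pm|pm] := eqVneq (p - 1) 0.
    rewrite (_ : (fun w => _) = fun=> 1); first exact: all_moments_cst.
    by apply/funext => w; rewrite pm powRr0.
  have pm0' : 0 < p - 1 by rewrite lt_def pm pm0.
  exact: (all_moments_powR pm0' (am k)).
pose H w := \sum_(c < n) h c * y c w.
have H0 w : 0 <= H w by apply: sumr_ge0 => c _; rewrite mulr_ge0.
have Hm : all_moments P H by apply: all_moments_sum => c; exact: (all_momentsZ (h0 c) (ym c)).
pose B w := \sum_(c < n) h c * y c w `^ p.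
have hyp c := all_momentsZ (h0 c) (all_moments_powR p0 (ym c)).
have Bm : all_moments P B by apply: all_moments_sum => c; exact: hyp.
pose t1 c w := (eta c w)%:R * (y c w * a c w `^ (p - 1)).
pose t2 c w := N c w `^ p.
have t1m c : all_moments P (t1 c).
  rewrite (_ : t1 c = fun w => N c w * a c w `^ (p - 1)).
    exact: (all_momentsM (Nm c) (apm c)).
  by apply/funext => w; rewrite /t1 mulrA.
have t2m c : all_moments P (t2 c) by exact: (all_moments_powR p0 (Nm c)).
have path w k : a k w `^ p <= C5 * \sum_(c < k) (t1 c w + t2 c w).
  elim: k => [|k IH]; first by rewrite /a !big_ord0 powR0 ?gt_eqF// mulr0.
  rewrite /a big_ord_recr /= -/(a k w) big_ord_recr /= mulrDr.
  apply: le_trans (powR_addl p1 (a0 k w) (N0 k w)) _; apply: lerD => //.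
  rewrite /C5 -mulrA; apply: ler_wpM2l; first exact: ltW.
  apply: (@le_trans _ _ (N k w * (2 `^ (p - 1) * (a k w `^ (p - 1) + N k w `^ (p - 1))))).
    by apply: ler_wpM2l => //; exact: powR_addr.
  rewrite mulrCA; apply: ler_wpM2l; first exact: powR_ge0.
  by rewrite mulrDr (mulr_powRB1 (N0 k w) p0) /t1 mulrA.
have e1 c : (\int[P]_w (t1 c w)%:E <= \int[P]_w (h c * (y c w * a c w `^ (p - 1)))%:E)%E.
  have yam := all_momentsM (ym c) (apm c).
  rewrite (expect_momentsZ yam (h0 c)) -[X in (X%:E * _)%E]mul1r.
  apply: (@incr_moment_le _ _ _ _ _ _ _ HP c (fun m => m%:R) 1
    (fun w => y c w * a c w `^ (p - 1))).
  - by [].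
  - by rewrite poisson_mass_mean// mul1r.
  - apply: measurable_funM; first exact: my.
    by apply: (@measurable_powR_fun _ _ (g_sigma_algebraType (gen c))).
  - by have [] := yam.
  - exact: (all_moments_lty yam).
have Ap := all_moments_powR p0 (am n); have Hp := all_moments_powR p0 Hm.
have AH := all_momentsM (apm n) Hm.
have E1 : (\int[P]_w (a n w `^ p)%:E <=
    C5%:E * (\int[P]_w (a n w `^ (p - 1) * H w)%:E + K%:E * \int[P]_w (B w)%:E))%E.
  have tm c := all_momentsD (t1m c) (t2m c).
  have sm : all_moments P (fun w => \sum_(c < n) (t1 c w + t2 c w)).
    by apply: all_moments_sum => c; exact: tm.
  apply: (@le_trans _ _ (\int[P]_w (C5 * \sum_(c < n) (t1 c w + t2 c w))%:E)%E).
    apply: (le_expect_moments Ap (all_momentsZ C50 sm)).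
    by move=> w; exact: path.
  rewrite (expect_momentsZ sm C50); apply: lee_wpmul2l; first by rewrite lee_fin.
  rewrite (expect_moments_sum _ (fun c : 'I_n => tm c)).
  rewrite (eq_bigr (fun c : 'I_n => (\int[P]_w (t1 c w)%:E + \int[P]_w (t2 c w)%:E)%E)); last first.
    by move=> c _; rewrite (expect_momentsD (t1m c) (t2m c)).
  rewrite big_split; apply: leeD.
    have hym c := all_momentsZ (h0 c) (all_momentsM (ym c) (apm c)).
    apply: le_trans (lee_sum _ (fun (c : 'I_n) _ => e1 c)) _.
    rewrite -(expect_moments_sum (index_enum 'I_n) (fun c : 'I_n => hym c)).
    apply: (le_expect_moments _ AH).
      by apply: all_moments_sum => c; exact: hym.
    move=> w; rewrite mulr_sumr; apply: ler_sum => c _.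
    rewrite mulrA mulrC; apply: ler_wpM2r; first by rewrite mulr_ge0.
    apply: (le_powR pm0 (a0 c w)); rewrite /a.
    rewrite -(big_mkord xpredT (fun c => N c w)) -(big_mkord xpredT (fun c => N c w)).
    by rewrite [leRHS](big_cat_nat (leq0n c) (ltnW (ltn_ord c)))//= lerDl sumr_ge0.
  rewrite (expect_moments_sum _ (fun c : 'I_n => hyp c)).
  rewrite ge0_sume_distrr; last first.
    by move=> c _; apply: expect_ge0 => w; rewrite mulr_ge0// powR_ge0.
  apply: lee_sum => c _.
  rewrite (expect_momentsZ (all_moments_powR p0 (ym c)) (h0 c)) muleA -EFinM.
  exact: (Nq p K c p1 (conj K0 HK)).
have E2 : (C5%:E * \int[P]_w (a n w `^ (p - 1) * H w)%:E <=
    (2^-1)%:E * \int[P]_w (a n w `^ p)%:E + C'%:E * \int[P]_w (H w `^ p)%:E)%E.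
  rewrite -(expect_momentsZ AH C50) -(expect_momentsZ Ap i2) -(expect_momentsZ Hp C'0).
  rewrite -(expect_momentsD (all_momentsZ i2 Ap) (all_momentsZ C'0 Hp)).
  apply: (le_expect_moments (all_momentsZ C50 AH)
    (all_momentsD (all_momentsZ i2 Ap) (all_momentsZ C'0 Hp))).
  by move=> w; exact: HC'.
rewrite -/(a n _) -/(H _) -/(B _); move: E1 E2.
have X0 (k : O -> R) : all_moments P k -> (0 <= \int[P]_w (k w)%:E)%E.
  by move=> [_ k0 _]; exact: expect_ge0.
have := X0 _ Ap; have := X0 _ AH; have := X0 _ Hp; have := X0 _ Bm.
have := all_moments_lty Ap; have := all_moments_lty AH.
have := all_moments_lty Hp; have := all_moments_lty Bm.
rewrite -/(a n _) -/(H _) -/(B _).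
case: (\int[P]_w (a n w `^ p)%:E)%E => [xA| |]//.
case: (\int[P]_w (a n w `^ (p - 1) * H w)%:E)%E => [xAH| |]//.
case: (\int[P]_w (H w `^ p)%:E)%E => [xH| |]//.
case: (\int[P]_w (B w)%:E)%E => [xB| |]//.
do 9 rewrite -?EFinM -?EFinD; rewrite !lee_fin => _ _ _ _ xB0 xH0 xAH0 xA0 l1 l2.
have l3 := mulr_ge0 C'0 xB0; have l4 := mulr_ge0 (mulr_ge0 C50 K0) xH0.
rewrite mulrDr in l1; lra.
Qed.

Section level_process.
Context {R : realType} d (O : measurableType d) (P : probability O R).
Context (gen : nat -> set (set O)) (eta : nat -> O -> nat) (h : nat -> R).
Hypothesis HP : poisson_increments P gen eta h.
Local Notation F c := (g_sigma_algebraType (gen c)).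
Context (s p : R) (hps : 1 <= p <= s) (x : nat -> O -> R).
Hypothesis mx : forall c, measurable_fun setT (x c : F c -> R).
Hypothesis xm : forall c, all_moments P (x c).

Let h0 c : 0 <= h c. Proof. by have /andP[] := incr_param HP c. Qed.
Let x0 c w : 0 <= x c w. Proof. by have [_] := xm c. Qed.
Local Notation L c w := (level s p h (x ^~ w) c).

Lemma level_measurable c : measurable_fun setT ((fun w => L c w) : F c -> R).
Proof.
elim: c => [|c IH]; first exact: measurable_cst.
have mpow q (f : F c -> R) : measurable_fun setT f -> measurable_fun setT (fun w => f w `^ q).
  exact: (@measurable_powR_fun _ _ (F c)).
have m : measurable_fun setT ((fun w => L c.+1 w) : F c -> R).
  under eq_fun do rewrite levelS.
  apply: measurable_fun_ifT.
  - by apply: measurable_fun_ler.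
  - apply: (mpow s^-1); apply: measurable_funD; first exact: mpow.
    by apply: measurable_funM => //; exact: mpow.
  - apply: measurable_funD; last exact: measurable_funM.
    apply: (mpow p^-1); apply: measurable_funD; first exact: mpow.
    by apply: measurable_funM => //; exact: mpow.
by move=> _ B mB; apply: (incr_mono HP); exact: m.
Qed.

Lemma level_all_moments c : all_moments P (fun w => L c w).
Proof.
have /andP[p1 ps] := hps.
have Lge0 n w : 0 <= L n w by apply: level_ge0.
elim: c => [|c IH]; first exact: all_moments_cst.
have three0 : 0 <= 3 :> R by [].
apply: (all_moments_le _ _ (all_momentsZ three0 (all_momentsD IH (xm c)))).
- by apply: (incr_mfun HP); exact: level_measurable.
- by move=> w; exact: Lge0.
move=> w; have hc1 : h c <= 1 by have /andP[] := incr_param HP c.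
have aux q : 1 <= q ->
    (L c w `^ q + h c * x c w `^ q) `^ q^-1 <= 2 * (L c w + x c w).
  move=> q1; have q0 : 0 < q by lra.
  have Lx0 : 0 <= L c w + x c w by rewrite addr_ge0.
  rewrite -[leRHS](@powRK _ q)//; last by rewrite mulr_ge0.
  apply: le_powR; first by rewrite invr_ge0 ltW.
    by rewrite addr_ge0 ?mulr_ge0 ?powR_ge0.
  have two0 : 0 <= 2 :> R by [].
  rewrite (powRM q two0 Lx0); apply: (@le_trans _ _ (2 * (L c w + x c w) `^ q)).
    rewrite mulr_natl mulr2n; apply: lerD.
      by apply: le_powR; [exact: ltW|exact: Lge0|rewrite lerDl].
    apply: (@le_trans _ _ (1 * x c w `^ q)).
      by apply: ler_wpM2r => //; exact: powR_ge0.
    by rewrite mul1r; apply: le_powR; [exact: ltW|exact: x0|rewrite lerDr].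
  apply: ler_wpM2r; first exact: powR_ge0.
  by apply: le1r_powR => //; lra.
have Lc0 := Lge0 c w; have xc0 := x0 c w.
rewrite levelS; case: ifPn => _.
  have := aux s (le_trans p1 ps); lra.
have := aux p p1; have : h c * x c w <= 1 * x c w by apply: ler_wpM2r.
lra.
Qed.

End level_process.

Lemma stoch_sum_le_level {R : realType} (s p : R)
    (Y : completeNormedModType R) : 1 < s -> 1 <= p < s -> martingale_type s Y ->
  exists2 C : R, 0 <= C &
  forall d (O : measurableType d) (P : probability O R) gen eta h,
  poisson_increments P gen eta h ->
  forall v : nat -> O -> Y,
  (forall c, strongly_measurable <<s gen c>> (v c)) ->
  (forall c, all_moments P (fun w => `|v c w|)) ->
  forall n,
  (\int[P]_w (rmax (fun k => `|stoch_sum eta h v k w|) n `^ p)%:E <=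
   C%:E * \int[P]_w (level s p h (fun c => `|v c w|) n `^ p)%:E)%E.
Proof.
move=> s1 p1s hY; have /andP[p1 ps] := p1s.
have s0 : 0 < s by lra. have p0 : 0 < p by lra.
have hps : 1 <= p <= s by rewrite p1 ltW.
have [Cs Cs0 HCs] := stoch_sum_small_exponent s1 p1s hY.
have [Cl Cl0 HCl] := poisson_sum_moment p1.
pose r := p / s; have r0 : 0 < r by rewrite divr_gt0.
have two_p : 0 <= 2 `^ p :> R by exact: powR_ge0.
have two_r : 0 <= 2 `^ r :> R by exact: powR_ge0.
pose D := 2 `^ p * (2 `^ p * (Cl * 2 + 1)) + 2 `^ p * (Cs * 2 `^ r).
have D10 : 0 <= Cs * 2 `^ r by rewrite mulr_ge0.
have D20 : 0 <= Cl * 2 + 1 by rewrite addr_ge0// mulr_ge0.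
exists D; first by rewrite addr_ge0 ?mulr_ge0.
move=> d O P gen eta h HP v sv vm n.
have h0 c : 0 <= h c by have /andP[] := incr_param HP c.
pose x c w := `|v c w|.
have x0 c w : 0 <= x c w by exact: normr_ge0.
have mx c : measurable_fun setT (x c : g_sigma_algebraType (gen c) -> R).
  exact: (coef_norm_measurable HP (leqnn c) (sv c)).
pose L c w := level s p h (x ^~ w) c.
have Lm c : all_moments P (L c) by exact: (level_all_moments HP hps mx vm).
have mL c : measurable_fun setT (L c : g_sigma_algebraType (gen c) -> R).
  exact: (level_measurable HP s p mx).
have L0 c w : 0 <= L c w by exact: level_ge0.
have mb c : measurable_fun setT ((fun w => x c w <= L c w) : g_sigma_algebraType (gen c) -> bool).
  exact: measurable_fun_ler.
have mB c (b : bool) : measurable_fun setT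
    ((fun w => if x c w <= L c w then b%:R else (~~ b)%:R) : g_sigma_algebraType (gen c) -> R).
  by apply: measurable_fun_ifT.
pose v0 c w := (if x c w <= L c w then true%:R else (~~ true)%:R) *: v c w.
pose v1 c w := (if x c w <= L c w then false%:R else (~~ false)%:R) *: v c w.
have sv0 c : strongly_measurable <<s gen c>> (v0 c).
  by apply: (@strongly_measurableZ _ _ (g_sigma_algebraType (gen c))); [exact: mB|exact: sv].
have sv1 c : strongly_measurable <<s gen c>> (v1 c).
  by apply: (@strongly_measurableZ _ _ (g_sigma_algebraType (gen c))); [exact: mB|exact: sv].
have nv0 c w : `|v0 c w| = (x c w <= L c w)%R%:R * x c w.
  by rewrite /v0 normrZ; case: ifP; rewrite /= ?normr1 ?normr0.
have nv1 c w : `|v1 c w| = (L c w < x c w)%R%:R * x c w.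
  by rewrite /v1 normrZ ltNge; case: ifP; rewrite /= ?normr1 ?normr0.
have b01 (b : bool) : b%:R <= 1 :> R by case: b.
have mnO c (u : nat -> O -> Y) : strongly_measurable <<s gen c>> (u c) ->
    measurable_fun setT (fun w => `|u c w|).
  by move=> su; apply: (incr_mfun HP); exact: (coef_norm_measurable HP (leqnn c) su).
have v0m c : all_moments P (fun w => `|v0 c w|).
  apply: (all_moments_le _ _ (vm c)); [exact: (mnO c v0)|by move=> w; exact: normr_ge0|].
  by move=> w; rewrite nv0; apply: ler_piMl => //; exact: (b01 (x c w <= L c w)%R).
have v1m c : all_moments P (fun w => `|v1 c w|).
  apply: (all_moments_le _ _ (vm c)); [exact: (mnO c v1)|by move=> w; exact: normr_ge0|].
  by move=> w; rewrite nv1; apply: ler_piMl => //; exact: (b01 (L c w < x c w)%R).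
pose M (u : nat -> O -> Y) w := rmax (fun k => `|stoch_sum eta h u k w|) n.
have M0 u w : 0 <= M u w by exact: rmax_ge0.
have Mm : all_moments P (M v) by exact: (stoch_max_all_moments HP sv vm n).
have Mm0 : all_moments P (M v0) by exact: (stoch_max_all_moments HP sv0 v0m n).
pose y c w := `|v1 c w|.
have my c : measurable_fun setT (y c : g_sigma_algebraType (gen c) -> R).
  exact: (coef_norm_measurable HP (leqnn c) (sv1 c)).
have [am HA] := HCl _ _ _ _ _ _ HP y my v1m n.
set a := (fun w => \sum_(c < n) (eta c w)%:R * y c w) in am HA.
have y0 c w : 0 <= y c w by exact: normr_ge0.
have a0 w : 0 <= a w by apply: sumr_ge0 => c _; rewrite mulr_ge0.
have HyL w : \sum_(c < n) h c * y c w <= L n w.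
  have := level_large1 hps h0 (x0 ^~ w) n; congr (_ <= _).
  by apply: eq_bigr => c _; rewrite /y nv1 mulrCA.
have path1 w : M v w <= M v0 w + (a w + L n w).
  apply: rmax_le => k kn.
  have -> : stoch_sum eta h v k w = stoch_sum eta h v0 k w + stoch_sum eta h v1 k w.
    rewrite /stoch_sum -big_split; apply: eq_bigr => c _ /=.
    rewrite -scalerDr /v0 /v1 -scalerDl.
    by case: ifP; rewrite /= ?addr0 ?add0r scale1r.
  apply: le_trans (ler_normD _ _) _; apply: lerD.
    exact: (rmax_ge (fun k => `|stoch_sum eta h v0 k w|)).
  apply: le_trans (ler_norm_sum _ _ _) _.
  apply: (@le_trans _ _ (\sum_(c < n) ((eta c w)%:R * y c w + h c * y c w))).
    rewrite -(big_mkord xpredT (fun c => `|increment eta h c w *: v1 c w|)).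
    rewrite -(big_mkord xpredT (fun c => (eta c w)%:R * y c w + h c * y c w)).
    rewrite [leRHS](big_cat_nat (leq0n k) kn)//=.
    apply: ler_wpDr.
      by apply: sumr_ge0 => c _; rewrite addr_ge0// mulr_ge0// normr_ge0.
    apply: ler_sum => c _; rewrite normrZ -mulrDl; apply: ler_wpM2r; first exact: normr_ge0.
    by apply: le_trans (ler_normB _ _) _; rewrite !ger0_norm.
  by rewrite big_split /= lerD2l.
have path w : M v w `^ p <= 2 `^ p * (M v0 w `^ p + 2 `^ p * (a w `^ p + L n w `^ p)).
  apply: (@le_trans _ _ ((M v0 w + (a w + L n w)) `^ p)).
    by apply: le_powR; [exact: ltW|exact: M0|exact: path1].
  apply: le_trans (powR_addr (ltW p0) (M0 _ _) (addr_ge0 (a0 w) (L0 n w))) _.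
  by apply: ler_wpM2l => //; rewrite lerD2l; exact: powR_addr (ltW p0) (a0 w) (L0 n w).
have Lp := all_moments_powR p0 (Lm n).
have ap := all_moments_powR p0 am; have M0p := all_moments_powR p0 Mm0.
have eA : (\int[P]_w (a w `^ p)%:E <= (Cl * 2)%:E * \int[P]_w (L n w `^ p)%:E)%E.
  apply: le_trans HA _; rewrite EFinM -muleA; apply: lee_wpmul2l; first by rewrite lee_fin.
  have -> : (2%:E * \int[P]_w (L n w `^ p)%:E = \int[P]_w (L n w `^ p)%:E + \int[P]_w (L n w `^ p)%:E)%E.
    by rewrite mule_natl mule2n.
  have hy1 : all_moments P (fun w => \sum_(c < n) h c * y c w).
    by apply: all_moments_sum => c; exact: (all_momentsZ (h0 c) (v1m c)).
  apply: leeD.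
    apply: (le_expect_moments (all_moments_powR p0 hy1) Lp) => w.
    apply: le_powR; [exact: ltW| |exact: HyL].
    by apply: sumr_ge0 => c _; rewrite mulr_ge0// normr_ge0.
  apply: (le_expect_moments _ Lp).
    apply: all_moments_sum => c.
    exact: (all_momentsZ (h0 c) (all_moments_powR p0 (v1m c))).
  move=> w; have := level_large hps h0 (x0 ^~ w) n; congr (_ <= _).
  apply: eq_bigr => c _; rewrite /y nv1; case: (_ < _)%R; rewrite ?mul1r//.
  by rewrite !mul0r powR0 ?gt_eqF// mulr0.
have eM0 (e : R) : 0 < e -> (\int[P]_w (M v0 w `^ p)%:E <=
    (Cs * 2 `^ r)%:E * ((e `^ r)%:E + \int[P]_w (L n w `^ p)%:E))%E.
  move=> e0; apply: le_trans (HCs _ _ _ _ _ _ HP v0 sv0 v0m n e e0) _.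
  rewrite EFinM -muleA; apply: lee_wpmul2l; first by rewrite lee_fin.
  have er0 : 0 <= e `^ r by exact: powR_ge0.
  have -> : ((e `^ r)%:E = \int[P]_w (e `^ r)%:E)%E.
    by rewrite integral_cst// [X in (_ * X)%E](_ : _ = 1%E) ?mule1//; exact: probability_setT.
  rewrite -(expect_momentsD (all_moments_cst P er0) Lp).
  rewrite -(expect_momentsZ (all_momentsD (all_moments_cst P er0) Lp) two_r).
  apply: (le_expect_moments _ (all_momentsZ two_r (all_momentsD (all_moments_cst P er0) Lp))).
    apply: (all_moments_powR r0); apply: (all_momentsD (all_moments_cst P (ltW e0))).
    apply: all_moments_sum => c.
    exact: (all_momentsZ (h0 c) (all_moments_powR s0 (v0m c))).
  move=> w; have S0 : 0 <= \sum_(c < n) h c * `|v0 c w| `^ s.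
    by apply: sumr_ge0 => c _; rewrite mulr_ge0// powR_ge0.
  apply: le_trans (powR_addr (ltW r0) (ltW e0) S0) _.
  apply: ler_wpM2l => //; rewrite lerD2l.
  have -> : L n w `^ p = (L n w `^ s) `^ r.
    by rewrite -powRrM /r mulrCA divff ?gt_eqF// mulr1.
  apply: le_powR => //; first exact: ltW.
  have := level_small hps h0 (x0 ^~ w) n; congr (_ <= _).
  apply: eq_bigr => c _; rewrite nv0; case: (_ <= _)%R; rewrite ?mul1r//.
  by rewrite !mul0r powR0 ?gt_eqF// mulr0.
have eM : (\int[P]_w (M v0 w `^ p)%:E <= (Cs * 2 `^ r)%:E * \int[P]_w (L n w `^ p)%:E)%E.
  apply/lee_addgt0Pr => e e0.
  pose e' := e / (Cs * 2 `^ r + 1).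
  have C1 : 0 < Cs * 2 `^ r + 1 by rewrite ltr_wpDl.
  have e'0 : 0 < e' by rewrite divr_gt0.
  apply: le_trans (eM0 (e' `^ r^-1) (powR_gt0 _ e'0)) _.
  have I0 : (0 <= \int[P]_w (L n w `^ p)%:E)%E by apply: expect_ge0 => w; exact: powR_ge0.
  have e'1 : (0 <= e'%:E)%E by rewrite lee_fin ltW.
  rewrite (powRVK r0 (ltW e'0)) (ge0_muleDr _ e'1 I0).
  rewrite addeC; apply: leeD => //; rewrite -EFinM lee_fin /e'.
  rewrite mulrA ler_pdivrMr// mulrC ler_wpM2l//; first exact: ltW.
  by rewrite lerDl.
have aL := all_momentsD ap Lp.
have maL := all_momentsD M0p (all_momentsZ two_p aL).
apply: (@le_trans _ _ (\int[P]_w (2 `^ p * (M v0 w `^ p + 2 `^ p * (a w `^ p + L n w `^ p)))%:E)%E).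
  exact: (le_expect_moments (all_moments_powR p0 Mm) (all_momentsZ two_p maL)).
rewrite (expect_momentsZ maL two_p) (expect_momentsD M0p (all_momentsZ two_p aL)).
rewrite (expect_momentsZ aL two_p) (expect_momentsD ap Lp).
rewrite -/(x _ _) -/(L n _); move: eA eM.
have X0 (k : O -> R) : all_moments P k -> (0 <= \int[P]_w (k w)%:E)%E.
  by move=> [_ k0 _]; exact: expect_ge0.
have := X0 _ Lp; have := X0 _ ap; have := X0 _ M0p.
have := all_moments_lty Lp; have := all_moments_lty ap; have := all_moments_lty M0p.
case: (\int[P]_w (M v0 w `^ p)%:E)%E => [xM| |]//.
case: (\int[P]_w (a w `^ p)%:E)%E => [xa| |]//.
case: (\int[P]_w (L n w `^ p)%:E)%E => [xL| |]//.
do 9 rewrite -?EFinM -?EFinD; rewrite !lee_fin => _ _ _ xM0 xa0 xL0 l1 l2.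
have l3 := ler_wpM2l two_p l2.
have l4 := ler_wpM2l two_p (ler_wpM2l two_p l1).
rewrite /D; lra.
Qed.

Lemma stoch_sum_le_modular {R : realType} (s p C0 : R)
    (Y : completeNormedModType R) : 1 < s -> 1 <= p < s -> martingale_type s Y ->
  exists2 C : R, 0 <= C &
  forall d (O : measurableType d) (P : probability O R) gen eta h,
  poisson_increments P gen eta h ->
  forall v : nat -> O -> Y,
  (forall c, strongly_measurable <<s gen c>> (v c)) ->
  (forall c, all_moments P (fun w => `|v c w|)) ->
  forall n (K : O -> R), measurable_fun setT K -> (forall w, 0 < K w) ->
  {ae P, forall w, \sum_(c < n) h c * modular s p (K w) `|v c w| <= C0} ->
  (\int[P]_w (rmax (fun k => `|stoch_sum eta h v k w|) n `^ p)%:E <=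
   C%:E * \int[P]_w (K w `^ p)%:E)%E.
Proof.
move=> s1 p1s hY; have /andP[p1 ps] := p1s.
have s0 : 0 < s by lra. have p0 : 0 < p by lra.
have hps : 1 <= p <= s by rewrite p1 ltW.
have [C1 C10 HC1] := stoch_sum_le_level s1 p1s hY.
pose e3 := (3 * expR (2 * C0)) `^ p.
have e30 : 0 <= e3 by exact: powR_ge0.
exists (C1 * e3); first by rewrite mulr_ge0.
move=> d O P gen eta h HP v sv vm n K mK K0 HK.
have h0 c : 0 <= h c by have /andP[] := incr_param HP c.
apply: le_trans (HC1 _ _ _ _ _ _ HP v sv vm n) _.
rewrite EFinM -muleA; apply: lee_wpmul2l; first by rewrite lee_fin.
have mx c : measurable_fun setT ((fun w => `|v c w|) : g_sigma_algebraType (gen c) -> R).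
  exact: (coef_norm_measurable HP (leqnn c) (sv c)).
have mKp : measurable_fun setT (fun w => K w `^ p) by exact: measurable_powR_fun.
rewrite -(expectZ _ mKp) //; last by move=> w; exact: powR_ge0.
have [mLp Lp0 _] := all_moments_powR p0 (level_all_moments HP hps mx vm n).
apply: ae_ge0_le_integral => //.
- by move=> w _; rewrite lee_fin.
- exact/measurable_EFinP.
- by move=> w _; rewrite lee_fin mulr_ge0// powR_ge0.
- by apply/measurable_EFinP; exact: measurable_funM.
apply: filterS HK => w Hw _.
have e33 : 0 <= 3 * expR (2 * C0) by rewrite mulr_ge0// expR_ge0.
rewrite lee_fin -(powRM p e33 (ltW (K0 w))).
apply: le_powR; first exact: ltW.
  by apply: level_ge0 => // c; exact: normr_ge0.
have := @level_le R s p hps h (fun c => `|v c w|) h0 (fun c => normr_ge0 _) (K w) n (K0 w).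
move=> /(_ _)/le_trans; apply.
  by move=> c _; have /andP[] := incr_param HP c.
rewrite mulrAC; apply: ler_wpM2r; first exact: ltW.
by rewrite ler_wpM2l// ler_expR ler_wpM2l.
Qed.

(** * Independence of disjoint regions *)

Section independence_class.
Context {R : realType} d (O : measurableType d) (P : probability O R).
Variables (F : set O) (mF : measurable F).
Local Open Scope ereal_scope.

Lemma independentC A : measurable A -> P (A `&` F) = P A * P F ->
  P (~` A `&` F) = P (~` A) * P F.
Proof.
move=> mA iA.
have fA := fin_num_measure P _ mA; have fF := fin_num_measure P _ mF.
have mAF : measurable (A `&` F) by exact: measurableI.
have fAF := fin_num_measure P _ mAF.
have -> : ~` A `&` F = F `\` (A `&` F).
  apply/seteqP; split=> w /=; first by move=> [nA Fw]; split=> // -[].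
  by move=> [Fw nAF]; split=> // Aw; apply: nAF.
have E : F `&` (A `&` F) = A `&` F by rewrite setIC -setIA setIid.
have -> : P (F `\` (A `&` F)) = P F - P (A `&` F).
  by rewrite measureD ?E// ltey_eq fF.
have -> : P (~` A) = 1 - P A by exact: probability_setC.
rewrite iA.
by rewrite muleBl ?mul1e// ?fin_num_adde_defr.
Qed.

Lemma independent_bigcup (A : nat -> set O) : (forall n, measurable (A n)) ->
  trivIset setT A -> (forall n, P (A n `&` F) = P (A n) * P F) ->
  P (\bigcup_n A n `&` F) = P (\bigcup_n A n) * P F.
Proof.
move=> mA tA iA; rewrite setI_bigcupl.
have mAF n : measurable (A n `&` F) by exact: measurableI.
rewrite measure_bigcup//=; last exact: trivIset_setIr.
rewrite measure_bigcup//=.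
rewrite (eq_eseriesr (fun n _ => iA n)).
rewrite -(@fineK _ (P F)) ?fin_num_measure//.
under eq_eseriesr do rewrite muleC.
by rewrite nneseriesZl// muleC.
Qed.

End independence_class.

Section region_independence.
Context {R : realType} dO (O : measurableType dO) (P : probability O R).
Context dE (E : measurableType dE).
Variables (mu : {sigma_finite_measure set E -> \bar R})
  (N : O -> {measure set E -> \bar R}).
Hypothesis HN : poisson_random_measure P mu N.

Definition gen_region (Rg : set E) : set (set O) :=
  [set D | exists (C : set E) (V : set (\bar R)),
     [/\ measurable C, C `<=` Rg & measurable V] /\ D = (N ^~ C) @^-1` V].

Lemma count_measurable C V : measurable C -> measurable V ->
  measurable ((N ^~ C) @^-1` V).
Proof.
move=> mC mV; rewrite -[X in measurable X]setTI.
exact: (prm_measurable HN mC measurableT mV).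
Qed.

Lemma gen_region_sub Rg : <<s gen_region Rg >> `<=` measurable.
Proof.
apply: smallest_sub; first exact: sigma_algebra_measurable.
by move=> _ [C [V [[mC _ mV] ->]]]; exact: count_measurable.
Qed.

Lemma gen_region_mono R1 R2 : R1 `<=` R2 ->
  <<s gen_region R1 >> `<=` <<s gen_region R2 >>.
Proof.
move=> R12; apply: smallest_sub; first exact: smallest_sigma_algebra.
move=> _ [C [V [[mC CR mV] ->]]]; apply: sub_sigma_algebra.
by exists C, V; split=> //; split=> //; exact: subset_trans R12.
Qed.

Lemma count_finite C : measurable C -> (mu C < +oo)%E ->
  P [set w | N w C = +oo%E] = 0%E.
Proof.
move=> mC Coo.
have mk k : measurable [set w | N w C = k%:R%:E].
  exact: (count_measurable mC (emeasurable_set1 k%:R%:E)).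
have -> : [set w | N w C = +oo%E] = ~` \bigcup_k [set w | N w C = k%:R%:E].
  apply/seteqP; split=> [w /= Noo [k _ /=]|w /= nk]; first by rewrite Noo.
  have [//|[k Nk]] := prm_integer HN w mC.
  by exfalso; apply: nk; exists k.
rewrite probability_setC; last exact: bigcup_measurable.
rewrite measure_bigcup//=; last first.
  by move=> i j _ _ [w [/= ->]] [/eqP]; rewrite eqr_nat => /eqP.
rewrite (eq_eseriesl (Q := xpredT)) => [|k]; last by rewrite in_setT.
rewrite (eq_eseriesr (fun k _ => prm_poisson HN mC Coo k)).
rewrite poisson_mass_sum1 ?subee//.
by rewrite fine_ge0.
Qed.

Section atoms.
Variables (Rg : set E) (mRg : measurable Rg).
Variables (T : finType) (C : T -> set E).
Hypotheses (mC : forall i, measurable (C i)) (CR : forall i, C i `<=` Rg).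

Definition atom (I : {set T}) : set E :=
  Rg `&` [set z | forall i, C i z <-> i \in I].

Lemma atom_measurable I : measurable (atom I).
Proof.
apply: measurableI => //.
have -> : [set z | forall i, C i z <-> i \in I] =
    \bigcap_(i in [set: T]) (if i \in I then C i else ~` C i).
  apply/seteqP; split=> [z zI i _|z zI i].
    have := zI i; case: ifP => iI [h1 h2]; first exact: h2.
    by move=> /h1.
  by have := zI i Logic.I; case: ifP => // iI h; split.
apply: fin_bigcap_measurable => // i _; case: ifP => _ //.
exact: measurableC.
Qed.

Lemma atom_trivIset : trivIset setT atom.
Proof.
move=> I I' _ _ [z [[_ /= zI] [_ /= zI']]]; apply/setP => i.
by apply/idP/idP => [/zI/zI'|/zI'/zI].
Qed.

Lemma bigcup_atom i : C i = \bigcup_(I in mkset (fun I : {set T} => i \in I)) atom I.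
Proof.
apply/seteqP; split=> [z Ciz|z [I /= iI [_ zI]]]; last exact/zI.
exists (finset (fun i => `[< C i z >])); first by rewrite /= inE; exact/asboolP.
split; first exact: CR Ciz.
by move=> j; rewrite inE; split=> /asboolP.
Qed.

Lemma measure_atom (rho : {measure set E -> \bar R}) i :
  rho (C i) = (\sum_(I : {set T} | i \in I) rho (atom I))%E.
Proof.
have E1 : mkset (fun I : {set T} => i \in I) =
    [set` seq.filter (fun I : {set T} => i \in I) (index_enum _)].
  by apply/seteqP; split=> I /=; rewrite mem_filter mem_index_enum andbT.
rewrite bigcup_atom E1 measure_fin_bigcup//.
- by rewrite -fsbig_seq ?filter_uniq ?index_enum_uniq// big_filter.
- exact: sub_trivIset atom_trivIset.
- by move=> I _; exact: atom_measurable.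
Qed.

Variables (D : set E) (V : set (\bar R)).
Hypotheses (mD : measurable D) (DR : Rg `&` D = set0) (mV : measurable V).
Local Notation F := ((N ^~ D) @^-1` V).
Local Notation cell a :=
  (\bigcap_(I in [set: {set T}]) [set w | N w (atom I) = a I]).

Lemma cell_measurable (a : {set T} -> \bar R) : measurable (cell a).
Proof.
apply: fin_bigcap_measurable => // I _.
exact: (count_measurable (atom_measurable I) (emeasurable_set1 (a I))).
Qed.

Lemma cell_independent (a : {set T} -> \bar R) :
  P (cell a `&` F) = (P (cell a) * P F)%E.
Proof.
pose K : finType := option {set T}.
pose B (i : 'I_#|K|) := if enum_val i is Some L then atom L else D.
pose W V0 (i : 'I_#|K|) :=
  if enum_val i is Some L then [set a L]%classic else V0.
have mB i : measurable (B i).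
  by rewrite /B; case: enum_val => // I; exact: atom_measurable.
have mW V0 : measurable V0 -> forall i, measurable (W V0 i).
  by move=> mV0 i; rewrite /W; case: enum_val.
have tB : trivIset setT B.
  move=> i j _ _ [z]; rewrite /B => -[].
  case Ei : (enum_val i) => [I|]; case Ej : (enum_val j) => [I'|].
  - move=> zI zI'; apply: enum_val_inj; rewrite Ei Ej; congr Some.
    by apply: (atom_trivIset (i := I) (j := I')) => //; exists z.
  - by move=> [Rz _] Dz; have : (Rg `&` D) z by []; rewrite DR.
  - by move=> Dz [Rz _]; have : (Rg `&` D) z by []; rewrite DR.
  - by move=> _ _; apply: enum_val_inj; rewrite Ei Ej.
have EW V0 : \bigcap_(i in [set: 'I_#|K|]) [set w | W V0 i (N w (B i))] =
    cell a `&` (N ^~ D) @^-1` V0.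
  apply/seteqP; split=> [w h|w [h1 h2] i _].
    split=> [I _|].
      by have := h (enum_rank (Some I)) Logic.I; rewrite /= /W /B enum_rankK.
    by have := h (enum_rank None) Logic.I; rewrite /= /W /B enum_rankK.
  by rewrite /= /W /B; case: enum_val => [I|//]; exact: h1.
have HT := prm_independent HN mB tB (mW _ (@measurableT _ (\bar R))).
have HV := prm_independent HN mB tB (mW _ mV).
rewrite !EW preimage_setT setIT in HT HV.
rewrite HV HT [in LHS](bigD1 (enum_rank (None : K)))//=.
rewrite [in RHS](bigD1 (enum_rank (None : K)))//=.
have -> : [set w | W V (enum_rank (None : K)) (N w (B (enum_rank None)))] = F.
  by rewrite /W /B enum_rankK.
have -> : [set w | W setT (enum_rank (None : K)) (N w (B (enum_rank None)))] =
    setT by rewrite /W enum_rankK.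
rewrite [X in (X * _ * _)%E](_ : _ = 1%E); last exact: probability_setT.
rewrite mul1e muleC; congr (_ * _)%E; apply: eq_bigr => i iN.
congr (P _); rewrite /W; case Ei : (enum_val i) => [//|].
by move: iN; rewrite -Ei enum_valK eqxx.
Qed.

(* The values of [N] being countable, an event depending only on the counts
   of the atoms is a countable union of cells. *)
Lemma atom_event_independent (W : set ({set T} -> \bar R)) :
  let A := [set w | W (fun I => N w (atom I))] in
  measurable A /\ P (A `&` F) = (P A * P F)%E.
Proof.
pose v (k : option nat) : \bar R := if k is Some k then k%:R%:E else +oo%E.
have v_inj : injective v.
  by move=> [k|] [l|]//= [/eqP]; rewrite eqr_nat => /eqP ->.
pose G m := if (pickle_inv m : option {ffun {set T} -> option nat}) is Some b
  then [set w | W (v \o b) /\ cell (v \o b) w] else set0.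
have GE m : G m = set0 \/ exists2 b : {set T} -> option nat,
    G m = cell (v \o b) & True.
  rewrite /G; case: pickle_inv => [b|]; last by left.
  have [Wb|nWb] := pselect (W (v \o b)); [right|left].
    by exists b => //; apply/seteqP; split=> w /=; [case|split].
  by apply/seteqP; split=> w // [].
have -> : [set w | W (fun I => N w (atom I))] = \bigcup_m G m.
  apply/seteqP; split=> [w /= Ww|w [m _]]; last first.
    rewrite /G; case: pickle_inv => // b [Wb cw] /=.
    by rewrite (_ : (fun I => _) = v \o b)//; apply/funext => I; exact: cw.
  have /choice[b bE] : forall I, exists k, N w (atom I) = v k.
    move=> I; have [->|[k ->]] := prm_integer HN w (atom_measurable I).
      by exists None.
    by exists (Some k).
  exists (pickle [ffun I => b I]) => //; rewrite /G pickleK_inv.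
  have -> : v \o [ffun I => b I] = fun I => N w (atom I).
    by apply/funext => I; rewrite /= ffunE bE.
  by split.
have mG m : measurable (G m).
  by have [->//|[b -> _]] := GE m; exact: cell_measurable.
split; first exact: bigcup_measurable.
apply: independent_bigcup => //.
- exact: count_measurable.
- move=> m m' _ _ [w []]; rewrite /G.
  have := @pickle_invK {ffun {set T} -> option nat} m.
  have := @pickle_invK {ffun {set T} -> option nat} m'.
  case: (pickle_inv m) => [b|//]; case: (pickle_inv m') => [b'|//] /= <- <-.
  move=> [_ cb] [_ cb'].
  congr pickle; apply/ffunP => I; apply: v_inj.
  by have := cb I Logic.I; have := cb' I Logic.I; rewrite /= => ->.
- move=> m; have [->|[b -> _]] := GE m; last exact: cell_independent.
  by rewrite set0I !measure0 mul0e.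
Qed.

End atoms.

Lemma region_independent (Rg D : set E) (V : set (\bar R)) : measurable Rg ->
  measurable D -> Rg `&` D = set0 -> measurable V ->
  forall A, <<s gen_region Rg >> A ->
  P (A `&` (N ^~ D) @^-1` V) = (P A * P ((N ^~ D) @^-1` V))%E.
Proof.
move=> mRg mD DR mV.
pose G := [set A | exists n (C : 'I_n -> set E) (W : set ('I_n -> \bar R)),
  [/\ forall i, measurable (C i), forall i, C i `<=` Rg &
      A = [set w | W (fun i => N w (C i))]]].
have GP A : G A -> measurable A /\
    P (A `&` (N ^~ D) @^-1` V) = (P A * P ((N ^~ D) @^-1` V))%E.
  move=> [n [C [W [mC CR ->]]]].
  have := atom_event_independent mRg mC mD DR mV
    [set a | W (fun i => \sum_(I : {set 'I_n} | i \in I) a I)%E].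
  rewrite /= (_ : (fun w => _) = [set w | W (fun i => N w (C i))])//.
  apply/seteqP; split=> w /=.
    by rewrite (_ : (fun i => _) = fun i => N w (C i))//; apply/funext => i;
       rewrite (measure_atom mRg mC CR).
  by rewrite (_ : (fun i => N w (C i)) = fun i =>
    \sum_(I : {set 'I_n} | i \in I) N w (atom Rg C I))%E//; apply/funext => i;
    rewrite (measure_atom mRg mC CR).
have sG : <<s gen_region Rg >> `<=` <<s G >>.
  apply: smallest_sub; first exact: smallest_sigma_algebra.
  move=> _ [C [W [[mC CR mW] ->]]]; apply: sub_sigma_algebra.
  by exists 1%N, (fun=> C), [set a | W (a ord0)]; split.
have GI : setI_closed G.
  move=> _ _ [n [C [W [mC CR ->]]]] [n' [C' [W' [mC' CR' ->]]]].
  exists (n + n')%N, (fun i => match fintype.split i with inl j => C j | inr j => C' j end).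
  exists [set a | W (fun i => a (lshift n' i)) /\ W' (fun i => a (rshift n i))].
  split=> [i|i|]; [by case: fintype.split|by case: fintype.split|].
  have El : forall w, (fun i => N w (match fintype.split (lshift n' i) with
      inl j => C j | inr j => C' j end)) = fun i => N w (C i).
    by move=> w; apply/funext => i; rewrite (unsplitK (inl i : 'I_n + 'I_n')).
  have Er : forall w, (fun i => N w (match fintype.split (rshift n i) with
      inl j => C j | inr j => C' j end)) = fun i => N w (C' i).
    by move=> w; apply/funext => i; rewrite (unsplitK (inr i : 'I_n + 'I_n')).
  by apply/seteqP; split=> w /=; rewrite El Er.
have mG : <<s G >> `<=` measurable.
  apply: smallest_sub; first exact: sigma_algebra_measurable.
  by move=> A /GP[].
have mF := count_measurable mD mV.
move=> A /sG; move: A.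
apply: (@dynkin_induction _ (g_sigma_algebraType G) G (fun A =>
  P (A `&` (N ^~ D) @^-1` V) = (P A * P ((N ^~ D) @^-1` V))%E)) => //.
- rewrite setTI [X in (X * _)%E](_ : _ = 1%E); first by rewrite mul1e.
  exact: probability_setT.
- by move=> A /GP[].
- move=> A mA; exact: (independentC mF (mG _ mA)).
- move=> A mA tA; apply: (independent_bigcup mF) => // n; exact: (mG _ (mA n)).
Qed.

Definition cell_count (cell : nat -> set E) (c : nat) (w : O) : nat :=
  Num.truncn (fine (N w (cell c))).

Lemma cell_countE cell c w : measurable (cell c) ->
  (cell_count cell c w)%:R = fine (N w (cell c)) :> R.
Proof.
move=> mc; rewrite /cell_count.
by have [->|[k ->]] := prm_integer HN w mc; rewrite /= ?truncn0// natrK.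
Qed.

Let counts m : set (\bar R) :=
  if m is m'.+1 then [set m'.+1%:R%:E] else [set 0%E; +oo%E].

Let counts_measurable m : measurable (counts m).
Proof.
case: m => [|m]; last exact: emeasurable_set1.
by apply: measurableU; exact: emeasurable_set1.
Qed.

Lemma cell_count_preimage cell c m : measurable (cell c) ->
  cell_count cell c @^-1` [set m] = (N ^~ (cell c)) @^-1` counts m.
Proof.
move=> mc; apply/seteqP; split=> w /=; rewrite /cell_count.
  have [->|[k ->]] := prm_integer HN w mc.
    by rewrite /= truncn0 => <-; right.
  by rewrite /= natrK => <-; case: k => [|k] //=; left.
by case: m => [|m] /= => [[]|] ->; rewrite ?natrK//= truncn0.
Qed.

Lemma count_law cell c m : measurable (cell c) -> (mu (cell c) < +oo)%E ->
  P (cell_count cell c @^-1` [set m]) =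
  (poisson_mass (fine (mu (cell c))) m)%:E.
Proof.
move=> mc coo; rewrite cell_count_preimage// -(prm_poisson HN mc coo m).
have mk (x : \bar R) : measurable [set w | N w (cell c) = x].
  exact: (count_measurable mc (emeasurable_set1 x)).
case: m => [|m]; last by [].
have n0 := count_finite mc coo.
have -> : N^~ (cell c) @^-1` counts 0 =
    [set w | N w (cell c) = 0%:R%:E] `|` [set w | N w (cell c) = +oo%E].
  by apply/seteqP; split=> w.
rewrite measureU// ?[X in (_ + X)%E]n0 ?adde0//.
by apply/seteqP; split=> w //= -[->].
Qed.

Lemma count_all_moments C : measurable C -> (mu C < +oo)%E ->
  all_moments P (fun w => fine (N w C)).
Proof.
move=> mC Coo; split.
- exact: (measurableT_comp (@fine_measurable _ _ measurableT) (prm_measurable HN mC)).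
- by move=> w; rewrite fine_ge0.
move=> q q1; pose h := fine (mu C).
have h0 : 0 <= h by rewrite fine_ge0.
have [K K0 /(_ h)] := poisson_mass_moment h0 q1.
rewrite h0 lexx => /(_ isT) HK; apply: le_lt_trans (ltry (K * h)).
apply: le_trans HK; pose eta := cell_count (fun=> C) 0.
have meta m : measurable (eta @^-1` [set m]).
  by rewrite /eta cell_count_preimage//; exact: count_measurable.
have -> : (\int[P]_w (fine (N w C) `^ q)%:E =
    \int[P]_w ((eta w)%:R `^ q)%:E)%E.
  by apply: eq_integral => w _; rewrite /eta (@cell_countE (fun=> C)).
have T : setT = \bigcup_m (eta @^-1` [set m]).
  by apply/seteqP; split=> // w _; exists (eta w).
rewrite [in leLHS]T ge0_integral_bigcup//.
- apply: lee_nneseries => [m _ _|m _]; first by apply: integral_ge0 => w _; rewrite lee_fin powR_ge0.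
  rewrite (_ : (\int[P]_(w in _) _)%E =
    \int[P]_(w in eta @^-1` [set m]) (cst (m%:R `^ q)%:E w))%E.
    by rewrite integral_cst// EFinM -(@count_law (fun=> C) 0%N m).
  by apply: eq_integral => w; rewrite inE /= => ->.
- rewrite -T => _ V mV; rewrite setTI.
  have -> : (fun w => ((eta w)%:R `^ q)%:E) @^-1` V =
      \bigcup_(m in [set m | V ((m%:R `^ q)%:E)]) eta @^-1` [set m].
    by apply/seteqP; split=> [w /= Vw|w [m /= Vm ->//]]; exists (eta w).
  by apply: bigcup_measurable => m _; exact: meta.
- by move=> i j _ _ [w [/= <- <-]].
Qed.

Lemma region_increments (Reg cell : nat -> set E) :
  (forall c, measurable (Reg c)) -> (forall c, Reg c `<=` Reg c.+1) ->
  (forall c, measurable (cell c)) -> (forall c, cell c `<=` Reg c.+1) ->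
  (forall c, Reg c `&` cell c = set0) -> (forall c, (mu (cell c) <= 1)%E) ->
  poisson_increments P (fun c => gen_region (Reg c)) (cell_count cell)
    (fun c => fine (mu (cell c))).
Proof.
move=> mR ndR mc cR Rc c1.
have coo c : (mu (cell c) < +oo)%E by exact: (le_lt_trans (c1 c) (ltry _)).
have cfin c : mu (cell c) \is a fin_num by rewrite ge0_fin_numE.
split.
- by move=> c; exact: gen_region_sub.
- by move=> c; exact: gen_region_mono.
- by move=> c; rewrite fine_ge0//= -lee_fin fineK.
- move=> c m; apply: sub_sigma_algebra; exists (cell c), (counts m).
  by split; [split|exact: cell_count_preimage].
- move=> c m A sA; rewrite -count_law// cell_count_preimage//.
  exact: (region_independent (mR c) (mc c) (Rc c) (counts_measurable m) sA).
Qed.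

End region_independence.

(** * Pathwise integrals of step functions *)

Lemma cauchy_rate {R : realType} {X : completeNormedModType R} (u : nat -> X)
    (a : nat -> R) :
  a @ \oo --> (0 : R) -> (forall n m, `|u n - u m| <= a n + a m) ->
  u @ \oo --> lim (u @ \oo) /\ forall n, `|u n - lim (u @ \oo)| <= a n.
Proof.
move=> a0 ua.
have cu : cvg (u @ \oo).
  apply/cauchy_cvgP/cauchyP => e e0.
  have e2 : 0 < e / 2 by lra.
  move/cvgrPdist_lt: (a0) => /(_ _ e2)[N _ HN]; exists (u N).
  exists N => // m /= Nm; rewrite -ball_normE/=.
  have aN k : (N <= k)%N -> a k < e / 2.
    by move=> /HN; rewrite sub0r normrN; exact/le_lt_trans/ler_norm.
  by have := aN _ (leqnn N); have := aN _ Nm; have := ua N m; lra.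
split=> // n; have h : `|u n - u m| @[m --> \oo] --> `|u n - lim (u @ \oo)|.
  by apply: cvg_norm; apply: cvgB => //; exact: cvg_cst.
apply/ler_addgt0Pr => e e0.
apply: (cvgr_to_le h); move/cvgrPdist_lt: (a0) => /(_ _ e0)[N _ HN].
exists N => // m /= /HN; rewrite sub0r normrN => am.
by have := ua n m; have := ler_norm (a m); lra.
Qed.

Section step_functions.
Context {R : realType} {X : completeNormedModType R}.
Context d (E : measurableType d).

Definition step_sum (K : finType) (C : K -> set E) (y : K -> X)
    (rho : set E -> \bar R) (D : set E) : X :=
  \sum_e fine (rho (C e `&` D)) *: y e.

Definition step_fun (K : finType) (C : K -> set E) (y : K -> X) (z : E) : X :=
  \sum_e (\1_(C e) z : R) *: y e.

Lemma step_fun_measurable (K : finType) (C : K -> set E) (y : K -> X) :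
  (forall e, measurable (C e)) -> strongly_measurable measurable (step_fun C y).
Proof.
move=> mC; apply: strongly_measurable_sum => e.
apply: strongly_measurableZ; last exact: strongly_measurable_cst.
exact: measurable_indic.
Qed.

Variable rho : {measure set E -> \bar R}.

Lemma step_sum_norm (K : finType) (C : K -> set E) (y : K -> X) D :
  (forall e, measurable (C e)) -> measurable D ->
  (forall e, (rho (C e `&` D) < +oo)%E) ->
  (`|step_sum C y rho D|%:E <= \int[rho]_(z in D) `|step_fun C y z|%:E)%E.
Proof.
move=> mC mD foo.
pose C' e := C e `&` D.
have mC' e : measurable (C' e) by exact: measurableI.
have CD e : C' e `<=` D by move=> z [].
pose at_ (L : {set K}) := atom D C' L.
have mat L : measurable (at_ L) by exact: atom_measurable.
have atoo (L : {set K}) e : e \in L -> (rho (at_ L) < +oo)%E.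
  move=> eL; apply: le_lt_trans (foo e); apply: le_measure; rewrite ?inE//.
    exact: mC'.
  by move=> z [_ /= /(_ e)[_ /(_ eL)]].
pose Y (L : {set K}) := \sum_(e in L) y e.
have -> : step_sum C y rho D = \sum_L fine (rho (at_ L)) *: Y L.
  rewrite /step_sum; under eq_bigr => e _.
    rewrite -/(C' e) (measure_atom mD mC' CD) -sum_fine => [|L eL]; last first.
      by rewrite ge0_fin_numE//; exact: (atoo L e).
    rewrite scaler_suml; over.
  rewrite (exchange_big_dep xpredT)//=; apply: eq_bigr => L _.
  by rewrite -scaler_sumr.
apply: (@le_trans _ _ (\sum_L (fine (rho (at_ L)) * `|Y L|)%:E)%E).
  rewrite sumEFin lee_fin; apply: le_trans (ler_norm_sum _ _ _) _.
  by apply: ler_sum => L _; rewrite normrZ ger0_norm// fine_ge0.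
have UD : \big[setU/set0]_(L <- index_enum {set K}) at_ L = D.
  rewrite -bigcup_seq; apply/seteqP; split=> [z [L _ []]//|z Dz].
  exists (finset (fun e => `[< C' e z >])); first by rewrite /= mem_index_enum.
  by split=> // e; rewrite inE; split=> /asboolP.
have YE L z : at_ L z -> step_fun C y z = Y L.
  move=> [Dz zL]; rewrite /Y big_mkcond; apply: eq_bigr => e _; rewrite indicE.
  have -> : (z \in C e) = (e \in L).
    apply/idP/idP => [/set_mem Cz|/(zL e).2 [Cz _]]; last exact/mem_set.
    exact/(zL e).1.
  by case: ifP => _; rewrite ?scale1r// scale0r.
rewrite -[X in (_ <= \int[_]_(z in X) _)%E]UD ge0_integral_bigsetU//=.
- apply: lee_sum => L _.
  rewrite (_ : (\int[rho]_(z in at_ L) _)%E =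
    \int[rho]_(z in at_ L) (cst `|Y L|%:E z))%E; last first.
    by apply: eq_integral => z /set_mem /YE ->.
  rewrite integral_cst//.
  have [->|/set0Pn[e eL]] := eqVneq L finset.set0.
    by rewrite /Y big_set0 normr0 mulr0 mul0e.
  by rewrite EFinM fineK 1?muleC// ge0_fin_numE//; exact: (atoo L e).
- exact: index_enum_uniq.
- exact: sub_trivIset (@atom_trivIset _ _ _ _ _).
- apply: measurable_funTS; apply/measurable_EFinP; apply: strongly_measurable_norm.
  exact: step_fun_measurable.
Qed.

Lemma step_sum_norm2 (K K' : finType) (C : K -> set E) (y : K -> X)
    (C' : K' -> set E) (y' : K' -> X) D :
  (forall e, measurable (C e)) -> (forall e, measurable (C' e)) ->
  measurable D ->
  (forall e, (rho (C e `&` D) < +oo)%E) ->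
  (forall e, (rho (C' e `&` D) < +oo)%E) ->
  (`|step_sum C y rho D - step_sum C' y' rho D|%:E <=
    \int[rho]_(z in D) `|step_fun C y z - step_fun C' y' z|%:E)%E.
Proof.
move=> mC mC' mD Coo C'oo.
pose C2 (e : K + K') := match e with inl e => C e | inr e => C' e end.
pose y2 (e : K + K') := match e with inl e => y e | inr e => - y' e end.
have := @step_sum_norm _ C2 y2 D _ mD _.
have -> : step_sum C2 y2 rho D = step_sum C y rho D - step_sum C' y' rho D.
  rewrite /step_sum big_sumType/=; congr (_ + _); rewrite -sumrN.
  by apply: eq_bigr => e _; rewrite scalerN.
under eq_integral => z _.
  rewrite (_ : step_fun C2 y2 z = step_fun C y z - step_fun C' y' z).
    over.
  rewrite /step_fun big_sumType/=; congr (_ + _); rewrite -sumrN.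
  by apply: eq_bigr => e _; rewrite scalerN.
by apply; case.
Qed.

Lemma step_sumD (K : finType) (C : K -> set E) (y : K -> X) G D D' :
  (forall e, measurable (C e)) -> measurable G -> (forall e, C e `<=` G) ->
  (rho G < +oo)%E -> measurable D -> measurable D' -> D' `<=` D ->
  step_sum C y rho D - step_sum C y rho D' = step_sum C y rho (D `\` D').
Proof.
move=> mC mG CG Goo mD mD' D'D; rewrite /step_sum -sumrB; apply: eq_bigr => e _.
have fin A : measurable A -> rho (C e `&` A) \is a fin_num.
  move=> mA; rewrite ge0_fin_numE//; apply: le_lt_trans Goo.
  apply: le_measure; rewrite ?inE//; first exact: measurableI.
  by move=> z [/CG].
have mDD : measurable (D `\` D') by exact: measurableD.
rewrite -scalerBl; congr (_ *: _).
have -> : C e `&` D = (C e `&` D') `|` (C e `&` (D `\` D')).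
  by rewrite -setIUr setDUK.
rewrite measureU//; first by rewrite fineD ?fin// addrAC subrr add0r.
- exact: measurableI.
- exact: measurableI.
- by apply/seteqP; split=> z //= [[_ D'z] [_ [_]]].
Qed.

Lemma step_sum_bound (K : finType) (C : K -> set E) (y : K -> X) G D b :
  (forall e, measurable (C e)) -> measurable G -> (forall e, C e `<=` G) ->
  (rho G < +oo)%E -> measurable D -> (forall z, `|step_fun C y z| <= b) ->
  `|step_sum C y rho D| <= b * fine (rho (G `&` D)).
Proof.
move=> mC mG CG Goo mD fb.
have mGD : measurable (G `&` D) by exact: measurableI.
have fin A : measurable A -> rho (G `&` A) \is a fin_num.
  move=> mA; rewrite ge0_fin_numE//; apply: le_lt_trans Goo.
  by apply: le_measure; rewrite ?inE//; exact: measurableI.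
have -> : step_sum C y rho D = step_sum C y rho (G `&` D).
  apply: eq_bigr => e _; congr (fine (rho _) *: _).
  by rewrite setIA (setIidl (CG e)).
rewrite -lee_fin EFinM fineK ?fin//.
apply: (le_trans (@step_sum_norm _ C y _ mC mGD _)).
  move=> e; apply: le_lt_trans Goo; apply: le_measure; rewrite ?inE//.
    exact: measurableI.
  by move=> z [/CG].
rewrite -integral_cst//; apply: ge0_le_integral => //.
- apply: measurable_funTS; apply/measurable_EFinP; apply: strongly_measurable_norm.
  exact: step_fun_measurable.
- by move=> z _; rewrite lee_fin.
Qed.

(* The rate of convergence [a] is uniform in the domain of integration. *)
Lemma step_sum_cauchy (K : nat -> finType) (C : forall n, K n -> set E)
    (y : forall n, K n -> X) (f : E -> X) G b :
  (forall n e, measurable (C n e)) -> measurable G ->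
  (forall n e, C n e `<=` G) -> (rho G < +oo)%E ->
  (forall n z, `|step_fun (C n) (y n) z| <= b) ->
  (forall z, step_fun (C n) (y n) z @[n --> \oo] --> f z) ->
  exists a : nat -> R, a @ \oo --> (0 : R) /\ forall D, measurable D ->
    forall n m, `|step_sum (C n) (y n) rho D - step_sum (C m) (y m) rho D|
      <= a n + a m.
Proof.
move=> mC mG CG Goo fb fc.
pose fn n := step_fun (C n) (y n).
have sfn n : strongly_measurable measurable (fn n) by exact: step_fun_measurable.
have sf : strongly_measurable measurable f by exact: (strongly_measurable_lim sfn fc).
have mnf n : measurable_fun setT (fun z => `|fn n z - f z|).
  by apply: strongly_measurable_norm; exact: strongly_measurableB.
have fb' z : `|f z| <= b.
  by apply: cvgr_to_le (cvg_norm (fc z)) _; apply: nearW.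
pose B := `|b| + `|b|; have B0 : 0 <= B by rewrite addr_ge0.
pose a n := fine (\int[rho]_(z in G) `|fn n z - f z|%:E)%E.
have fnb n z : `|fn n z - f z| <= B.
  apply: (le_trans (ler_normB _ _)); apply: lerD.
    by rewrite (le_trans (fb _ _))// ler_norm.
  by rewrite (le_trans (fb' _))// ler_norm.
have ib : rho.-integrable G (cst (B)%:E).
  apply/integrableP; split; first exact: measurable_cst.
  rewrite integral_cst//; apply: lte_mul_pinfty => //.
have cG z : (`|fn n z - f z|%:E @[n --> \oo] --> 0%E)%E.
  apply: cvg_EFin; first exact: nearW.
  have h : (fn n z - f z) @[n --> \oo] --> (0 : X).
    by rewrite -(subrr (f z)); apply: cvgB; [exact: fc|exact: cvg_cst].
  by rewrite -(@normr0 _ X); exact: (cvg_norm h).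
have mEf A n : measurable_fun A (fun z => `|fn n z - f z|%:E).
  by apply: measurable_funTS; exact/measurable_EFinP.
have aec : {ae rho, forall z, G z -> `|fn n z - f z|%:E @[n --> \oo] --> 0%E}.
  by apply: aeW => z _; exact: cG.
have aeb : {ae rho, forall z n, G z -> (`| `|fn n z - f z|%:E | <= (B)%:E)%E}.
  by apply: aeW => z n _; rewrite lee_fin normr_id fnb.
have [_ _] := dominated_convergence mG (mEf G) (measurable_cst _) aec ib aeb.
rewrite /= integral_cst// mul0e => cI.
have af n : (a n)%:E = (\int[rho]_(z in G) `|fn n z - f z|%:E)%E.
  rewrite fineK// ge0_fin_numE; last by apply: integral_ge0.
  apply: le_lt_trans (_ : \int[rho]_(z in G) (cst (B)%:E z) < +oo)%E.
    apply: ge0_le_integral => //.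
    by move=> z _; rewrite lee_fin.
  rewrite integral_cst//; apply: lte_mul_pinfty => //.
exists a; split.
  by apply: fine_cvg; apply: cvg_trans cI; apply: near_eq_cvg; apply: nearW.
move=> D mD n m; have mGD : measurable (G `&` D) by exact: measurableI.
have fin k e : (rho (C k e `&` (G `&` D)) < +oo)%E.
  apply: le_lt_trans Goo; apply: le_measure; rewrite ?inE//.
    exact: measurableI.
  by move=> z [/CG].
have E1 k : step_sum (C k) (y k) rho D = step_sum (C k) (y k) rho (G `&` D).
  apply: eq_bigr => e _; congr (fine (rho _) *: _).
  by rewrite setIA (setIidl (CG k e)).
have mEfD A n1 : measurable_fun A (fun z => `|fn n1 z - f z|%:E) by exact: mEf.
rewrite !E1 -lee_fin EFinD !af.
apply: (@le_trans _ _
  (\int[rho]_(z in G) (`|fn n z - f z|%:E + `|fn m z - f z|%:E))%E);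
  last by rewrite ge0_integralD.
apply: (le_trans (@step_sum_norm2 _ _ _ (y n) _ (y m) _ (mC n) (mC m) mGD
  (fin n) (fin m))).
apply: (@le_trans _ _
  (\int[rho]_(z in G `&` D) (`|fn n z - f z|%:E + `|fn m z - f z|%:E))%E).
  apply: ge0_le_integral => //.
  - apply: measurable_funTS; apply/measurable_EFinP.
    exact: (strongly_measurable_norm (strongly_measurableB (sfn n) (sfn m))).
  - exact: emeasurable_funD.
  - move=> z _; rewrite -EFinD lee_fin.
    have -> : step_fun (C n) (y n) z - step_fun (C m) (y m) z =
        (fn n z - f z) - (fn m z - f z) by rewrite opprB addrA subrK.
    exact: ler_normB.
apply: ge0_subset_integral => //; first exact: emeasurable_funD.
by move=> z _; rewrite -EFinD lee_fin addr_ge0.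
Qed.

End step_functions.

(** * Grids and left-endpoint approximations *)

Section grids.
Context {R : realType}.
Implicit Types (t : nat -> R) (L : nat).

Lemma grid_le t L : (forall i, (i < L)%N -> t i < t i.+1) ->
  forall i j, (i <= j <= L)%N -> t i <= t j.
Proof.
move=> tlt i; elim=> [|j IH]; first by rewrite leqn0 => /andP[/eqP->].
rewrite leq_eqVlt => /andP[/predU1P[-> //|ij jL]].
by rewrite (le_trans (IH _))// ?(ltW (tlt _ jL))// -ltnS ij ltnW.
Qed.

Lemma grid_uniq t L u i j : (forall i, (i < L)%N -> t i < t i.+1) ->
  (i < L)%N -> (j < L)%N -> t i < u <= t i.+1 -> t j < u <= t j.+1 -> i = j.
Proof.
move=> tlt; wlog ij : i j / (i <= j)%N.
  move=> W iL jL iu ju; case/orP: (leq_total i j) => ?; first exact: W.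
  by apply/esym; apply: W.
move=> iL jL /andP[_ ui] /andP[uj _]; apply/eqP; rewrite eqn_leq ij leqNgt.
apply/negP => ij'; have := grid_le tlt (_ : (i.+1 <= j <= L)%N).
by rewrite ij' (ltnW jL) => /(_ isT); lra.
Qed.

Lemma grid_find t L u : t 0%N < u <= t L ->
  exists2 i, (i < L)%N & t i < u <= t i.+1.
Proof.
elim: L => [|L IH] /andP[u0 uL]; first by move: u0; rewrite ltNge uL.
have [uL'|uL'] := leP u (t L).
  by have [|i iL iu] := IH; rewrite ?u0//; exists i => //; exact: ltnW.
by exists L => //; rewrite uL' uL.
Qed.

Definition refine t n a : R :=
  t (a %/ 2 ^ n)%N +
  (t (a %/ 2 ^ n).+1%N - t (a %/ 2 ^ n)%N) * ((a %% 2 ^ n)%:R / (2 ^ n)%:R).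

Lemma refine_coarse t n i : refine t n (i * 2 ^ n) = t i.
Proof. by rewrite /refine mulnK ?expn_gt0// modnMl mul0r mulr0 addr0. Qed.

Lemma refineS t n a : refine t n a.+1 = t (a %/ 2 ^ n)%N +
  (t (a %/ 2 ^ n).+1%N - t (a %/ 2 ^ n)%N) * ((a %% 2 ^ n).+1%:R / (2 ^ n)%:R).
Proof.
have d0 : (0 < 2 ^ n)%N by rewrite expn_gt0.
rewrite /refine; set q := (a %/ _)%N; set r := (a %% _)%N.
have rd : (r < 2 ^ n)%N by rewrite ltn_mod.
have -> : (a.+1 = q * 2 ^ n + r.+1)%N by rewrite addnS -divn_eq.
rewrite divnMDl// modnMDl.
have [rd'|] := ltnP r.+1 (2 ^ n); first by rewrite divn_small// addn0 modn_small.
move=> rd'; have -> : r.+1 = (2 ^ n)%N by apply/eqP; rewrite eqn_leq rd rd'.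
rewrite divnn modnn d0 addn1 mul0r mulr0 addr0 divff ?pnatr_eq0 -?lt0n//; ring.
Qed.

Lemma refine_step t n a : refine t n a.+1 - refine t n a =
  (t (a %/ 2 ^ n).+1%N - t (a %/ 2 ^ n)%N) / (2 ^ n)%:R.
Proof. by rewrite refineS /refine -natr1; ring. Qed.

Variables (t : nat -> R) (L : nat).
Hypothesis tlt : forall i, (i < L)%N -> t i < t i.+1.

Lemma coarse_lt n a : (a < L * 2 ^ n)%N -> (a %/ 2 ^ n < L)%N.
Proof. by rewrite ltn_divLR ?expn_gt0. Qed.

Lemma refine_lt n a : (a < L * 2 ^ n)%N -> refine t n a < refine t n a.+1.
Proof.
move=> /coarse_lt/tlt h; rewrite -subr_gt0 refine_step.
by rewrite divr_gt0 ?subr_gt0// ltr0n expn_gt0.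
Qed.

Lemma refine_ge n a : (a < L * 2 ^ n)%N -> t (a %/ 2 ^ n)%N <= refine t n a.
Proof.
move=> /coarse_lt/tlt h; rewrite /refine lerDl mulr_ge0// subr_ge0; exact: ltW.
Qed.

Lemma refine_le n a : (a < L * 2 ^ n)%N ->
  refine t n a.+1 <= t (a %/ 2 ^ n).+1%N.
Proof.
move=> aL; have /tlt h := coarse_lt aL.
rewrite refineS -lerBrDl -[leRHS]mulr1; apply: ler_wpM2l.
  by rewrite subr_ge0; exact: ltW.
by rewrite ler_pdivrMr ?ltr0n ?expn_gt0// mul1r ler_nat ltn_mod expn_gt0.
Qed.

Lemma refine_mesh n a : (a < L * 2 ^ n)%N ->
  refine t n a.+1 - refine t n a <= (t L - t 0%N) / (2 ^ n)%:R.
Proof.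
move=> aL; rewrite refine_step ler_pM2r ?invr_gt0 ?ltr0n ?expn_gt0//.
have qL := coarse_lt aL.
have := grid_le tlt (_ : (0 <= a %/ 2 ^ n <= L)%N).
have := grid_le tlt (_ : ((a %/ 2 ^ n).+1 <= L <= L)%N).
by rewrite qL leqnn (ltnW qL) => /(_ isT) ? /(_ isT); lra.
Qed.

End grids.

Section step_processes.
Context {R : realType} {X : completeNormedModType R}.
Context dO (O : measurableType dO) (P : probability O R).
Context dJ (J : measurableType dJ)
  (nu : {sigma_finite_measure set J -> \bar R}).
Local Notation RJ := (measurableTypeR R * J)%type.
Context (N : O -> {measure set RJ -> \bar R}).
Implicit Type psi : @step_process R X dO O dJ J.

Definition sp_index psi : finType :=
  ('I_(sp_l psi) * ('I_(sp_m psi) * 'I_(sp_n psi)))%type.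

Definition sp_cell psi (e : sp_index psi) : set RJ :=
  `]sp_t psi e.1, sp_t psi e.1.+1]%classic `*` sp_A (s := psi) e.2.1.

Definition sp_coef psi w (e : sp_index psi) : X :=
  sp_F (s := psi) e.1 e.2.1 e.2.2 w *: sp_x (s := psi) e.1 e.2.1 e.2.2.

Definition region_integral psi (D : set RJ) w : X :=
  step_sum (@sp_cell psi) (@sp_coef psi w) (N w) D -
  step_sum (@sp_cell psi) (@sp_coef psi w) (intensity nu) D.

Lemma sp_sum psi (V : nmodType)
    (f : 'I_(sp_l psi) -> 'I_(sp_m psi) -> 'I_(sp_n psi) -> V) :
  \sum_i \sum_j \sum_k f i j k = \sum_(e : sp_index psi) f e.1 e.2.1 e.2.2.
Proof.
under eq_bigr do rewrite pair_bigA.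
by rewrite pair_bigA.
Qed.

Lemma indicX (A : set (measurableTypeR R)) (B : set J) (z : RJ) :
  \1_(A `*` B) z = \1_A z.1 * \1_B z.2 :> R.
Proof.
rewrite !indicE -natrM mulnb; congr (nat_of_bool _)%:R.
by apply/idP/andP => [/set_mem[? ?]|[/set_mem ? /set_mem ?]];
  [split; exact/mem_set|exact/mem_set].
Qed.

Lemma sp_funE psi w z : sp_fun psi w z = step_fun (@sp_cell psi) (@sp_coef psi w) z.
Proof.
rewrite /sp_fun sp_sum; apply: eq_bigr => e _.
by rewrite /sp_coef /sp_cell indicX scalerA; congr (_ *: _); ring.
Qed.

Hypothesis HN : poisson_random_measure P (intensity nu) N.
Variables (phi : @step_process R X dO O dJ J).
Hypothesis Hphi : simple_adapted P nu N phi.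

Lemma sp_t_le i j : (i <= j <= sp_l phi)%N -> sp_t phi i <= sp_t phi j.
Proof. exact: (grid_le (sa_lt Hphi)). Qed.

Lemma sp_t_ge0 i : (i <= sp_l phi)%N -> 0 <= sp_t phi i.
Proof. by move=> il; rewrite -(sa_t0 Hphi) sp_t_le. Qed.

Lemma sp_cell_measurable e : measurable (@sp_cell phi e).
Proof.
apply: measurableX; first exact: measurable_itv.
exact: (sa_measurable Hphi).
Qed.

Lemma sp_integralE t B w :
  sp_integral nu N phi t B w = region_integral phi (`]0, t]%classic `*` B) w.
Proof.
rewrite /sp_integral sp_sum /region_integral /step_sum -sumrB.
apply: eq_bigr => e _.
have -> : `]Num.min (sp_t phi e.1) t, Num.min (sp_t phi e.1.+1) t]%classic `*`
    (sp_A (s := phi) e.2.1 `&` B) = @sp_cell phi e `&` (`]0, t]%classic `*` B).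
  have t0 : 0 <= sp_t phi e.1 by apply: sp_t_ge0; exact: ltnW.
  apply/seteqP; split=> -[x j]; rewrite /sp_cell /= !in_itv/=.
    rewrite gt_min le_min => -[/andP[xl /andP[xr xt]] [Aj Bj]].
    have : sp_t phi e.1 < x by case/orP: xl => // ?; lra.
    by move=> h; rewrite h xr xt (le_lt_trans t0 h).
  move=> [[/andP[xl xr] Aj] [/andP[x0 xt] Bj]].
  by rewrite gt_min le_min xl xr xt.
by rewrite /compensated -scalerBl scalerA mulrC.
Qed.

End step_processes.

Lemma cvg_bigsum {R : realType} {V : normedModType R} (I : Type) (r : seq I)
    (f : nat -> I -> V) (a : I -> V) :
  (forall i, f n i @[n --> \oo] --> a i) ->
  \sum_(i <- r) f n i @[n --> \oo] --> \sum_(i <- r) a i.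
Proof.
move=> fa; elim: r => [|i r IH].
  by rewrite big_nil; under eq_fun do rewrite big_nil; exact: cvg_cst.
by rewrite big_cons; under eq_fun do rewrite big_cons; exact: cvgD.
Qed.

Lemma natural_filtration_mono {R : realType} dO (O : measurableType dO)
    dJ (J : measurableType dJ)
    (N : O -> {measure set (measurableTypeR R * J)%type -> \bar R}) (t u : R) :
  t <= u -> natural_filtration N t `<=` natural_filtration N u.
Proof.
move=> tu; apply: smallest_sub; first exact: smallest_sigma_algebra.
move=> _ [a [b [A [V [[a0 ab bt mA mV] ->]]]]]; apply: sub_sigma_algebra.
by exists a, b, A, V; split=> //; split=> //; exact: le_trans tu.
Qed.

Section step_values.
Context {R : realType} {X : completeNormedModType R}.
Context dO (O : measurableType dO) dJ (J : measurableType dJ).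
Implicit Types psi : @step_process R X dO O dJ J.

Lemma sp_fun_at psi w z (i : 'I_(sp_l psi)) :
  (forall i, (i < sp_l psi)%N -> sp_t psi i < sp_t psi i.+1) ->
  sp_t psi i < z.1 <= sp_t psi i.+1 ->
  sp_fun psi w z =
  \sum_j \sum_k (sp_F i j k w * \1_(sp_A j) z.2) *: sp_x (s := psi) i j k.
Proof.
move=> tlt iz; rewrite /sp_fun (bigD1 i)//= [X in _ + X]big1 ?addr0.
  apply: eq_bigr => j _; apply: eq_bigr => k _; congr ((_ * _) *: _).
  by rewrite indicE mem_set ?mulr1//= in_itv.
move=> i' ii'; apply: big1 => j _; apply: big1 => k _.
rewrite [\1_(`]_, _]) _]indicE memNset ?mulr0 ?mul0r ?scale0r//= in_itv/= => i'z.
move/eqP: ii'; apply; apply: val_inj.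
exact: (grid_uniq tlt (ltn_ord i') (ltn_ord i) i'z iz).
Qed.

Lemma sp_fun_out psi w z :
  (forall i, (i < sp_l psi)%N -> sp_t psi i < sp_t psi i.+1) ->
  ~~ (sp_t psi 0 < z.1 <= sp_t psi (sp_l psi)) -> sp_fun psi w z = 0.
Proof.
move=> tlt /negP zout; apply: big1 => i _; apply: big1 => j _; apply: big1 => k _.
rewrite [\1_(`]_, _]) _]indicE memNset ?mulr0 ?mul0r ?scale0r//= in_itv/= => /andP[iz zi].
apply: zout; apply/andP; split.
  by apply: le_lt_trans iz; apply: (grid_le tlt); rewrite leq0n/= ltnW.
by apply: (le_trans zi); apply: (grid_le tlt); rewrite leqnn ltn_ord.
Qed.

End step_values.

Section discretization.
Context {R : realType} {X Y : completeNormedModType R}.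
Context dO (O : measurableType dO) (P : probability O R).
Context dJ (J : measurableType dJ)
  (nu : {sigma_finite_measure set J -> \bar R}).
Local Notation RJ := (measurableTypeR R * J)%type.
Context (N : O -> {measure set RJ -> \bar R}).
Variables (phi : @step_process R X dO O dJ J).
Hypothesis Hphi : simple_adapted P nu N phi.
Local Notation l := (sp_l phi).
Local Notation t := (sp_t phi).

Definition sp_map (g : X -> Y) : @step_process R Y dO O dJ J :=
  @StepProcess R Y dO O dJ J (sp_l phi) (sp_m phi) (sp_n phi) (sp_t phi)
    (@sp_F _ _ _ _ _ _ phi) (@sp_A _ _ _ _ _ _ phi)
    (fun i j k => g (sp_x i j k)).

Definition coarse n (a : 'I_(sp_l phi * 2 ^ n)) : 'I_(sp_l phi) :=
  Ordinal (coarse_lt (ltn_ord a)).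

(* Left-endpoint approximation of [(w, u, j) |-> T u (phi w u j)] along the
   n-th refinement of the grid of [phi]. *)
Definition disc (T : R -> X -> Y) n : @step_process R Y dO O dJ J :=
  @StepProcess R Y dO O dJ J (sp_l phi * 2 ^ n) (sp_m phi) (sp_n phi)
    (refine (sp_t phi) n)
    (fun a => sp_F (coarse a)) (@sp_A _ _ _ _ _ _ phi)
    (fun a j k => T (refine (sp_t phi) n a) (sp_x (coarse a) j k)).

Let tlt i : (i < l)%N -> t i < t i.+1. Proof. exact: (sa_lt Hphi). Qed.

Lemma disc_adapted T n : simple_adapted P nu N (disc T n).
Proof.
split => /=.
- by rewrite -[RHS](sa_t0 Hphi) -[in RHS](refine_coarse t n 0) mul0n.
- exact: (refine_lt tlt).
- move=> a j k V mV; apply: natural_filtration_mono (sa_adapted Hphi _ _ mV).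
  exact: (refine_ge tlt).
- by move=> a j k; exact: (sa_bounded Hphi).
- exact: (sa_measurable Hphi).
- exact: (sa_finite Hphi).
- exact: (sa_disjoint Hphi).
Qed.

Variable T : R -> X -> Y.

Lemma disc_fun n z : exists v, [/\ v < z.1,
  z.1 - (t l + 1) / (2 ^ n)%:R <= v &
  forall w, sp_fun (disc T n) w z = sp_fun (sp_map (T v)) w z].
Proof.
have tl0 : 0 <= t l by apply: (sp_t_ge0 Hphi).
have d0 : 0 < (2 ^ n)%:R :> R by rewrite ltr0n expn_gt0.
have dlt := sa_lt (disc_adapted T n).
have E0 : sp_t (disc T n) 0 = t 0%N.
  by rewrite /= -[in RHS](refine_coarse t n 0) mul0n.
have El : sp_t (disc T n) (sp_l (disc T n)) = t l by rewrite /= refine_coarse.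
have [zin|zout] := boolP (t 0%N < z.1 <= t l); last first.
  exists (z.1 - (t l + 1) / (2 ^ n)%:R); split=> //.
    by rewrite ltrBlDr ltrDl divr_gt0//; lra.
  move=> w; rewrite !sp_fun_out//.
  by rewrite E0 El.
have [|a aL az] := @grid_find R (sp_t (disc T n)) (sp_l (disc T n)) z.1.
  by rewrite E0 El.
exists (refine t n a); have /andP[az1 az2] := az; split=> //.
  rewrite lerBlDr -lerBlDl; apply: (@le_trans _ _ (t l / (2 ^ n)%:R)).
    have := refine_mesh tlt aL; rewrite (sa_t0 Hphi) subr0 /=.
    by move: az1 az2 => /=; lra.
  by rewrite ler_pM2r ?invr_gt0// lerDl.
move=> w; rewrite (@sp_fun_at _ _ _ _ _ _ (disc T n) w z (Ordinal aL))//.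
rewrite (@sp_fun_at _ _ _ _ _ _ (sp_map _) w z (coarse (Ordinal aL)))//=.
apply/andP; split.
  by apply: le_lt_trans az1; exact: (refine_ge tlt).
by apply: (le_trans az2); exact: (refine_le tlt).
Qed.

Definition coef_bound w : R :=
  \sum_(e : sp_index phi)
    `|sp_F e.1 e.2.1 e.2.2 w| * `|sp_x (s := phi) e.1 e.2.1 e.2.2|.

Lemma coef_bound_ge0 w : 0 <= coef_bound w.
Proof. by apply: sumr_ge0 => e _; rewrite mulr_ge0. Qed.

Variable M : R.
Hypothesis TM : forall u x, `|T u x| <= M * `|x|.

Lemma disc_fun_bound n w z : `|sp_fun (disc T n) w z| <= M * coef_bound w.
Proof.
have [v [_ _ ->]] := disc_fun n z; rewrite /sp_fun sp_sum /coef_bound mulr_sumr.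
apply: le_trans (ler_norm_sum _ _ _) _; apply: ler_sum => e _ /=.
rewrite normrZ !normrM mulrCA -!mulrA; apply: ler_wpM2l => //.
have i1 (A : Type) (D : set A) x : `|\1_D x : R| <= 1.
  by rewrite indicE; case: (_ \in _); rewrite ?normr1 ?normr0.
rewrite mulrA -[leRHS]mul1r; apply: ler_pM => //.
by rewrite -[leRHS]mul1r; apply: ler_pM.
Qed.

Hypothesis TL : forall u x, 0 < u -> T v x @[v --> u^'-] --> T u x.

Lemma disc_fun_cvg w z :
  sp_fun (disc T n) w z @[n --> \oo] --> sp_fun (sp_map (T z.1)) w z.
Proof.
have [z0|z0] := leP z.1 0.
  rewrite [X in _ --> X]sp_fun_out//=; last by rewrite (sa_t0 Hphi) ltNge z0.
  apply: cvg_near_cst; apply: nearW => n; apply/eqP; rewrite sp_fun_out//.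
    exact: (sa_lt (disc_adapted T n)).
  by rewrite (sa_t0 (disc_adapted T n)) ltNge z0.
have /choice[v vP] := disc_fun ^~ z.
have vz : v @ \oo --> z.1.
  have h2 : z.1 - (t l + 1) / (2 ^ n)%:R @[n --> \oo] --> z.1.
    rewrite -[X in _ --> X]subr0; apply: cvgB; first exact: cvg_cst.
    rewrite -[X in _ --> X](mulr0 (t l + 1)); apply: cvgM; first exact: cvg_cst.
    under eq_fun do rewrite natrX -exprVn.
    by apply: cvg_expr; rewrite ger0_norm; lra.
  apply: (squeeze_cvgr _ h2 (cvg_cst z.1)); apply: nearW => n.
  by have [vz1 -> _] := vP n; rewrite ltW.
have Tv x : T (v n) x @[n --> \oo] --> T z.1 x.
  apply: (cvg_comp _ _ _ (@TL z.1 x z0)) => A hA.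
  have {}hA : nbhs z.1 (fun u => u < z.1 -> A u) := hA.
  have [k _ hk] := vz _ hA; exists k => // n kn.
  by apply: (hk n kn); have [] := vP n.
rewrite (_ : (fun n => _) = fun n => sp_fun (sp_map (T (v n))) w z); last first.
  by apply/funext => n; have [_ _ ->] := vP n.
pose c i j k := sp_F (s := phi) i j k w *
  \1_(`]t i, t i.+1]%classic) z.1 * \1_(sp_A (s := phi) j) z.2 : R.
have E g : sp_fun (sp_map g) w z = \sum_i \sum_j \sum_k c i j k *: g (sp_x i j k).
  by [].
under eq_fun do rewrite E.
rewrite E; apply: cvg_bigsum => i; apply: cvg_bigsum => j; apply: cvg_bigsum => k.
have h := @cvgZl_tmp _ _ _ _ _ (c i j k) _ _ (Tv (sp_x i j k)).
exact: h.
Qed.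

End discretization.

Lemma all_moments_ae_bounded {R : realType} d (O : measurableType d)
    (P : probability O R) (f : O -> R) (M : R) :
  measurable_fun setT f -> (forall w, 0 <= f w) -> {ae P, forall w, f w <= M} ->
  all_moments P f.
Proof.
move=> mf f0 fM; split=> // q q1; have q0 : 0 <= q by lra.
apply: (@le_lt_trans _ _ (\int[P]_w (cst (`|M| `^ q)%:E w))%E); last first.
  rewrite integral_cst//; apply: lte_mul_pinfty => //.
  by rewrite -ge0_fin_numE// fin_num_measure.
have g0 (g : O -> R) w : setT w -> (0 <= (g w `^ q)%:E)%E.
  by move=> _; rewrite lee_fin powR_ge0.
apply: (ae_ge0_le_integral measurableT (g0 f) _ (fun w _ => g0 (fun=> `|M|) w Logic.I)
  (measurable_cst _)).
  by apply/measurable_EFinP; exact: measurable_powR_fun.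
apply: filterS fM => w fw _; rewrite lee_fin; apply: le_powR => //.
by rewrite (le_trans fw)// ler_norm.
Qed.

Section limit_of_discretizations.
Context {R : realType} {X Y : completeNormedModType R}.
Context dO (O : measurableType dO) (P : probability O R).
Context dJ (J : measurableType dJ)
  (nu : {sigma_finite_measure set J -> \bar R}).
Local Notation RJ := (measurableTypeR R * J)%type.
Context (N : O -> {measure set RJ -> \bar R}).
Hypothesis HN : poisson_random_measure P (intensity nu) N.
Variables (phi : @step_process R X dO O dJ J).
Hypothesis Hphi : simple_adapted P nu N phi.
Local Notation mu := (intensity nu).

Definition sp_domain : set RJ :=
  `]0, sp_t phi (sp_l phi)]%classic `*` \bigcup_j sp_A (s := phi) j.

Lemma sp_marks_measurable : measurable (\bigcup_j sp_A (s := phi) j).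
Proof.
by apply: fin_bigcup_measurable => // j _; exact: (sa_measurable Hphi).
Qed.

Lemma sp_domain_measurable : measurable sp_domain.
Proof.
apply: measurableX; [exact: measurable_itv|exact: sp_marks_measurable].
Qed.

Lemma sp_marks_finite : (nu (\bigcup_j sp_A (s := phi) j) < +oo)%E.
Proof.
have fT : finite_set [set: 'I_(sp_m phi)] by exact: finite_finset.
rewrite (measure_fin_bigcup nu fT); last 2 first.
- exact: (sa_disjoint Hphi).
- by move=> j _; exact: (sa_measurable Hphi).
rewrite (fsbig_finite _ _ fT); apply/lte_sum_pinfty => j _.
exact: (sa_finite Hphi).
Qed.

Lemma intensityX (a b : R) (A : set J) : 0 <= a -> a <= b -> measurable A ->
  mu (`]a, b]%classic `*` A) = ((b - a)%:E * nu A)%E.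
Proof.
move=> a0 ab mA; rewrite /intensity product_measure1E//=.
congr (_ * _)%E; rewrite /dt /mrestr.
rewrite (setIidl _); last first.
  by move=> x /=; rewrite /Rplus/= !in_itv/= andbT => /andP[ax _]; lra.
rewrite lebesgue_measure_itv/= lte_fin -EFinB.
by case: ltP => // ba; rewrite (_ : b = a) ?subrr//; lra.
Qed.

Lemma sp_domain_finite : (mu sp_domain < +oo)%E.
Proof.
rewrite intensityX//.
- by apply: lte_mul_pinfty => //; [rewrite lee_fin subr0; exact: (sp_t_ge0 Hphi)|exact: sp_marks_finite].
- exact: (sp_t_ge0 Hphi).
- exact: sp_marks_measurable.
Qed.

Lemma natural_filtration_sub t : natural_filtration N t `<=` measurable.
Proof.
apply: smallest_sub; first exact: sigma_algebra_measurable.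
move=> _ [s [u [A [V [[_ _ _ mA mV] ->]]]]]; apply: (count_measurable HN) => //.
by apply: measurableX => //; exact: measurable_itv.
Qed.

Lemma sp_F_measurable i j k : measurable_fun setT (sp_F (s := phi) i j k).
Proof.
by move=> _ V mV; rewrite setTI; exact: natural_filtration_sub (sa_adapted Hphi _ _ mV).
Qed.

Lemma coef_bound_all_moments : all_moments P (coef_bound phi).
Proof.
apply: all_moments_sum => e.
have [M HM] := sa_bounded Hphi e.1 e.2.1 e.2.2.
apply: all_momentsM; last exact: all_moments_cst.
apply: (@all_moments_ae_bounded _ _ _ _ _ M) => //.
by apply: measurableT_comp => //; exact: sp_F_measurable.
Qed.

Lemma region_integral_measurable (psi : @step_process R Y dO O dJ J) D :
  simple_adapted P nu N psi -> measurable D ->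
  strongly_measurable measurable (region_integral nu N psi D).
Proof.
move=> Hpsi mD.
have mF e : measurable_fun setT (sp_F (s := psi) e.1 e.2.1 e.2.2).
  move=> _ V mV; rewrite setTI.
  exact: natural_filtration_sub (sa_adapted Hpsi _ _ mV).
have mc e : measurable (@sp_cell _ _ _ _ _ _ psi e `&` D).
  by apply: measurableI => //; exact: (sp_cell_measurable Hpsi).
apply: strongly_measurableB; apply: strongly_measurable_sum => e.
  apply: strongly_measurableZ.
    exact: (measurableT_comp (@fine_measurable _ _ measurableT) (prm_measurable HN (mc e))).
  by apply: strongly_measurableZ => //; exact: strongly_measurable_cst.
apply: strongly_measurableZ; first exact: measurable_cst.
by apply: strongly_measurableZ => //; exact: strongly_measurable_cst.
Qed.

Variables (T : R -> X -> Y) (M : R).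
Hypotheses (M0 : 0 <= M) (TM : forall u x, `|T u x| <= M * `|x|).
Hypothesis TL : forall u x, 0 < u -> T v x @[v --> u^'-] --> T u x.

Local Notation G := sp_domain.
Local Notation cl n := (@sp_cell _ _ _ _ _ _ (disc phi T n)).
Local Notation cf n := (@sp_coef _ _ _ _ _ _ (disc phi T n)).
Local Notation RI n := (region_integral nu N (disc phi T n)).

(* [0] on the null event where [N] charges the domain infinitely often, so
   that [disc_limit] is a pointwise limit of measurable functions. *)
Definition disc_limit (D : set RJ) (w : O) : Y :=
  if (N w G < +oo)%E then lim (RI n D w @[n --> \oo]) else 0.

Let cell_sub n e : cl n e `<=` G.
Proof.
move=> z [/= z1 z2]; split; last by exists e.2.1.
move: z1; rewrite /= !in_itv/= => /andP[az za]; apply/andP; split.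
  by apply: le_lt_trans az; exact: (sp_t_ge0 (disc_adapted Hphi T n) (ltnW (ltn_ord _))).
apply: (le_trans za); rewrite -[leRHS](refine_coarse _ n (sp_l phi)).
by apply: (sp_t_le (disc_adapted Hphi T n)); rewrite ltn_ord/=.
Qed.

Let mcell n e : measurable (cl n e).
Proof. exact: (sp_cell_measurable (disc_adapted Hphi T n)). Qed.

Let step_bound w n z : `|step_fun (cl n)
  (cf n w) z| <= M * coef_bound phi w.
Proof. by rewrite -sp_funE; exact: (disc_fun_bound Hphi). Qed.

Definition total_mass w : R := fine (N w G) + fine (mu G).

Lemma disc_integral_bound n D w : measurable D -> (N w G < +oo)%E ->
  `|RI n D w| <= M * coef_bound phi w * total_mass w.
Proof.
move=> mD Goo; apply: (le_trans (ler_normB _ _)); rewrite mulrDr.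
have mG := sp_domain_measurable.
have B (rho : {measure set RJ -> \bar R}) : (rho G < +oo)%E ->
    `|step_sum (cl n) (cf n w) rho D|
    <= M * coef_bound phi w * fine (rho G).
  move=> roo; apply: (le_trans (step_sum_bound (@mcell n) mG (@cell_sub n) roo mD
    (step_bound w n))).
  apply: ler_wpM2l; first by rewrite mulr_ge0// coef_bound_ge0.
  apply: fine_le; rewrite ?ge0_fin_numE//; last first.
    by apply: le_measure; rewrite ?inE//; exact: measurableI.
  apply: le_lt_trans roo.
  by apply: le_measure; rewrite ?inE//; exact: measurableI.
by apply: lerD; apply: B => //; exact: sp_domain_finite.
Qed.

Lemma disc_limit_rate w : (N w G < +oo)%E ->
  exists a : nat -> R, a @ \oo --> (0 : R) /\ forall D, measurable D ->
    RI n D w @[n --> \oo] --> disc_limit D w /\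
    forall n, `|RI n D w - disc_limit D w| <= a n.
Proof.
move=> Goo; have mG := sp_domain_measurable.
have cvf z : step_fun (cl n)
    (cf n w) z @[n --> \oo] --> sp_fun (sp_map phi (T z.1)) w z.
  by under eq_fun do rewrite -sp_funE; exact: (disc_fun_cvg Hphi TL).
have C (rho : {measure set RJ -> \bar R}) roo := step_sum_cauchy (rho := rho)
  (y := fun n => cf n w) mcell mG cell_sub roo (step_bound w) cvf.
have [a [a0 Ha]] := C (N w) Goo.
have [b [b0 Hb]] := C mu sp_domain_finite.
exists (fun n => a n + b n); split.
  by rewrite -(addr0 (0 : R)); apply: cvgD.
move=> D mD; rewrite /disc_limit Goo; apply: cauchy_rate.
  by rewrite -(addr0 (0 : R)); apply: cvgD.
move=> n m; have := Ha D mD n m; have := Hb D mD n m; rewrite /region_integral.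
set x1 := step_sum _ _ _ _; set x2 := step_sum _ _ _ _ => h2.
set x3 := step_sum _ _ _ _; set x4 := step_sum _ _ _ _ => h4.
have -> : x3 - x1 - (x4 - x2) = (x3 - x4) - (x1 - x2).
  by rewrite !opprB addrACA [in RHS]addrACA [- x1 + _]addrC.
by have := ler_normB (x3 - x4) (x1 - x2); lra.
Qed.

Lemma disc_limit_increment w D D' : (N w G < +oo)%E -> measurable D ->
  measurable D' -> D' `<=` D ->
  `|disc_limit D w - disc_limit D' w| <= M * coef_bound phi w *
    (fine (N w (G `&` (D `\` D'))) + fine (mu (G `&` (D `\` D')))).
Proof.
move=> Goo mD mD' D'D; have mG := sp_domain_measurable.
have [a [_ Ha]] := disc_limit_rate Goo.
have [[cD _] [cD' _]] := (Ha _ mD, Ha _ mD').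
apply: (cvgr_to_le (cvg_norm (cvgB cD cD'))); apply: nearW => n.
have mDD : measurable (D `\` D') by exact: measurableD.
have E1 : step_sum (cl n) (cf n w) (N w) D - step_sum (cl n) (cf n w) (N w) D' =
    step_sum (cl n) (cf n w) (N w) (D `\` D').
  exact: (step_sumD _ (@mcell n) mG (@cell_sub n) Goo).
have E2 : step_sum (cl n) (cf n w) mu D - step_sum (cl n) (cf n w) mu D' =
    step_sum (cl n) (cf n w) mu (D `\` D').
  exact: (step_sumD _ (@mcell n) mG (@cell_sub n) sp_domain_finite).
have B1 := step_sum_bound (rho := N w) (@mcell n) mG (@cell_sub n) Goo mDD
  (step_bound w n).
have B2 := step_sum_bound (rho := mu) (@mcell n) mG (@cell_sub n)
  sp_domain_finite mDD (step_bound w n).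
rewrite mulrDr; change (`|RI n D w - RI n D' w| <= M * coef_bound phi w *
  fine (N w (G `&` (D `\` D'))) + M * coef_bound phi w *
  fine (mu (G `&` (D `\` D')))).
rewrite /region_integral.
have -> : forall a b c e : Y, a - b - (c - e) = (a - c) - (b - e).
  by move=> a' b c e; rewrite !opprB addrACA [in RHS]addrACA [- b + _]addrC.
by rewrite E1 E2; apply: (le_trans (ler_normB _ _)); exact: lerD.
Qed.

Lemma disc_limit_measurable D : measurable D ->
  strongly_measurable measurable (disc_limit D).
Proof.
move=> mD; pose O0 := [set w | (N w G < +oo)%E].
have mO0 : measurable O0.
  rewrite (_ : O0 = ~` ((N ^~ G) @^-1` [set +oo%E])).
    apply: measurableC; apply: (count_measurable HN sp_domain_measurable).
    exact: emeasurable_set1.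
  by apply/seteqP; split=> w; rewrite /O0 /= ltey => /eqP.
apply: (@strongly_measurable_lim _ _ _ _ (fun n w => (\1_O0 w : R) *: RI n D w)).
  move=> n; apply: strongly_measurableZ; first exact: measurable_indic.
  exact: (region_integral_measurable (disc_adapted Hphi T n) mD).
move=> w; have [Goo|Goo] := boolP (N w G < +oo)%E.
  under eq_fun do rewrite indicE mem_set// scale1r.
  by have [a [_ /(_ D mD) []]] := disc_limit_rate Goo.
have nO : w \notin O0 by apply/negP => /set_mem; exact/negP.
rewrite /disc_limit (negbTE Goo); under eq_fun do rewrite indicE (negbTE nO) scale0r.
exact: cvg_cst.
Qed.

Lemma domain_count_finite : {ae P, forall w, (N w G < +oo)%E}.
Proof.
have mG := sp_domain_measurable.
exists [set w | N w G = +oo%E]; split.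
- exact: (count_measurable HN mG (emeasurable_set1 +oo%E)).
- exact: (count_finite HN mG sp_domain_finite).
- by move=> w /= /negP; rewrite -leNgt leye_eq => /eqP.
Qed.

Lemma total_mass_all_moments : all_moments P total_mass.
Proof.
apply: all_momentsD.
  exact: (count_all_moments HN sp_domain_measurable sp_domain_finite).
by apply: all_moments_cst; rewrite fine_ge0.
Qed.

Let dominating w := M * coef_bound phi w * total_mass w.

Let dominating_all_moments : all_moments P dominating.
Proof.
apply: all_momentsM; last exact: total_mass_all_moments.
exact: all_momentsZ M0 coef_bound_all_moments.
Qed.

Lemma disc_limit_bound D w : measurable D -> `|disc_limit D w| <= dominating w.
Proof.
move=> mD; have [Goo|Goo] := boolP (N w G < +oo)%E; last first.
  rewrite /disc_limit (negbTE Goo) normr0.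
  by have [_ d0 _] := dominating_all_moments; exact: d0.
have [a [_ /(_ D mD) [cD _]]] := disc_limit_rate Goo.
by apply: (cvgr_to_le (cvg_norm cD)); apply: nearW => n; exact: disc_integral_bound.
Qed.

Lemma disc_Lp_cvg p D : 1 <= p -> measurable D ->
  Lp_cvg P p (fun n => RI n D) (disc_limit D).
Proof.
move=> p1 mD; have p0 : 0 < p by lra.
have sl := disc_limit_measurable mD.
have sd n := region_integral_measurable (disc_adapted Hphi T n) mD.
have [mg g0 gq] := dominating_all_moments.
split.
  split=> //; apply: le_lt_trans (gq p p1); apply: le_expect => //.
  - by apply: measurable_powR_fun; exact: strongly_measurable_norm.
  - exact: measurable_powR_fun.
  - by move=> w; apply: le_powR => //; [exact: ltW|exact: disc_limit_bound].
have [_ _ hq] := all_momentsZ (ler0n R 2) dominating_all_moments.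
have md n : measurable_fun setT (fun w => (`|RI n D w - disc_limit D w| `^ p)%:E).
  apply/measurable_EFinP; apply: measurable_powR_fun; apply: strongly_measurable_norm.
  exact: strongly_measurableB.
have md0 : measurable_fun setT (fun w => (2 * dominating w) `^ p).
  by apply: measurable_powR_fun; exact: measurable_funM.
have ig : P.-integrable setT (fun w => ((2 * dominating w) `^ p)%:E).
  apply/integrableP; split; first exact/measurable_EFinP.
  under eq_integral => w _ do rewrite gee0_abs ?lee_fin ?powR_ge0//.
  exact: hq.
have aec : {ae P, forall w, setT w ->
    (`|RI n D w - disc_limit D w| `^ p)%:E @[n --> \oo] --> 0%E}.
  apply: filterS domain_count_finite => w Goo _.
  have [a [_ /(_ D mD) [cD _]]] := disc_limit_rate Goo.
  apply: cvg_EFin; first exact: nearW.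
  have h : RI n D w - disc_limit D w @[n --> \oo] --> (0 : Y).
    by rewrite -(subrr (disc_limit D w)); apply: cvgB; [exact: cD|exact: cvg_cst].
  apply/cvgrPdist_lt => e e0.
  have e' : 0 < e `^ p^-1 by rewrite powR_gt0.
  move/cvgrPdist_lt : h => /(_ _ e'); apply: filterS => n.
  rewrite !sub0r !normrN ger0_norm ?powR_ge0// => hn.
  rewrite -[ltRHS](@powRVK _ p e p0 (ltW e0)).
  by apply: gt0_ltr_powR; rewrite ?nnegrE ?powR_ge0.
have aeb : {ae P, forall w n, setT w ->
    (`| (`|RI n D w - disc_limit D w| `^ p)%:E | <= ((2 * dominating w) `^ p)%:E)%E}.
  apply: filterS domain_count_finite => w Goo n _.
  rewrite gee0_abs ?lee_fin ?powR_ge0//; apply: le_powR => //; first exact: ltW.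
  apply: (le_trans (ler_normB _ _)); have := disc_integral_bound n mD Goo.
  by have := disc_limit_bound w mD; rewrite /dominating; lra.
have [_ _] := dominated_convergence measurableT md (measurable_cst 0%E) aec ig aeb.
by rewrite /= integral_cst// mul0e.
Qed.

End limit_of_discretizations.

(** * Moment bounds in terms of the intensity *)

Lemma le_lower_integral {R : realType} d (T : measurableType d)
    (mu : {measure set T -> \bar R}) (f g : T -> \bar R) :
  (forall x, 0 <= f x)%E -> (forall x, f x <= g x)%E ->
  (\int[mu]_x f x <= \int[mu]_x g x)%E.
Proof.
move=> f0 fg; have g0 x : (0 <= g x)%E by exact: le_trans (fg x).
rewrite !ge0_integralTE//; apply: le_ereal_sup => _ [h hf <-].
by exists h => // x; exact: le_trans (fg x).
Qed.

Section disjoint_cells.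
Context {R : realType} d (E : measurableType d).
Variables (mu : {measure set E -> \bar R}) (cell : nat -> set E).
Hypotheses (mc : forall c, measurable (cell c)) (tc : trivIset setT cell)
  (cfin : forall c, mu (cell c) \is a fin_num).

Lemma cells_sum_le n (f : nat -> R) (F : E -> \bar R) :
  (forall c, 0 <= f c) -> (forall z, 0 <= F z)%E -> measurable_fun setT F ->
  {ae mu, forall z, forall c, cell c z -> ((f c)%:E <= F z)%E} ->
  ((\sum_(c < n) fine (mu (cell c)) * f c)%:E <= \int[mu]_z F z)%E.
Proof.
move=> f0 F0 mF fF.
pose G z : \bar R := (\sum_(c < n) (f c)%:E * (\1_(cell c) z)%:E)%E.
have G0 z : (0 <= G z)%E.
  by apply: sume_ge0 => c _; rewrite -EFinM lee_fin mulr_ge0.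
have mi (c : nat) : measurable_fun setT (fun z => (\1_(cell c) z)%:E : \bar R).
  by apply/measurable_EFinP; exact: measurable_indic.
have -> : ((\sum_(c < n) fine (mu (cell c)) * f c)%:E = \int[mu]_z G z)%E.
  rewrite ge0_integral_sum//; last 2 first.
  - by move=> c; apply: measurable_funeM; exact: mi.
  - by move=> c z _; rewrite -EFinM lee_fin mulr_ge0.
  rewrite -sumEFin; apply: eq_bigr => c _.
  rewrite ge0_integralZl_EFin//.
  by rewrite integral_indic// setIT EFinM fineK ?cfin// muleC.
apply: ae_ge0_le_integral => //.
  by apply: emeasurable_sum => c; apply: measurable_funeM; exact: mi.
apply: filterS fF => z fF _; rewrite /G.
have [[c cz]|nc] := pselect (exists c : 'I_n, cell c z).
  rewrite (bigD1 c)//= big1 ?adde0.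
    by rewrite indicE mem_set// mule1; exact: fF.
  move=> c' c'c; rewrite indicE memNset ?mule0// => c'z.
  move/eqP: c'c; apply; apply: val_inj.
  by apply: (tc (i := c') (j := c)) => //; exists z.
rewrite big1 ?F0// => c _; rewrite indicE memNset ?mule0// => cz.
by apply: nc; exists c.
Qed.

End disjoint_cells.

Section cell_moment_bounds.
Context {R : realType} dO (O : measurableType dO) (P : probability O R).
Context d (E : measurableType d) {X Y : completeNormedModType R}.

Record cell_integrand (mu : {sigma_finite_measure set E -> \bar R})
    (N : O -> {measure set E -> \bar R}) (Reg cell : nat -> set E)
    (v : nat -> O -> Y) (psi : O -> E -> X) : Prop := {
  ci_prm : poisson_random_measure P mu N ;
  ci_reg : forall c, measurable (Reg c) ;
  ci_reg_mono : forall c, Reg c `<=` Reg c.+1 ;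
  ci_cell : forall c, measurable (cell c) ;
  ci_cell_sub : forall c, cell c `<=` Reg c.+1 ;
  ci_cell_disj : forall c, Reg c `&` cell c = set0 ;
  ci_cell_le1 : forall c, (mu (cell c) <= 1)%E ;
  ci_measurable : forall c, strongly_measurable <<s gen_region N (Reg c)>> (v c) ;
  ci_moments : forall c, all_moments P (fun w => `|v c w|) ;
  ci_psi : forall w, measurable_fun setT (fun z => `|psi w z|) ;
  ci_le : forall c w z, cell c z -> `|v c w| <= `|psi w z| }.

Variables (mu : {sigma_finite_measure set E -> \bar R})
  (N : O -> {measure set E -> \bar R}) (Reg cell : nat -> set E)
  (v : nat -> O -> Y) (psi : O -> E -> X).
Hypothesis H : cell_integrand mu N Reg cell v psi.

Local Notation h c := (fine (mu (cell c))).
Local Notation eta := (cell_count N cell).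

Lemma ci_increments :
  poisson_increments P (fun c => gen_region N (Reg c)) eta (fun c => h c).
Proof. by case: H => *; exact: region_increments. Qed.

Lemma ci_fin c : mu (cell c) \is a fin_num.
Proof.
rewrite ge0_fin_numE//; exact: le_lt_trans (ci_cell_le1 H c) (ltry _).
Qed.

Lemma ci_trivIset : trivIset setT cell.
Proof.
have W i j z : (i < j)%N -> cell i z -> cell j z -> False.
  move=> ij ci cj; suff : (Reg j `&` cell j) z by rewrite (ci_cell_disj H).
  split=> //; elim: j ij {cj} => // j IH; rewrite ltnS leq_eqVlt => /predU1P[<-|ij].
    exact: (ci_cell_sub H).
  exact: (ci_reg_mono H (IH ij)).
move=> i j _ _ [z [ci cj]]; apply/eqP; rewrite eqn_leq; apply/andP.
by split; rewrite leqNgt; apply/negP => ij; [exact: (W j i z)|exact: (W i j z)].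
Qed.

Lemma ci_sum_le n q w : 1 <= q ->
  ((\sum_(c < n) h c * `|v c w| `^ q)%:E <= \int[mu]_z (`|psi w z| `^ q)%:E)%E.
Proof.
move=> q1; apply: (@cells_sum_le _ _ _ mu cell (ci_cell H) ci_trivIset ci_fin n
  (fun c => `|v c w| `^ q) (fun z => (`|psi w z| `^ q)%:E)) => //.
- by apply/measurable_EFinP; apply: measurable_powR_fun; exact: (ci_psi H).
- apply: aeW => z c cz; rewrite lee_fin le_powR//; first lra.
  exact: (ci_le H).
Qed.

Local Notation A s p := (\int[P]_w (\int[mu]_z (`|psi w z| `^ s)%:E) `^ (p / s))%E.

Lemma ci_sum_expect n p : 1 <= p ->
  (\int[P]_w (\sum_(c < n) h c * `|v c w| `^ p)%:E <= A p p)%E.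
Proof.
move=> p1; apply: le_lower_integral => w.
  by rewrite lee_fin; apply: sumr_ge0 => c _; rewrite mulr_ge0 ?fine_ge0// powR_ge0.
rewrite divff; last by rewrite gt_eqF//; lra.
rewrite poweRe1 ?ci_sum_le//; apply: integral_ge0 => z _.
by rewrite lee_fin powR_ge0.
Qed.

Lemma ci_sum_powR_expect n s p : 1 <= s -> s <= p ->
  (\int[P]_w ((\sum_(c < n) h c * `|v c w| `^ s) `^ (p / s))%:E <= A s p)%E.
Proof.
move=> s1 sp; apply: le_lower_integral => w; first by rewrite lee_fin powR_ge0.
rewrite -poweR_EFin; apply: gt0_ler_poweR.
- by rewrite divr_ge0//; lra.
- rewrite in_itv/= leey andbT lee_fin.
  by apply: sumr_ge0 => c _; rewrite mulr_ge0 ?fine_ge0// powR_ge0.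
- rewrite in_itv/= leey andbT; apply: integral_ge0 => z _.
  by rewrite lee_fin powR_ge0.
- exact: ci_sum_le.
Qed.

End cell_moment_bounds.

Section Lp_bounds.
Context {R : realType}.
Local Notation rmaxS eta h v n w :=
  (rmax (fun k => `|stoch_sum eta h v k w|) n).
Local Notation A P mu psi s p :=
  (\int[P]_w (\int[mu]_z (`|psi w z| `^ s)%:E) `^ (p / s))%E.

Lemma powR_quotient (x q r : R) : x `^ (r / q) = (x `^ q^-1) `^ r.
Proof. by rewrite mulrC powRrM. Qed.

Lemma poweRVK (p : R) (x : \bar R) : 0 < p -> (0 <= x)%E ->
  ((x `^ p^-1) `^ p = x)%E.
Proof. by move=> p0 x0; rewrite -poweRrM mulVf ?gt_eqF// poweRe1. Qed.

Lemma le_poweR (p : R) (x y : \bar R) : 0 <= p -> (0 <= x)%E -> (x <= y)%E ->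
  (x `^ p <= y `^ p)%E.
Proof.
move=> p0 x0 xy; apply: gt0_ler_poweR; rewrite ?in_itv/= ?leey ?andbT//.
exact: le_trans xy.
Qed.

Lemma cell_bound_cap (s p : R) (Y : completeNormedModType R) :
  1 < s -> s <= p -> martingale_type s Y ->
  exists2 C : R, 0 <= C &
  forall dO (O : measurableType dO) (P : probability O R)
    d (E : measurableType d) (X : completeNormedModType R)
    (mu : {sigma_finite_measure set E -> \bar R}) N Reg cell
    (v : nat -> O -> Y) (psi : O -> E -> X),
  cell_integrand P mu N Reg cell v psi -> forall n,
  (\int[P]_w (rmaxS (cell_count N cell) (fun c => fine (mu (cell c))) v n w
     `^ p)%:E <=
   (C%:E * maxe (A P mu psi s p `^ p^-1) (A P mu psi p p `^ p^-1)) `^ p)%E.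
Proof.
move=> s1 sp mY; have p0 : 0 < p by lra.
have p1 : 1 <= p by lra. have s1' : 1 <= s by lra.
suff [C C0 HC] : exists2 C : R, 0 <= C &
  forall dO (O : measurableType dO) (P : probability O R)
    d (E : measurableType d) (X : completeNormedModType R)
    (mu : {sigma_finite_measure set E -> \bar R}) N Reg cell
    (v : nat -> O -> Y) (psi : O -> E -> X),
  cell_integrand P mu N Reg cell v psi -> forall n,
  (\int[P]_w (rmaxS (cell_count N cell) (fun c => fine (mu (cell c))) v n w
     `^ p)%:E <= C%:E * (A P mu psi s p + A P mu psi p p))%E.
  exists ((C + C) `^ p^-1); first exact: powR_ge0.
  move=> dO O P d E X mu N Reg cell v psi H n.
  apply: (le_trans (HC _ _ _ _ _ _ _ _ _ _ _ _ H n)).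
  have A0 q : (0 <= A P mu psi q p)%E by apply: integral_ge0 => w _; exact: poweR_ge0.
  set m := maxe _ _.
  have m0 : (0 <= m)%E by rewrite /m le_max poweR_ge0.
  have Am q : (A P mu psi q p `^ p^-1 <= m)%E -> (A P mu psi q p <= m `^ p)%E.
    by move=> qm; rewrite -[leLHS](poweRVK p0 (A0 q)); apply: le_poweR => //;
       [exact: ltW|exact: poweR_ge0].
  rewrite poweRM ?lee_fin ?powR_ge0// poweR_EFin powRVK ?addr_ge0//.
  rewrite EFinD ge0_muleDl ?lee_fin//.
  rewrite -ge0_muleDr ?poweR_ge0//; apply: lee_wpmul2l; first by rewrite lee_fin.
  by apply: leeD; apply: Am; rewrite /m le_max lexx ?orbT.
have A0 dO (O : measurableType dO) (P : probability O R)
    d (E : measurableType d) (X : completeNormedModType R)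
    (mu : {sigma_finite_measure set E -> \bar R}) (psi : O -> E -> X) q :
    (0 <= A P mu psi q p)%E.
  by apply: integral_ge0 => w _; exact: poweR_ge0.
have [ps|ps] := eqVneq s p.
  have [C C0 HC] := martingale_maximal_inequality s1 mY.
  exists C => // dO O P d E X mu N Reg cell v psi H n; rewrite -ps.
  have vm c := ci_moments H c.
  apply: (le_trans (HC _ _ _ _ _ _ (ci_increments H) _ (ci_measurable H) _ n)).
    by move=> c; have [_ _] := vm c; apply.
  apply: lee_wpmul2l; first by rewrite lee_fin.
  have h0 (c : nat) : 0 <= fine (mu (cell c)) by rewrite fine_ge0.
  have vs c : all_moments P (fun w => `|v c w| `^ s).
    by apply: all_moments_powR => //; lra.
  rewrite (_ : (\sum_(c < n) _)%E =
      (\int[P]_w (\sum_(c < n) fine (mu (cell c)) * `|v c w| `^ s)%:E)%E).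
    apply: (le_trans (ci_sum_expect H n s1')); rewrite leeDr// ps; exact: A0.
  rewrite expect_moments_sum; last by move=> c; exact: all_momentsZ.
  by apply: eq_bigr => c _; rewrite expect_momentsZ.
have sp' : s < p by rewrite lt_neqAle ps.
have [C C0 HC] := stoch_sum_large_exponent s1 sp' mY.
exists C => // dO O P d E X mu N Reg cell v psi H n.
apply: (le_trans (HC _ _ _ _ _ _ (ci_increments H) _ (ci_measurable H)
  (ci_moments H) n)).
apply: lee_wpmul2l; first by rewrite lee_fin.
by apply: leeD; [exact: (ci_sum_powR_expect H)|exact: (ci_sum_expect H)].
Qed.

Lemma product_ae_sections dO (O : measurableType dO) (P : probability O R)
    d (E : measurableType d) (mu : {sigma_finite_measure set E -> \bar R})
    (Q : O * E -> Prop) :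
  {ae (P \x mu)%E, forall wz, Q wz} ->
  {ae P, forall w, {ae mu, forall z, Q (w, z)}}.
Proof.
move=> [D [mD D0 DQ]].
have mx : measurable_fun setT (fun w => mu (xsection D w)).
  exact: measurable_fun_xsection.
have : ae_eq P setT (fun w => mu (xsection D w)) (cst 0%E).
  apply/ae_eq_integral_abs => //; rewrite -[RHS]D0.
  by apply: eq_integral => w _; rewrite gee0_abs.
apply: filterS => w /(_ Logic.I) h.
exists (xsection D w); split; [exact: measurable_xsection|exact: h|].
by move=> z nQ; rewrite /xsection /= inE; apply: DQ.
Qed.

Section mixed_norm_measurability.
Context dO (O : measurableType dO) (P : probability O R).
Context d (E : measurableType d) (X : completeNormedModType R).
Variable mu : {sigma_finite_measure set E -> \bar R}.
Variables (f : O -> E -> X) (q p : R).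
Hypothesis sf :
  strongly_measurable measurable (fun wz : O * E => f wz.1 wz.2).

Lemma joint_norm_measurable :
  measurable_fun setT (fun wz : O * E => (`|f wz.1 wz.2| `^ q)%:E).
Proof.
by apply/measurable_EFinP; apply: measurable_powR_fun; exact: (strongly_measurable_norm sf).
Qed.

Lemma section_norm_measurable w : measurable_fun setT (fun z => `|f w z|).
Proof.
exact: (measurableT_comp (strongly_measurable_norm sf) (pair1_measurable w)).
Qed.

Lemma inner_norm_measurable :
  measurable_fun setT (fun w => (\int[mu]_z (`|f w z| `^ q)%:E)%E).
Proof.
apply: (@measurable_fun_fubini_tonelli_F _ _ _ _ _ mu _ joint_norm_measurable).
by move=> wz; rewrite lee_fin powR_ge0.
Qed.

Hypotheses (q0 : 0 < q) (p0 : 0 < p).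
Hypothesis fin : (A P mu f q p < +oo)%E.

Lemma inner_norm_finite :
  {ae P, forall w, (\int[mu]_z (`|f w z| `^ q)%:E < +oo)%E}.
Proof.
have pq : p / q != 0 by rewrite gt_eqF// divr_gt0.
have ii : P.-integrable setT
    (fun w => (\int[mu]_z (`|f w z| `^ q)%:E) `^ (p / q))%E.
  apply/integrableP; split.
    apply: (measurableT_comp (measurable_poweR _)); exact: inner_norm_measurable.
  by under eq_integral => w _ do rewrite gee0_abs ?poweR_ge0//.
have := integrable_ae measurableT ii; apply: filterS => w /(_ Logic.I) h.
apply: (lty_poweRy pq); rewrite -ge0_fin_numE//; exact: poweR_ge0.
Qed.

Lemma fine_inner_norm :
  (\int[P]_w (fine (\int[mu]_z (`|f w z| `^ q)%:E)%E `^ (p / q))%:E <= A P mu f q p)%E.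
Proof.
apply: le_lower_integral => w; first by rewrite lee_fin powR_ge0.
have I0 : (0 <= \int[mu]_z (`|f w z| `^ q)%:E)%E.
  by apply: integral_ge0 => z _; rewrite lee_fin powR_ge0.
have pq : p / q != 0 by rewrite gt_eqF// divr_gt0.
case: (\int[mu]_z _)%E I0 => [r r0|_|//]; first by rewrite poweR_EFin.
by rewrite poweRyr// leey.
Qed.

End mixed_norm_measurability.

Lemma cell_bound_sum (s p : R) (Y : completeNormedModType R) :
  1 < s -> 1 <= p < s -> martingale_type s Y ->
  exists2 C : R, 0 <= C &
  forall dO (O : measurableType dO) (P : probability O R)
    d (E : measurableType d) (X : completeNormedModType R)
    (mu : {sigma_finite_measure set E -> \bar R}) N Reg cell
    (v : nat -> O -> Y) (psi : O -> E -> X),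
  cell_integrand P mu N Reg cell v psi ->
  forall psi0 psi1 : O -> E -> X,
  strongly_measurable measurable (fun wz : O * E => psi0 wz.1 wz.2) ->
  strongly_measurable measurable (fun wz : O * E => psi1 wz.1 wz.2) ->
  (A P mu psi0 s p < +oo)%E -> (A P mu psi1 p p < +oo)%E ->
  {ae (P \x mu)%E, forall wz, psi wz.1 wz.2 = psi0 wz.1 wz.2 + psi1 wz.1 wz.2} ->
  forall n,
  (\int[P]_w (rmaxS (cell_count N cell) (fun c => fine (mu (cell c))) v n w
     `^ p)%:E <=
   (C%:E * (A P mu psi0 s p `^ p^-1 + A P mu psi1 p p `^ p^-1)) `^ p)%E.
Proof.
move=> s1 hp mY; have /andP[p1 ps] := hp; have p0 : 0 < p by lra.
have s0 : 0 < s by lra.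
have hps : 1 <= p <= s by rewrite p1 ltW.
pose C0 : R := 2 `^ s * 2.
have [C C0' HC] := stoch_sum_le_modular C0 s1 hp mY.
pose C1 := C * (2 `^ p * (2 `^ p)).
have C10 : 0 <= C1 by rewrite !mulr_ge0 ?powR_ge0.
have C2p : C * (2 `^ p) >= 0 by rewrite mulr_ge0 ?powR_ge0.
exists ((C1 + C1) `^ p^-1); first exact: powR_ge0.
move=> dO O P d E X mu N Reg cell v psi H psi0 psi1 sp0 sp1 A0f A1f psiE n.
pose a w := fine (\int[mu]_z (`|psi0 w z| `^ s)%:E)%E.
pose b w := fine (\int[mu]_z (`|psi1 w z| `^ p)%:E)%E.
have a0 w : 0 <= a w.
  by rewrite fine_ge0//; apply: integral_ge0 => z _; rewrite lee_fin powR_ge0.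
have b0 w : 0 <= b w.
  by rewrite fine_ge0//; apply: integral_ge0 => z _; rewrite lee_fin powR_ge0.
have ma : measurable_fun setT a.
  exact: (measurableT_comp (@fine_measurable _ _ measurableT) (inner_norm_measurable mu s sp0)).
have mb : measurable_fun setT b.
  exact: (measurableT_comp (@fine_measurable _ _ measurableT) (inner_norm_measurable mu p sp1)).
set A0 := A P mu psi0 s p; set A1 := A P mu psi1 p p.
have A00 : (0 <= A0)%E by apply: integral_ge0 => w _; exact: poweR_ge0.
have A10 : (0 <= A1)%E by apply: integral_ge0 => w _; exact: poweR_ge0.
set L := (\int[P]_w _)%E.
suff HL : (L <= C1%:E * (A0 + A1))%E.
  apply: (le_trans HL); set m := (A0 `^ p^-1 + A1 `^ p^-1)%E.
  have m0 : (0 <= m)%E by rewrite adde_ge0// poweR_ge0.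
  have A0m : (A0 <= m `^ p)%E.
    rewrite -[leLHS](poweRVK p0 A00); apply: le_poweR; [exact: ltW|exact: poweR_ge0|].
    by rewrite /m leeDl// poweR_ge0.
  have A1m : (A1 <= m `^ p)%E.
    rewrite -[leLHS](poweRVK p0 A10); apply: le_poweR; [exact: ltW|exact: poweR_ge0|].
    by rewrite /m leeDr// poweR_ge0.
  rewrite poweRM ?lee_fin ?powR_ge0// poweR_EFin powRVK ?addr_ge0//.
  rewrite EFinD ge0_muleDl ?lee_fin//.
  rewrite -ge0_muleDr ?poweR_ge0//; apply: lee_wpmul2l; first by rewrite lee_fin.
  exact: leeD.
apply/lee_addgt0Pr => e e0.
pose ep := (e / (C * 2 `^ p + 1)) `^ p^-1.
have ep0 : 0 < ep by rewrite powR_gt0// divr_gt0//; lra.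
pose K w := a w `^ s^-1 + b w `^ p^-1 + ep.
have K0 w : 0 < K w.
  by apply: ltr_wpDl ep0; apply: addr_ge0; exact: powR_ge0.
have mK : measurable_fun setT K.
  apply: measurable_funD; last exact: measurable_cst.
  by apply: measurable_funD; exact: measurable_powR_fun.
have aeK : {ae P, forall w,
    \sum_(c < n) fine (mu (cell c)) * modular s p (K w) `|v c w| <= C0}.
  have f0 := inner_norm_finite sp0 s0 p0 A0f.
  have f1 := inner_norm_finite sp1 p0 p0 A1f.
  have ps' := product_ae_sections psiE.
  move: f0 f1 ps'; apply: filterS3 => w fa fb pw.
  have Kn0 : K w != 0 by rewrite gt_eqF.
  pose F z : \bar R := (2 `^ s * ((`|psi0 w z| / K w) `^ s + (`|psi1 w z| / K w) `^ p))%:E.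
  have F0 z : (0 <= F z)%E.
    by rewrite lee_fin mulr_ge0 ?powR_ge0// addr_ge0 ?powR_ge0.
  have m0 := section_norm_measurable sp0 w; have m1 := section_norm_measurable sp1 w.
  have md (g : E -> R) q : measurable_fun setT g ->
      measurable_fun setT (fun z => (g z / K w) `^ q).
    by move=> mg; apply: measurable_powR_fun; apply: measurable_funM => //; exact: measurable_cst.
  have mF : measurable_fun setT F.
    apply/measurable_EFinP; apply: measurable_funM; first exact: measurable_cst.
    by apply: measurable_funD; exact: md.
  rewrite -lee_fin.
  apply: (@le_trans _ _ (\int[mu]_z F z)%E).
    apply: (@cells_sum_le _ _ _ mu cell (ci_cell H) (ci_trivIset H) (ci_fin H) n
      (fun c => modular s p (K w) `|v c w|) F) => //.
      by move=> c; exact: modular_ge0.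
    apply: filterS pw => z /= pz c cz; rewrite lee_fin.
    apply: (modular_le_sum hps (K0 w)) => //.
    by apply: (le_trans (ci_le H w cz)); rewrite pz ler_normD.
  have E1 (g : E -> X) q : 0 < q -> measurable_fun setT (fun z => `|g z|) ->
      (\int[mu]_z ((`|g z| / K w) `^ q)%:E =
       ((K w)^-1 `^ q)%:E * \int[mu]_z (`|g z| `^ q)%:E)%E.
    move=> q0 mg; under eq_integral do rewrite powRM ?invr_ge0 ?(ltW (K0 w))// mulrC.
    rewrite -ge0_integralZl_EFin ?powR_ge0//.
      by apply/measurable_EFinP; exact: measurable_powR_fun.
  have E2 (g : E -> X) q : 0 < q -> measurable_fun setT (fun z => `|g z|) ->
      (\int[mu]_z (`|g z| `^ q)%:E < +oo)%E ->
      fine (\int[mu]_z (`|g z| `^ q)%:E)%E `^ q^-1 <= K w ->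
      (\int[mu]_z ((`|g z| / K w) `^ q)%:E <= 1)%E.
    move=> q0 mg gfin gK; rewrite E1//.
    have g0 : (0 <= \int[mu]_z (`|g z| `^ q)%:E)%E.
      by apply: integral_ge0 => z _; rewrite lee_fin powR_ge0.
    rewrite -(fineK (_ : (\int[mu]_z (`|g z| `^ q)%:E)%E \is a fin_num)); last first.
      by rewrite ge0_fin_numE.
    rewrite -EFinM lee_fin -(@powRVK _ q (fine _) q0) ?fine_ge0//.
    rewrite -powRM ?invr_ge0 ?(ltW (K0 w)) ?powR_ge0//.
    have p1q : (1 : R) = 1 `^ q by rewrite powR1.
    rewrite [leRHS]p1q; apply: le_powR; first exact: ltW.
      by rewrite mulr_ge0 ?invr_ge0 ?(ltW (K0 w)) ?powR_ge0.
    by rewrite mulrC ler_pdivrMr// mul1r.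
  have md' (g : E -> X) q : measurable_fun setT (fun z => `|g z|) ->
      measurable_fun setT (fun z => ((`|g z| / K w) `^ q)%:E).
    by move=> mg; apply/measurable_EFinP; exact: md.
  rewrite /F; under eq_integral do rewrite EFinM.
  rewrite ge0_integralZl_EFin ?powR_ge0//; last 2 first.
  - by move=> z _; rewrite lee_fin addr_ge0 ?powR_ge0.
  - by apply/measurable_EFinP; apply: measurable_funD; exact: md.
  rewrite /C0 EFinM; apply: lee_wpmul2l; first by rewrite lee_fin powR_ge0.
  under eq_integral do rewrite EFinD.
  rewrite ge0_integralD//; first last.
  - exact: md'.
  - by move=> z _; rewrite lee_fin powR_ge0.
  - exact: md'.
  - by move=> z _; rewrite lee_fin powR_ge0.
  rewrite (_ : 2 = 1 + 1 :> R)// EFinD; apply: leeD; apply: E2 => //.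
  - rewrite /K -addrA lerDl; apply: addr_ge0; [exact: powR_ge0|exact: ltW].
  - rewrite /K addrAC lerDr; apply: addr_ge0; [exact: powR_ge0|exact: ltW].
apply: (le_trans (HC _ _ _ _ _ _ (ci_increments H) _ (ci_measurable H)
  (ci_moments H) n K mK K0 aeK)).
have Kp w : K w `^ p <= 2 `^ p * (2 `^ p) * (a w `^ (p / s) + b w `^ (p / p)) +
    2 `^ p * ep `^ p.
  apply: (le_trans (powR_addr (ltW p0) _ (ltW ep0))).
    by rewrite addr_ge0 ?powR_ge0.
  rewrite mulrDr lerD2r -mulrA; apply: ler_wpM2l; first exact: powR_ge0.
  apply: (le_trans (powR_addr (ltW p0) (powR_ge0 _ _) (powR_ge0 _ _))).
  apply: ler_wpM2l; first exact: powR_ge0.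
  apply: lerD.
    by rewrite (powR_quotient (a w)).
  by rewrite (powR_quotient (b w)).
have epE : C * 2 `^ p * ep `^ p <= e.
  rewrite /ep powRVK//; last by rewrite divr_ge0//; lra.
  by rewrite mulrA ler_pdivrMr; [nra|lra].
have mpow (g : O -> R) q : measurable_fun setT g ->
    measurable_fun setT (fun w => (g w `^ q)%:E).
  by move=> mg; apply/measurable_EFinP; exact: measurable_powR_fun.
have pg0 (g : O -> R) q w : setT w -> (0 <= (g w `^ q)%:E)%E.
  by move=> _; rewrite lee_fin powR_ge0.
pose g w : \bar R := ((a w `^ (p / s))%:E + (b w `^ (p / p))%:E)%E.
have mg : measurable_fun setT g by apply: emeasurable_funD; exact: mpow.
have g0 w : setT w -> (0 <= g w)%E.
  by move=> _; rewrite /g adde_ge0// lee_fin powR_ge0.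
have c10 : 0 <= 2 `^ p * 2 `^ p :> R by rewrite mulr_ge0 ?powR_ge0.
have c20 : 0 <= 2 `^ p * ep `^ p by rewrite mulr_ge0 ?powR_ge0.
have IK : (\int[P]_w (K w `^ p)%:E <=
    (2 `^ p * 2 `^ p)%:E * (A0 + A1) + (2 `^ p * ep `^ p)%:E)%E.
  apply: (@le_trans _ _ (\int[P]_w ((2 `^ p * 2 `^ p)%:E * g w +
      cst (2 `^ p * ep `^ p)%:E w))%E).
    apply: le_lower_integral => w; first by rewrite lee_fin powR_ge0.
    change ((K w `^ p)%:E <= (2 `^ p * 2 `^ p * (a w `^ (p / s) +
      b w `^ (p / p)) + 2 `^ p * ep `^ p)%:E)%E.
    by rewrite lee_fin; exact: Kp.
  rewrite ge0_integralD//; last 2 first.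
  - by move=> w _; apply: mule_ge0; [rewrite lee_fin|exact: g0].
  - exact: measurable_funeM.
  rewrite ge0_integralZl_EFin// integral_cst//.
  apply: leeD; last first.
    rewrite [X in (_ * X)%E](_ : _ = 1%E) ?mule1//; exact: probability_setT.
  apply: lee_wpmul2l; first by rewrite lee_fin.
  rewrite ge0_integralD//; [|exact: pg0|exact: mpow|exact: pg0|exact: mpow].
  by apply: leeD; [exact: (fine_inner_norm P mu)|exact: (fine_inner_norm P mu)].
apply: (@le_trans _ _ (C%:E * ((2 `^ p * 2 `^ p)%:E * (A0 + A1) +
    (2 `^ p * ep `^ p)%:E))%E).
  by apply: lee_wpmul2l => //; rewrite lee_fin.
rewrite ge0_muleDr ?lee_fin//; last by rewrite mule_ge0// ?lee_fin// adde_ge0.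
rewrite muleA -EFinM; apply: leeD => //.
by rewrite -EFinM lee_fin mulrA.
Qed.

End Lp_bounds.

(** * Lexicographic cells *)

Section lexicographic_cells.
Context {R : realType} {X Y : completeNormedModType R}.
Context dO (O : measurableType dO) (P : probability O R).
Context dJ (J : measurableType dJ)
  (nu : {sigma_finite_measure set J -> \bar R}).
Local Notation RJ := (measurableTypeR R * J)%type.
Context (N : O -> {measure set RJ -> \bar R}).
Hypothesis HN : poisson_random_measure P (intensity nu) N.
Variables (phi : @step_process R X dO O dJ J).
Hypothesis Hphi : simple_adapted P nu N phi.
Local Notation mu := (intensity nu).
Variables (B : set J) (mB : measurable B).
Variables (T : R -> X -> Y) (Kq : R).
Hypotheses (K0 : 0 < Kq) (TM : forall u x, `|T u x| <= Kq * `|x|).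
Hypothesis Tlin : forall u (I : finType) (c : I -> R) (x : I -> X),
  T u (\sum_k c k *: x k) = \sum_k c k *: T u (x k).
Variable n : nat.
Local Notation L := (sp_l phi * 2 ^ n)%N.
Local Notation m := (sp_m phi).
Local Notation u := (refine (sp_t phi) n).
Hypothesis mesh :
  (((sp_t phi (sp_l phi)) / (2 ^ n)%:R)%:E * nu (\bigcup_j sp_A (s := phi) j) <= 1)%E.

Let ult a : (a < L)%N -> u a < u a.+1. Proof. exact: (refine_lt (sa_lt Hphi)). Qed.
Let ule a b : (a <= b <= L)%N -> u a <= u b. Proof. exact: (grid_le ult). Qed.
Let u0 : u 0 = 0.
Proof. by rewrite -[RHS](sa_t0 Hphi) -[in RHS](refine_coarse _ n 0) mul0n. Qed.

(* The cells [(a, j)] are enumerated in lexicographic order, time first. *)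
Definition lex_pair c : option ('I_L * 'I_m) :=
  if insub (c %/ m)%N is Some a then
    if insub (c %% m)%N is Some j then Some (a, j) else None
  else None.

Lemma lex_pairP c a j : lex_pair c = Some (a, j) ->
  (c = a * m + j)%N /\ (c %/ m = a)%N.
Proof.
rewrite /lex_pair; case: insubP => // a' _ Ea; case: insubP => // j' _ Ej [<- <-].
by rewrite Ea Ej -divn_eq.
Qed.

Lemma lex_pairE (a : 'I_L) (j : 'I_m) : lex_pair (a * m + j) = Some (a, j).
Proof.
have m0 : (0 < m)%N by apply: leq_ltn_trans (ltn_ord j).
rewrite /lex_pair divnMDl// divn_small// addn0 modnMDl modn_small//.
by rewrite !valK.
Qed.

Definition lex_cell c : set RJ :=
  if lex_pair c is Some (a, j)
  then `]u a, u a.+1]%classic `*` (sp_A (s := phi) j `&` B) else set0.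

Definition lex_value c w : Y :=
  if lex_pair c is Some (a, j)
  then Kq^-1 *: \sum_k sp_F (s := phi) (coarse a) j k w *:
    T (u a) (sp_x (s := phi) (coarse a) j k)
  else 0.

Definition lex_region c : set RJ :=
  `]0, u (minn (c %/ m) L)]%classic `*` setT `|` \bigcup_(c' < c) lex_cell c'.

Lemma lex_cell_measurable c : measurable (lex_cell c).
Proof.
rewrite /lex_cell; case: lex_pair => [[a j]|//].
apply: measurableX; first exact: measurable_itv.
by apply: measurableI => //; exact: (sa_measurable Hphi).
Qed.

Lemma lex_region_measurable c : measurable (lex_region c).
Proof.
apply: measurableU; last by apply: bigcup_measurable => k _; exact: lex_cell_measurable.
by apply: measurableX => //; exact: measurable_itv.
Qed.

Lemma lex_region_mono c : lex_region c `<=` lex_region c.+1.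
Proof.
move=> z [[/= z1 _]|[c' /= c'c cz]]; last by right; exists c' => //=; exact: ltnW.
left; split=> //=; move: z1; rewrite !in_itv/= => /andP[-> z1] /=.
apply: (le_trans z1); apply: ule; rewrite geq_minr andbT leq_min geq_minr andbT.
by rewrite geq_min leq_div2r ?leqnSn.
Qed.

Lemma lex_cell_disj c : lex_region c `&` lex_cell c = set0.
Proof.
apply/seteqP; split=> // z [zR]; rewrite /lex_cell.
case E : (lex_pair c) => [[a j]|//] [/= za [Aj _]].
have [cE aE] := lex_pairP E.
case: zR => [[/= z1 _]|[c' /= c'c]].
  move: z1 za; rewrite aE (minn_idPl (ltnW (ltn_ord a))) !in_itv/=.
  by move=> /andP[_ h1] /andP[h2 _]; move: h1; rewrite leNgt h2.
rewrite /lex_cell; case E' : (lex_pair c') => [[a' j']|//] [/= za' [Aj' _]].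
have [c'E _] := lex_pairP E'.
have aa : val a' = val a.
  by move: za za'; rewrite /= !in_itv/= => za za'; exact: (grid_uniq ult _ _ za' za).
have jj : j' = j by apply: (sa_disjoint Hphi) => //; exists z.2.
by move: c'c; rewrite cE c'E aa jj ltnn.
Qed.

Lemma lex_cell_le1 c : (mu (lex_cell c) <= 1)%E.
Proof.
rewrite /lex_cell; case: lex_pair => [[a j]|]; last by rewrite measure0.
have aL := ltn_ord a.
have ua0 : 0 <= u a by rewrite -[leLHS]u0; apply: ule; exact: (ltnW aL).
have mA : measurable (sp_A (s := phi) j `&` B).
  by apply: measurableI => //; exact: (sa_measurable Hphi).
have uaa := ltW (ult aL).
rewrite intensityX//.
apply: le_trans mesh; apply: lee_pmul => //.
- by rewrite lee_fin subr_ge0 ltW// ult.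
- rewrite lee_fin; have := refine_mesh (sa_lt Hphi) aL.
  by rewrite (sa_t0 Hphi) subr0.
- apply: le_measure; rewrite ?inE//; first exact: (sp_marks_measurable Hphi).
  by move=> z [Aj _]; exists j.
Qed.

Lemma filtration_sub_region c (a : 'I_L) : (c %/ m = a)%N ->
  natural_filtration N (u a) `<=` <<s gen_region N (lex_region c) >>.
Proof.
move=> ca; apply: smallest_sub; first exact: smallest_sigma_algebra.
move=> _ [x [y [A [V [[x0 xy ya mA mV] ->]]]]]; apply: sub_sigma_algebra.
exists (`]x, y]%classic `*` A), V; split=> //; split=> //.
  by apply: measurableX => //; exact: measurable_itv.
move=> z [/= z1 _]; left; split=> //=; move: z1.
rewrite ca (minn_idPl (ltnW (ltn_ord a))) !in_itv/= => /andP[xz zy].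
by rewrite (le_lt_trans x0 xz) (le_trans zy ya).
Qed.

Lemma lex_value_measurable c :
  strongly_measurable <<s gen_region N (lex_region c) >> (lex_value c).
Proof.
pose Fc := g_sigma_algebraType (gen_region N (lex_region c)).
rewrite /lex_value; case E : (lex_pair c) => [[a j]|]; last first.
  exact: (@strongly_measurable_cst _ _ Fc).
have [_ ca] := lex_pairP E.
apply: (@strongly_measurableZ _ _ Fc); first exact: measurable_cst.
apply: (@strongly_measurable_sum _ _ Fc) => k.
apply: (@strongly_measurableZ _ _ Fc); last exact: (@strongly_measurable_cst _ _ Fc).
move=> _ V mV; rewrite setTI; apply: (filtration_sub_region ca).
apply: natural_filtration_mono (sa_adapted Hphi _ _ mV).
exact: (refine_ge (sa_lt Hphi)).
Qed.

Lemma lex_value_moments c : all_moments P (fun w => `|lex_value c w|).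
Proof.
apply: (@all_moments_le _ _ _ _ _ (coef_bound phi)).
- apply: strongly_measurable_norm; apply: strongly_measurable_sub (lex_value_measurable c).
  exact: (gen_region_sub HN).
- by move=> w.
- exact: (coef_bound_all_moments HN Hphi).
move=> w; rewrite /lex_value; case: lex_pair => [[a j]|]; last first.
  by rewrite normr0 coef_bound_ge0.
rewrite normrZ ger0_norm ?invr_ge0 ?(ltW K0)// ler_pdivrMl//.
rewrite -Tlin; apply: (le_trans (TM _ _)); apply: ler_wpM2l; first exact: ltW.
apply: le_trans (ler_norm_sum _ _ _) _.
under eq_bigr do rewrite normrZ.
rewrite /coef_bound -(sp_sum (psi := phi) (fun i j k =>
  `|sp_F i j k w| * `|sp_x (s := phi) i j k|)).
rewrite (bigD1 (coarse a))//= (bigD1 j)//= -addrA lerDl addr_ge0//.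
  by apply: sumr_ge0 => j' _; apply: sumr_ge0 => k _; rewrite mulr_ge0.
apply: sumr_ge0 => i _; apply: sumr_ge0 => j' _; apply: sumr_ge0 => k _.
by rewrite mulr_ge0.
Qed.

Lemma lex_cell_integrand : cell_integrand P mu N lex_region lex_cell lex_value
  (restrict_marks B (sp_fun phi)).
Proof.
split => //.
- exact: lex_region_measurable.
- exact: lex_region_mono.
- exact: lex_cell_measurable.
- by move=> c z cz; right; exists c => /=.
- exact: lex_cell_disj.
- exact: lex_cell_le1.
- exact: lex_value_measurable.
- exact: lex_value_moments.
- move=> w; apply: strongly_measurable_norm; apply: strongly_measurableZ.
    by apply: measurableT_comp measurable_snd; exact: measurable_indic.
  rewrite (_ : sp_fun phi w = step_fun (@sp_cell _ _ _ _ _ _ phi)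
      (@sp_coef _ _ _ _ _ _ phi w)).
    by apply: step_fun_measurable => e; exact: (sp_cell_measurable Hphi).
  by apply/funext => z; exact: sp_funE.
- move=> c w z; rewrite /lex_cell /lex_value.
  case: lex_pair => [[a j]|//] [/= za [Aj Bz]].
  rewrite normrZ ger0_norm ?invr_ge0 ?(ltW K0)// ler_pdivrMl//.
  rewrite -Tlin; apply: (le_trans (TM _ _)); apply: ler_wpM2l; first exact: ltW.
  rewrite /restrict_marks indicE mem_set// scale1r.
  rewrite (@sp_fun_at _ _ _ _ _ _ phi w z (coarse a)) //; last first.
  + move: za; rewrite in_itv/= => /andP[z1 z2]; apply/andP; split.
      by apply: le_lt_trans z1; exact: (refine_ge (sa_lt Hphi)).
    by apply: (le_trans z2); exact: (refine_le (sa_lt Hphi)).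
  + exact: (sa_lt Hphi).
  rewrite (bigD1 j)//= [X in _ + X]big1 ?addr0.
    rewrite le_eqVlt; apply/orP; left; apply/eqP; congr (`|_|).
    by apply: eq_bigr => k _; rewrite indicE mem_set// mulr1.
  move=> j' j'j; apply: big1 => k _; rewrite indicE memNset ?mulr0 ?scale0r// => Aj'.
  by move/eqP: j'j; apply; apply: (sa_disjoint Hphi) => //; exists z.2.
Qed.

Lemma big_ord_lex (V : nmodType) (a b : nat) (F : nat -> V) :
  \sum_(c < a * b) F c = \sum_(i < a) \sum_(j < b) F (i * b + j)%N.
Proof.
elim: a => [|a IH]; first by rewrite mul0n !big_ord0.
by rewrite mulSnr big_split_ord big_ord_recr/= IH.
Qed.

Lemma stoch_sum_lex a w : (a <= L)%N ->
  Kq *: stoch_sum (cell_count N lex_cell) (fun c => fine (mu (lex_cell c)))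
    lex_value (a * m) w =
  region_integral nu N (disc phi T n) (`]0, u a]%classic `*` B) w.
Proof.
move=> aL; rewrite /stoch_sum (big_ord_lex a m (fun c => increment (cell_count N lex_cell)
  (fun c => fine (mu (lex_cell c))) c w *: lex_value c w)).
rewrite (big_ord_widen L (fun i => \sum_(j < m) increment (cell_count N lex_cell)
  (fun c => fine (mu (lex_cell c))) (i * m + j) w *: lex_value (i * m + j) w))//.
rewrite big_mkcond /region_integral /step_sum -sumrB.
rewrite -(sp_sum (psi := disc phi T n) (fun i j k =>
  fine (N w (@sp_cell _ _ _ _ _ _ (disc phi T n) (i, (j, k)) `&`
     (`]0, u a]%classic `*` B))) *:
    (sp_F (s := disc phi T n) i j k w *: sp_x (s := disc phi T n) i j k) -
  fine (mu (@sp_cell _ _ _ _ _ _ (disc phi T n) (i, (j, k)) `&`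
     (`]0, u a]%classic `*` B))) *:
    (sp_F (s := disc phi T n) i j k w *: sp_x (s := disc phi T n) i j k))).
rewrite scaler_sumr; apply: eq_bigr => i _ /=.
have ui0 : 0 <= u i by rewrite -[leLHS]u0; apply: ule; rewrite leq0n ltnW.
case: ifPn => [ia|]; last first.
  rewrite -leqNgt => ai; rewrite scaler0; apply/esym.
  apply: big1 => j _; apply: big1 => k _.
  have -> : @sp_cell _ _ _ _ _ _ (disc phi T n) (i, (j, k)) `&`
      (`]0, u a]%classic `*` B) = set0.
    apply/seteqP; split=> // z [[/= z1 _] [/= z2 _]].
    have uai : u a <= u i by apply: ule; rewrite ai ltnW.
    by move: z1 z2; rewrite !in_itv/= => /andP[h _] /andP[_ h']; lra.
  by rewrite !measure0 !scale0r subrr.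
rewrite scaler_sumr; apply: eq_bigr => j _.
have cE : lex_cell (i * m + j) =
    `]u i, u i.+1]%classic `*` (sp_A (s := phi) j `&` B).
  by rewrite /lex_cell lex_pairE.
rewrite /lex_value lex_pairE /increment (cell_countE HN)//; last exact: lex_cell_measurable.
have KK (D : R) (V : Y) : Kq *: (D *: (Kq^-1 *: V)) = D *: V.
  by rewrite !scalerA; congr (_ *: _); field; rewrite gt_eqF.
rewrite KK.
rewrite scaler_sumr; apply: eq_bigr => k _; rewrite -scalerBl.
have -> // : @sp_cell _ _ _ _ _ _ (disc phi T n) (i, (j, k)) `&`
    (`]0, u a]%classic `*` B) = lex_cell (i * m + j).
rewrite cE; apply/seteqP; split=> z /=.
  by move=> [[z1 Aj] [_ Bz]].
move=> [z1 [Aj Bz]]; split=> //; split=> //; move: z1; rewrite !in_itv/=.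
move=> /andP[h1 h2]; rewrite (le_lt_trans ui0 h1)/=; apply: (le_trans h2).
by apply: ule; rewrite ia.
Qed.

Lemma region_integral_le_rmax a w : (a <= L)%N ->
  `|region_integral nu N (disc phi T n) (`]0, u a]%classic `*` B) w| <=
  Kq * rmax (fun k => `|stoch_sum (cell_count N lex_cell)
    (fun c => fine (mu (lex_cell c))) lex_value k w|) (L * m).
Proof.
move=> aL; rewrite -stoch_sum_lex// normrZ gtr0_norm// ler_pM2l//.
apply: rmax_ge; exact: leq_mul.
Qed.

End lexicographic_cells.

(** * Path regularity and suprema *)

Lemma measure_shrinking {R : realType} d (E : measurableType d)
    (rho : {measure set E -> \bar R}) (F : nat -> set E) (e : R) :
  (forall k, measurable (F k)) -> (rho (F 0%N) < +oo)%E ->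
  (forall k, F k.+1 `<=` F k) -> \bigcap_k F k = set0 -> 0 < e ->
  exists k, forall D, measurable D -> D `<=` F k -> fine (rho D) < e.
Proof.
move=> mF F0 Fd FI e0.
have ndF : nonincreasing_seq F.
  by apply/nonincreasing_seqP => k; apply/subsetPset; exact: Fd.
have := @nonincreasing_cvg_mu _ _ _ rho F F0 mF.
rewrite FI measure0 => /(_ measurable0 ndF) c0.
have Ffin k : (rho (F k) < +oo)%E.
  apply: le_lt_trans F0; apply: le_measure; rewrite ?inE//.
  exact/subsetPset/ndF.
have fc : fine (rho (F k)) @[k --> \oo] --> (0 : R) by apply: fine_cvg.
move/cvgrPdist_lt : fc => /(_ _ e0)[k _ /(_ k (leqnn k))].
rewrite sub0r normrN ger0_norm ?fine_ge0// => ke.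
exists k => D mD DF; apply: le_lt_trans ke.
have rD : (rho D <= rho (F k))%E by apply: le_measure; rewrite ?inE.
by apply: fine_le => //; rewrite ge0_fin_numE//; exact: le_lt_trans rD (Ffin k).
Qed.

Lemma limn_einf_ge {R : realType} (u : nat -> \bar R) (c : \bar R) :
  (\forall n \near \oo, c <= u n)%E -> (c <= limn_einf u)%E.
Proof.
move=> [k _ kc]; rewrite limn_einf_lim; apply: lime_ge; first exact: is_cvg_einfs.
exists k => // n /= kn; apply: le_ereal_inf_tmp => _ [i /= ni <-].
by apply: kc => /=; exact: leq_trans ni.
Qed.

Lemma limn_einf_le {R : realType} (u : nat -> \bar R) (c : \bar R) :
  (\forall n \near \oo, u n <= c)%E -> (limn_einf u <= c)%E.
Proof.
move=> [k _ kc]; rewrite limn_einf_lim; apply: lime_le; first exact: is_cvg_einfs.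
apply: nearW => n; apply: (@le_trans _ _ (u (maxn n k))).
  by apply: ereal_inf_lbound; exists (maxn n k) => //=; exact: leq_maxl.
by apply: kc => /=; exact: leq_maxr.
Qed.

Section path_regularity.
Context {R : realType} {X Y : completeNormedModType R}.
Context dO (O : measurableType dO) (P : probability O R).
Context dJ (J : measurableType dJ)
  (nu : {sigma_finite_measure set J -> \bar R}).
Local Notation RJ := (measurableTypeR R * J)%type.
Context (N : O -> {measure set RJ -> \bar R}).
Hypothesis HN : poisson_random_measure P (intensity nu) N.
Variables (phi : @step_process R X dO O dJ J).
Hypothesis Hphi : simple_adapted P nu N phi.
Local Notation mu := (intensity nu).
Variables (B : set J) (mB : measurable B).
Variables (T : R -> X -> Y) (M : R).
Hypotheses (M0 : 0 <= M) (TM : forall u x, `|T u x| <= M * `|x|).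
Hypothesis TL : forall u x, 0 < u -> T v x @[v --> u^'-] --> T u x.
Variable w : O.
Local Notation G := (sp_domain phi).
Hypothesis Goo : (N w G < +oo)%E.
Local Notation I D := (disc_limit nu N phi T D w).

Lemma limit_shrinking (F : nat -> set RJ) (e : R) : (forall k, measurable (F k)) ->
  (forall k, F k.+1 `<=` F k) -> \bigcap_k F k = set0 -> 0 < e ->
  exists k, forall D D', measurable D -> measurable D' -> D' `<=` D ->
    D `\` D' `<=` F k -> `|I D - I D'| <= e.
Proof.
move=> mF Fd FI e0; have mG := sp_domain_measurable Hphi.
pose b := M * coef_bound phi w.
have b0 : 0 <= b by rewrite mulr_ge0// coef_bound_ge0.
pose eta := e / (2 * (b + 1)).
have eta0 : 0 < eta by rewrite divr_gt0//; lra.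
pose F' k := G `&` F k.
have mF' k : measurable (F' k) by exact: measurableI.
have F'G k : F' k `<=` G by move=> z [].
have Fd' k : F' k.+1 `<=` F' k by move=> z [Gz /Fd].
have FI' : \bigcap_k F' k = set0.
  by apply/seteqP; split=> // z h; rewrite -FI => k _; have [] := h k Logic.I.
have Foo (rho : {measure set RJ -> \bar R}) : (rho G < +oo)%E -> (rho (F' 0%N) < +oo)%E.
  by move=> roo; apply: le_lt_trans roo; apply: le_measure; rewrite ?inE.
have [k1 H1] := measure_shrinking mF' (Foo _ Goo) Fd' FI' eta0.
have [k2 H2] := measure_shrinking mF' (Foo mu (sp_domain_finite Hphi)) Fd' FI' eta0.
have mono i j : (i <= j)%N -> F' j `<=` F' i.
  elim: j => [|j IH]; first by rewrite leqn0 => /eqP->.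
  rewrite leq_eqVlt => /predU1P[->//|ij]; exact: subset_trans (Fd' _) (IH ij).
exists (maxn k1 k2) => D D' mD mD' D'D DF.
apply: (le_trans (disc_limit_increment Hphi TM TL Goo mD mD' D'D)).
have mDD : measurable (G `&` (D `\` D')).
  by apply: measurableI => //; exact: measurableD.
have sub : G `&` (D `\` D') `<=` F' (maxn k1 k2) by move=> z [Gz /DF].
have h1 := H1 _ mDD (subset_trans sub (mono _ _ (leq_maxl _ _))).
have h2 := H2 _ mDD (subset_trans sub (mono _ _ (leq_maxr _ _))).
apply: (@le_trans _ _ (b * (eta + eta))).
  by apply: ler_wpM2l => //; apply: lerD; exact: ltW.
have Ee : eta * (2 * (b + 1)) = e by rewrite divfK// gt_eqF//; lra.
by rewrite -[leRHS]Ee; nra.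
Qed.

Let shrink_itv (k : nat) : 0 < (k.+1%:R)^-1 :> R.
Proof. by rewrite invr_gt0 ltr0n. Qed.

Let small_inv (x : R) : 0 < x -> exists k : nat, (k.+1%:R)^-1 <= x.
Proof.
move=> x0; exists (Num.bound x^-1).
rewrite -[leRHS]invrK lef_pV2 ?posrE ?invr_gt0 ?ltr0n//.
apply: ltW; apply: (lt_trans (archi_boundP _)); first by rewrite invr_ge0 ltW.
by rewrite ltr_nat.
Qed.

Let inv_mono k : (k.+2%:R)^-1 <= (k.+1%:R)^-1 :> R.
Proof. by rewrite lef_pV2 ?posrE ?ltr0n// ler_nat. Qed.

Lemma limit_right t e : 0 < e -> exists2 delta, 0 < delta &
  forall t', t <= t' <= t + delta ->
  `|I (`]0, t']%classic `*` B) - I (`]0, t]%classic `*` B)| <= e.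
Proof.
move=> e0; pose F (k : nat) : set RJ := `]t, t + (k.+1%:R)^-1]%classic `*` setT.
have [||||k Hk] := @limit_shrinking F e.
- by move=> k; apply: measurableX => //; exact: measurable_itv.
- move=> k z [/= z1 _]; split=> //=; move: z1; rewrite !in_itv/= => /andP[-> h] /=.
  by apply: (le_trans h); rewrite lerD2l.
- apply/seteqP; split=> // z h.
  have zt : t < z.1 by have [/= ] := h 0%N Logic.I; rewrite in_itv/= => /andP[].
  have [|k hk] := @small_inv ((z.1 - t) / 2); first by lra.
  have [/= ] := h k Logic.I; rewrite in_itv/= => /andP[_].
  by move: zt hk; move: (k.+1%:R^-1 : R) (z.1 : R) => r x xt rx rx'; exfalso; lra.
- by [].
exists (k.+1%:R)^-1; first exact: shrink_itv.
move=> t' /andP[tt' t't]; apply: Hk.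
- by apply: measurableX => //; exact: measurable_itv.
- by apply: measurableX => //; exact: measurable_itv.
- move=> z [/= z1 Bz]; split=> //=; move: z1; rewrite !in_itv/= => /andP[-> h] /=.
  exact: le_trans tt'.
- move=> z [[/= z1 Bz] nz]; split=> //=; move: z1; rewrite !in_itv/= => /andP[z0 h].
  rewrite (le_trans h t't) andbT ltNge; apply/negP => zt; apply: nz; split=> //=.
  by rewrite in_itv/= z0.
Qed.

Lemma limit_left t e : 0 < e -> exists2 delta, 0 < delta &
  forall t', t - delta <= t' < t ->
  `|I (`]0, t[%classic `*` B) - I (`]0, t']%classic `*` B)| <= e.
Proof.
move=> e0; pose F (k : nat) : set RJ := `]t - (k.+1%:R)^-1, t[%classic `*` setT.
have [||||k Hk] := @limit_shrinking F e.
- by move=> k; apply: measurableX => //; exact: measurable_itv.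
- move=> k z [/= z1 _]; split=> //=; move: z1; rewrite !in_itv/= => /andP[h ->].
  by rewrite andbT; apply: le_lt_trans h; rewrite lerB.
- apply/seteqP; split=> // z h.
  have zt : z.1 < t by have [/= ] := h 0%N Logic.I; rewrite in_itv/= => /andP[].
  have [|k hk] := @small_inv ((t - z.1) / 2); first by lra.
  have [/= ] := h k Logic.I; rewrite in_itv/= => /andP[+ _].
  by move: zt hk; move: (k.+1%:R^-1 : R) (z.1 : R) => r x xt rx rx'; exfalso; lra.
- by [].
exists (k.+1%:R)^-1; first exact: shrink_itv.
move=> t' /andP[tt' t't]; apply: Hk.
- by apply: measurableX => //; exact: measurable_itv.
- by apply: measurableX => //; exact: measurable_itv.
- move=> z [/= z1 Bz]; split=> //=; move: z1; rewrite !in_itv/= => /andP[-> h] /=.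
  exact: le_lt_trans t't.
- move=> z [[/= z1 Bz] nz]; split=> //=; move: z1; rewrite !in_itv/= => /andP[z0 h].
  rewrite h andbT; apply: (le_lt_trans tt'); rewrite ltNge; apply/negP => zt; apply: nz; split=> //=.
  by rewrite in_itv/= z0.
Qed.

Lemma limit_stationary t : sp_t phi (sp_l phi) <= t ->
  I (`]0, t]%classic `*` B) = I (`]0, sp_t phi (sp_l phi)]%classic `*` B).
Proof.
move=> tt; apply/eqP; rewrite -subr_eq0 -normr_le0.
have mX s : measurable (`]0, s]%classic `*` B : set RJ).
  by apply: measurableX => //; exact: measurable_itv.
have sub : `]0, sp_t phi (sp_l phi)]%classic `*` B `<=` `]0, t]%classic `*` B.
  move=> z [/= z1 Bz]; split=> //=; move: z1; rewrite !in_itv/= => /andP[-> h] /=.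
  exact: le_trans tt.
apply: (le_trans (disc_limit_increment Hphi TM TL Goo (mX t) (mX _) sub)).
have -> : G `&` ((`]0, t]%classic `*` B) `\` (`]0, sp_t phi (sp_l phi)]%classic `*` B)) = set0.
  by apply/seteqP; split=> // z [[z1 _] [[_ Bz] nz]]; apply: nz.
by rewrite !measure0 /= addr0 mulr0.
Qed.

End path_regularity.

Lemma eventually_div2n {R : realType} (r e : R) : 0 < e ->
  \forall n \near \oo, r / (2 ^ n)%:R <= e.
Proof.
move=> e0.
have h : r / (2 ^ n)%:R @[n --> \oo] --> (0 : R).
  rewrite -[X in _ --> X](mulr0 r); apply: cvgM; first exact: cvg_cst.
  under eq_fun do rewrite natrX -exprVn.
  by apply: cvg_expr; rewrite ger0_norm; lra.
move/cvgrPdist_le : h => /(_ _ e0); apply: filterS => n.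
by rewrite sub0r normrN; exact/le_trans/ler_norm.
Qed.

Lemma norm_le_path {R : realType} {V : normedModType R} (x z y : V) :
  `|x| <= `|z| + `|z - y| + `|y - x|.
Proof.
have h1 := ler_normB y (y - x); have h2 := ler_normB z (z - y).
by rewrite !subKr in h1 h2; lra.
Qed.

Section supremum.
Context {R : realType} {X Y : completeNormedModType R}.
Context dO (O : measurableType dO) (P : probability O R).
Context dJ (J : measurableType dJ)
  (nu : {sigma_finite_measure set J -> \bar R}).
Local Notation RJ := (measurableTypeR R * J)%type.
Context (N : O -> {measure set RJ -> \bar R}).
Hypothesis HN : poisson_random_measure P (intensity nu) N.
Variables (phi : @step_process R X dO O dJ J).
Hypothesis Hphi : simple_adapted P nu N phi.
Local Notation mu := (intensity nu).
Variables (B : set J) (mB : measurable B).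
Variables (T : R -> X -> Y) (Kq : R).
Hypotheses (K0 : 0 < Kq) (TM : forall u x, `|T u x| <= Kq * `|x|).
Hypothesis TL : forall u x, 0 < u -> T v x @[v --> u^'-] --> T u x.
Hypothesis Tlin : forall u (I : finType) (c : I -> R) (x : I -> X),
  T u (\sum_k c k *: x k) = \sum_k c k *: T u (x k).
Local Notation G := (sp_domain phi).
Local Notation L n := (sp_l phi * 2 ^ n)%N.
Local Notation tl := (sp_t phi (sp_l phi)).
Local Notation u n := (refine (sp_t phi) n).
Local Notation I t := (disc_limit nu N phi T (`]0, t]%classic `*` B)).
Local Notation cell n := (lex_cell phi B n).
Local Notation S n := (stoch_sum (cell_count N (cell n))
  (fun c => fine (mu (cell n c))) (lex_value phi T Kq n)).
Local Notation smax n w :=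
  (rmax (fun k => `|S n k w|) (L n * sp_m phi)).

Definition fine_mesh n : Prop :=
  ((tl / (2 ^ n)%:R)%:E * nu (\bigcup_j sp_A (s := phi) j) <= 1)%E.

Lemma fine_mesh_near : \forall n \near \oo, fine_mesh n.
Proof.
have := @eventually_div2n R (tl * fine (nu (\bigcup_j sp_A (s := phi) j))) 1 ltr01.
apply: filterS => n h; rewrite /fine_mesh.
have nf : nu (\bigcup_j sp_A (s := phi) j) \is a fin_num.
  by rewrite ge0_fin_numE//; exact: (sp_marks_finite Hphi).
by rewrite -(fineK nf) -EFinM lee_fin mulrAC.
Qed.

Lemma grid_near n t : 0 < t -> exists2 a, (a <= L n)%N &
  Num.min t tl <= u n a <= Num.min t tl + tl / (2 ^ n)%:R.
Proof.
move=> t0; have tl0 : 0 <= tl by exact: (sp_t_ge0 Hphi).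
have r0 : 0 <= tl / (2 ^ n)%:R by rewrite divr_ge0.
have [ttl|ttl] := ltP t tl; last first.
  by exists (L n) => //; rewrite refine_coarse lexx/= lerDl.
have u0 : u n 0 = 0 by rewrite -[RHS](sa_t0 Hphi) -[in RHS](refine_coarse _ n 0) mul0n.
have [|i iL /andP[it ti]] := @grid_find R (u n) (L n) t.
  by rewrite u0 refine_coarse t0 ltW.
exists i.+1 => //; rewrite ti/=.
have := refine_mesh (sa_lt Hphi) iL; rewrite (sa_t0 Hphi) subr0.
by move: it; lra.
Qed.

Lemma limit_le_smax w t e : (N w G < +oo)%E -> 0 < t -> 0 < e ->
  \forall n \near \oo, `|I t w| <= Kq * smax n w + e.
Proof.
move=> Goo t0 e0; have e2 : 0 < e / 2 by lra.
set t' := Num.min t tl.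
have It : I t w = I t' w.
  rewrite /t'; have [//|tt] := ltP t tl.
  exact: (limit_stationary Hphi mB TM TL Goo).
have [delta d0 Hd] := limit_right Hphi mB (ltW K0) TM TL Goo t' e2.
have [a [a0 Ha]] := disc_limit_rate Hphi TM TL Goo.
have a_near : \forall n \near \oo, a n <= e / 2.
  move/cvgrPdist_le : a0 => /(_ _ e2); apply: filterS => n.
  by rewrite sub0r normrN; exact/le_trans/ler_norm.
move: a_near (@eventually_div2n R tl _ d0); apply: filterS2 => n an nd.
have [i iL /andP[i1 i2]] := grid_near n t0.
have mD : measurable (`]0, u n i]%classic `*` B : set RJ).
  by apply: measurableX => //; exact: measurable_itv.
have h0 : t' <= u n i <= t' + delta.
  apply/andP; split; first exact: i1.
  apply: (le_trans i2); rewrite lerD2l; exact: nd.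
have h1 := Hd _ h0.
have [_ /(_ n) h2] := Ha _ mD.
have h3 := region_integral_le_rmax HN Hphi mB T K0 w iL.
have h4 := norm_le_path (I t' w)
  (region_integral nu N (disc phi T n) (`]0, u n i]%classic `*` B) w) (I (u n i) w).
rewrite It; apply: (le_trans h4).
apply: (le_trans (lerD (lerD h3 (le_trans h2 an)) h1)).
by rewrite -addrA -splitr; exact: lexx.
Qed.

Lemma limit_sup_moment p (D : \bar R) : 1 <= p ->
  (forall n, fine_mesh n -> (\int[P]_w (smax n w `^ p)%:E <= D)%E) ->
  exists H : O -> \bar R, [/\ measurable_fun setT H, forall w, (0 <= H w)%E,
    (\int[P]_w H w <= (Kq `^ p)%:E * D)%E &
    forall w, (N w G < +oo)%E -> forall t, 0 < t ->
      ((`|I t w| `^ p)%:E <= H w)%E].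
Proof.
move=> p1 HD; have p0 : 0 < p by lra.
have [n0 _ Hn0] := fine_mesh_near.
have fm k : fine_mesh (n0 + k) by apply: Hn0; exact: leq_addr.
pose f k w := ((Kq * smax (n0 + k) w) `^ p)%:E : \bar R.
have s0 n w : 0 <= smax n w by apply: rmax_ge0.
have mS k : measurable_fun setT (fun w => smax (n0 + k) w).
  have CI := lex_cell_integrand HN Hphi mB K0 TM Tlin (fm k).
  have HP := ci_increments CI.
  apply: measurable_rmax => i _; apply: strongly_measurable_norm.
  apply: strongly_measurable_sub (stoch_sum_measurable HP (ci_measurable CI) i).
  exact: (incr_sub HP).
have mf k : measurable_fun setT (f k).
  apply/measurable_EFinP; apply: measurable_powR_fun.
  exact: measurable_funM.
have f0 k w : (0 <= f k w)%E by rewrite lee_fin powR_ge0.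
exists (fun w => limn_einf (f ^~ w)); split.
- rewrite /limn_einf; apply: measurableT_comp => //.
  apply: measurable_fun_limn_esup => k; exact: measurableT_comp.
- by move=> w; apply: limn_einf_ge; apply: nearW => k; exact: f0.
- apply: (le_trans (fatou P measurableT mf (fun k w _ => f0 k w))).
  apply: limn_einf_le; apply: nearW => k.
  rewrite (_ : (\int[P]_w f k w)%E =
      ((Kq `^ p)%:E * \int[P]_w (smax (n0 + k) w `^ p)%:E)%E).
    by apply: lee_wpmul2l; [rewrite lee_fin powR_ge0|exact: HD].
  rewrite -expectZ ?powR_ge0//.
  + by apply: eq_integral => w _; rewrite /f powRM// ltW.
  + exact: measurable_powR_fun.
  + by move=> w; exact: powR_ge0.
- move=> w Goo t t0; set l := limn_einf _.
  have l0 : (0 <= l)%E by apply: limn_einf_ge; apply: nearW => k; exact: f0.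
  have ley y : 0 <= y -> y < `|I t w| -> ((y `^ p)%:E <= l)%E.
    move=> y0 yI; apply: limn_einf_ge.
    have e0 : 0 < `|I t w| - y by rewrite subr_gt0.
    have [k _ Hk] := limit_le_smax Goo t0 e0.
    exists k => // i /= ki; rewrite /f lee_fin; apply: le_powR => //; first exact: ltW.
    by have := Hk (n0 + i)%N (leq_trans ki (leq_addl _ _)); rewrite /=; lra.
  case: l l0 ley => [r|_ _|//]; last by rewrite leey.
  rewrite lee_fin => r0 ley.
  rewrite lee_fin -(powRVK p0 r0); apply: le_powR => //; first exact: ltW.
  rewrite leNgt; apply/negP => rI.
  pose y := (r `^ p^-1 + `|I t w|) / 2.
  have y0 : 0 <= y by rewrite divr_ge0// addr_ge0// powR_ge0.
  have yI : y < `|I t w| by rewrite /y; move: rI; lra.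
  have ry : r `^ p^-1 < y by rewrite /y; move: rI; lra.
  have := ley y y0 yI; rewrite lee_fin leNgt => /negP; apply.
  rewrite -[ltLHS](powRVK p0 r0).
  by apply: gt0_ltr_powR; rewrite ?nnegrE ?powR_ge0.
Qed.

End supremum.

(** * Dilated convolutions *)

Lemma continuous_linear_bound {R : realType} (V W : normedModType R)
    (f : {linear V -> W}) : continuous f ->
  exists2 K : R, 0 < K & forall x, `|f x| <= K * `|x|.
Proof.
move=> cf; have /linear_boundedP : bounded_near f (nbhs (0 : V)).
  by apply: continuous_linear_bounded; exact: cf.
by move=> /pinfty_ex_gt0[K K0 HK]; exists K.
Qed.

Section dilated_convolution.
Context {R : realType} {X Y : completeNormedModType R}.
Variables (S : R -> {linear X -> X}) (MS : R).
Hypotheses (HS : C0_semigroup S) (MS0 : 0 <= MS)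
  (SM : forall t x, 0 <= t -> `|S t x| <= MS * `|x|).
Variables (Q : {linear X -> Y}) (Pj : {linear Y -> Y}) (U : R -> {linear Y -> Y}).
Variables (KQ KP cQ : R).
Hypotheses (KQ0 : 0 < KQ) (QK : forall x, `|Q x| <= KQ * `|x|)
  (KP0 : 0 < KP) (PK : forall y, `|Pj y| <= KP * `|y|)
  (cQ0 : 0 < cQ) (Qc : forall x, cQ * `|x| <= `|Q x|)
  (Qcont : continuous Q)
  (PP : forall y, Pj (Pj y) = Pj y) (PQ : range Pj = range Q)
  (HU : isometric_C0_group U)
  (dil : forall t x, 0 < t -> Q (S t x) = Pj (U t (Q x))).

Definition convolution_kernel t u x : X := if u <= t then S (t - u) x else 0.

Definition dilated_kernel u x : Y := U (- u) (Q x).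

Lemma convolution_kernel_bound t u x : `|convolution_kernel t u x| <= MS * `|x|.
Proof.
rewrite /convolution_kernel; case: ifPn => [ut|_]; last by rewrite normr0 mulr_ge0.
by apply: SM; rewrite subr_ge0.
Qed.

Lemma convolution_kernel_cvg t u x : 0 < u ->
  convolution_kernel t v x @[v --> u^'-] --> convolution_kernel t u x.
Proof.
move=> u0; rewrite {2}/convolution_kernel; have [ut|tu] := leP u t; last first.
  apply: cvg_near_cst; near=> v; rewrite /convolution_kernel leNgt.
  by rewrite (_ : t < v)//; near: v; exact: nbhs_left_gt.
have tu0 : (t - u) \in `[0, +oo[ by rewrite in_itv/= andbT subr_ge0.
have /subspace_continuousP/(_ _ tu0) cS := @C0_strong _ _ _ HS x.
have cv : t - v @[v --> u^'-] --> t - u.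
  by apply: cvg_at_left_filter; apply: cvgB; [exact: cvg_cst|exact: cvg_id].
have cw : t - v @[v --> u^'-] --> within [set` `[0, +oo[] (nbhs (t - u)).
  move=> A hA; have {}hA : nbhs (t - u) (fun y => y \in `[0, +oo[ -> A y) := hA.
  have uv : \forall v \near u^'-, v < u by exact: nbhs_left_lt.
  move: uv (cv _ hA); apply: filterS2 => v vu; apply.
  by rewrite in_itv/= andbT; lra.
have c2 := cvg_comp _ _ cw cS.
apply: cvg_trans c2; apply: near_eq_cvg; near=> v.
rewrite /convolution_kernel ifT//; apply: (le_trans _ ut); apply: ltW.
by near: v; exact: nbhs_left_lt.
Unshelve. all: by end_near.
Qed.

Lemma dilated_kernel_bound u x : `|dilated_kernel u x| <= KQ * `|x|.
Proof. by rewrite /dilated_kernel (group_isometry HU). Qed.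

Lemma dilated_kernel_cvg u x : 0 < u ->
  dilated_kernel v x @[v --> u^'-] --> dilated_kernel u x.
Proof.
move=> _; apply: cvg_at_left_filter.
have cN : - v @[v --> u] --> - u by apply: cvgN; exact: cvg_id.
exact: (cvg_comp _ _ cN (@group_strong _ _ _ HU (Q x) (- u))).
Qed.

Lemma dilated_kernel_linear u (K : finType) (c : K -> R) (x : K -> X) :
  dilated_kernel u (\sum_k c k *: x k) = \sum_k c k *: dilated_kernel u (x k).
Proof.
rewrite /dilated_kernel !linear_sum; apply: eq_bigr => k _.
by rewrite !linearZ.
Qed.

Lemma dilation_kernels t u x : u <= t ->
  Q (convolution_kernel t u x) = Pj (U t (dilated_kernel u x)).
Proof.
move=> ut; rewrite /convolution_kernel ut /dilated_kernel -(group_add HU).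
move: ut; rewrite le_eqVlt => /predU1P[->|ut]; last by rewrite dil// subr_gt0.
rewrite subrr (C0_0 HS) (group_0 HU).
have : range Q (Q x) by exists x.
by rewrite -PQ => -[y _ <-]; rewrite PP.
Qed.

Context dO (O : measurableType dO) (P : probability O R).
Context dJ (J : measurableType dJ)
  (nu : {sigma_finite_measure set J -> \bar R}).
Local Notation RJ := (measurableTypeR R * J)%type.
Context (N : O -> {measure set RJ -> \bar R}).
Hypothesis HN : poisson_random_measure P (intensity nu) N.
Variables (phi : @step_process R X dO O dJ J).
Hypothesis Hphi : simple_adapted P nu N phi.
Variables (B : set J) (mB : measurable B).
Local Notation D t := (`]0, t]%classic `*` B : set RJ).
Local Notation I E := (disc_limit nu N phi dilated_kernel E).

Definition convolution t w : X :=
  disc_limit nu N phi (convolution_kernel t) (D t) w.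

Let mD t : measurable (D t).
Proof. by apply: measurableX => //; exact: measurable_itv. Qed.

Lemma convolution_is_integral p t : 1 <= p -> 0 < t ->
  is_stoch_integral P nu N p (convolution_integrand S (sp_fun phi) t) t B
    (convolution t).
Proof.
move=> p1 t0; have Lp E mE := disc_Lp_cvg HN Hphi MS0
  (convolution_kernel_bound t) (@convolution_kernel_cvg t) p1 mE.
have Esp n t' B' : sp_integral nu N (disc phi (convolution_kernel t) n) t' B' =
    region_integral nu N (disc phi (convolution_kernel t) n) (`]0, t']%classic `*` B').
  by apply/funext => w; exact: (sp_integralE (disc_adapted Hphi _ n)).
exists (disc phi (convolution_kernel t)).
  split.
  - by move=> n; exact: disc_adapted.
  - apply: aeW => -[w z] /=.
    have -> : convolution_integrand S (sp_fun phi) t w z =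
        sp_fun (sp_map phi (convolution_kernel t z.1)) w z.
      have [z0|z0] := leP z.1 0.
        rewrite [RHS]sp_fun_out//; last by rewrite /= (sa_t0 Hphi) ltNge z0.
          rewrite /convolution_integrand indicE memNset ?scale0r//= in_itv/=.
          by move=> /andP[]; rewrite ltNge z0.
        exact: (sa_lt Hphi).
      rewrite /convolution_integrand indicE /convolution_kernel /sp_fun /=.
      have [zt|zt] := leP z.1 t.
        rewrite mem_set ?scale1r; last by rewrite /= in_itv/= z0 zt.
        rewrite linear_sum; apply: eq_bigr => i _; rewrite linear_sum.
        apply: eq_bigr => j _; rewrite linear_sum; apply: eq_bigr => k _.
        by rewrite linearZ.
      rewrite memNset ?scale0r; last by rewrite /= in_itv/= z0/= leNgt zt.
      apply/esym; apply: big1 => i _; apply: big1 => j _; apply: big1 => k _.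
      by rewrite scaler0.
    exact: (disc_fun_cvg Hphi (@convolution_kernel_cvg t)).
  - move=> t' B' t'0 mB'.
    exists (disc_limit nu N phi (convolution_kernel t) (`]0, t']%classic `*` B')).
    under eq_fun do rewrite Esp.
    by apply: Lp; apply: measurableX => //; exact: measurable_itv.
by under eq_fun do rewrite Esp; exact: Lp.
Qed.

Lemma dilation_step n t w : 0 < t ->
  Q (region_integral nu N (disc phi (convolution_kernel t) n) (D t) w) =
  Pj (U t (region_integral nu N (disc phi dilated_kernel n) (D t) w)).
Proof.
move=> t0; have E (rho : {measure set RJ -> \bar R}) :
    Q (step_sum (@sp_cell _ _ _ _ _ _ (disc phi (convolution_kernel t) n))
      (@sp_coef _ _ _ _ _ _ (disc phi (convolution_kernel t) n) w) rho (D t)) =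
    Pj (U t (step_sum (@sp_cell _ _ _ _ _ _ (disc phi dilated_kernel n))
      (@sp_coef _ _ _ _ _ _ (disc phi dilated_kernel n) w) rho (D t))).
  rewrite /step_sum !linear_sum; apply: eq_bigr => e _.
  rewrite /sp_coef /= !linearZ.
  have [ut|tu] := leP (refine (sp_t phi) n e.1) t.
    by rewrite -(dilation_kernels _ ut); congr (_ *: _); rewrite !linearZ.
  have E0 : @sp_cell _ _ _ _ _ _ (disc phi dilated_kernel n) e `&` D t = set0.
    apply/seteqP; split=> // z [[/= z1 _] [/= z2 _]].
    move: z1 z2; rewrite !in_itv/= => /andP[h _] /andP[_ h'].
    by move: (lt_le_trans (lt_trans tu h) h'); rewrite ltxx.
  have r0 : fine (rho (@sp_cell _ _ _ _ _ _ (disc phi dilated_kernel n) e `&` D t)) = 0.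
    by rewrite E0 measure0.
  have zl (c : R) (y : Y) : c = 0 -> c *: y = 0 by move=> ->; rewrite scale0r.
  by transitivity (0 : Y); [exact: (zl _ _ r0)|apply/esym; exact: (zl _ _ r0)].
rewrite /region_integral !linearB; congr (_ - _); first exact: (E (N w)).
exact: (E (intensity nu)).
Qed.

Lemma dilation_limit t w : (N w (sp_domain phi) < +oo)%E -> 0 < t ->
  Q (convolution t w) = Pj (U t (I (D t) w)).
Proof.
move=> Goo t0.
have [_ [_ /(_ _ (mD t)) [cX _]]] := disc_limit_rate Hphi
  (convolution_kernel_bound t) (@convolution_kernel_cvg t) Goo.
have [_ [_ /(_ _ (mD t)) [cY _]]] := disc_limit_rate Hphi dilated_kernel_bound
  (@dilated_kernel_cvg) Goo.
have c1 : Q (region_integral nu N (disc phi (convolution_kernel t) n) (D t) w)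
    @[n --> \oo] --> Q (convolution t w).
  by apply: continuous_cvg => //; exact: Qcont.
have c2 : Pj (U t (region_integral nu N (disc phi dilated_kernel n) (D t) w))
    @[n --> \oo] --> Pj (U t (I (D t) w)).
  apply/cvgrPdist_le => e e0; have e' : 0 < e / KP by rewrite divr_gt0.
  move/cvgrPdist_le : cY => /(_ _ e'); apply: filterS => n h.
  rewrite -!linearB; apply: (le_trans (PK _)); rewrite (group_isometry HU).
  by rewrite mulrC -ler_pdivlMr.
move: c1; under eq_fun do rewrite dilation_step//.
move=> c1; exact: (cvg_unique _ c1 c2).
Qed.

Lemma convolution_norm t w : (N w (sp_domain phi) < +oo)%E -> 0 < t ->
  `|convolution t w| <= KP / cQ * `|I (D t) w|.
Proof.
move=> Goo t0; rewrite -(ler_pM2l cQ0); apply: (le_trans (Qc _)).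
rewrite (dilation_limit Goo t0); apply: (le_trans (PK _)).
by rewrite (group_isometry HU) [leRHS]mulrA [cQ * _]mulrC divfK ?gt_eqF.
Qed.

Lemma convolution_cvg (F : set_system R) {FF : ProperFilter F} t y l w :
  (N w (sp_domain phi) < +oo)%E -> F --> t -> (\forall u \near F, 0 < u) ->
  Q l = Pj (U t y) ->
  (forall e, 0 < e -> \forall u \near F, `|I (D u) w - y| <= e) ->
  convolution u w @[u --> F] --> l.
Proof.
move=> Goo Ft F0 Ql Iy; apply/cvgrPdist_le => e e0.
pose e2 := e * cQ / KP / 2.
have e20 : 0 < e2 by rewrite !divr_gt0// mulr_gt0.
have cU : U u y @[u --> F] --> U t y := cvg_comp _ _ Ft (@group_strong _ _ _ HU y t).
move/cvgrPdist_le : cU => /(_ _ e20) cU.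
move: F0 (Iy _ e20) cU; apply: filterS3 => u u0 h1 h2.
rewrite -(ler_pM2l cQ0); apply: (le_trans (Qc _)).
rewrite linearB Ql (dilation_limit Goo u0) -linearB; apply: (le_trans (PK _)).
have -> : U t y - U u (I (D u) w) = (U t y - U u y) - U u (I (D u) w - y).
  by rewrite linearB opprB addrA subrK.
have h3 := ler_normB (U t y - U u y) (U u (I (D u) w - y)).
rewrite (group_isometry HU) in h3.
rewrite -ler_pdivlMl//; apply: (le_trans h3); apply: (le_trans (lerD h2 h1)).
by rewrite /e2 -splitr mulrC [e * cQ]mulrC; exact: lexx.
Qed.

Lemma convolution_cadlag w : (N w (sp_domain phi) < +oo)%E ->
  cadlag (convolution ^~ w).
Proof.
move=> Goo t t0; split.
  apply: (@convolution_cvg _ _ t (I (D t) w)) => //.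
  - exact: cvg_within.
  - by near=> u; apply: lt_trans t0 _; near: u; exact: nbhs_right_gt.
  - exact: dilation_limit.
  - move=> e e0; have [d d0 Hd] := limit_right Hphi mB (ltW KQ0)
      dilated_kernel_bound (@dilated_kernel_cvg) Goo t e0.
    near=> u; apply: Hd; apply/andP; split.
      by apply: ltW; near: u; exact: nbhs_right_gt.
    near: u; apply: nbhs_right_le; by rewrite ltrDl.
have [l _ Ql] : range Q (Pj (U t (I (`]0, t[%classic `*` B) w))).
  by rewrite -PQ; exists (U t (I (`]0, t[%classic `*` B) w)).
exists l; apply: (@convolution_cvg _ _ t (I (`]0, t[%classic `*` B) w)) => //.
- exact: cvg_within.
- by near=> u; near: u; exact: nbhs_left_gt.
- move=> e e0; have [d d0 Hd] := limit_left Hphi mB (ltW KQ0)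
    dilated_kernel_bound (@dilated_kernel_cvg) Goo t e0.
  near=> u; rewrite distrC; apply: Hd; apply/andP; split.
    by near: u; apply: nbhs_left_ge; rewrite ltrBlDr ltrDl.
  by near: u; exact: nbhs_left_lt.
Unshelve. all: by end_near.
Qed.

Lemma convolution_stoch p : 1 <= p ->
  stoch_convolution P nu N p S (sp_fun phi) B convolution.
Proof.
move=> p1; split; first by move=> t t0; exact: convolution_is_integral.
apply: filterS (domain_count_finite HN Hphi) => w; exact: convolution_cadlag.
Qed.

Lemma convolution_sup_norm p (E : \bar R) : 1 <= p -> (0 <= E)%E ->
  (forall n, fine_mesh nu phi n ->
   (\int[P]_w (rmax (fun k => `|stoch_sum (cell_count N (lex_cell phi B n))
      (fun c => fine (intensity nu (lex_cell phi B n c)))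
      (lex_value phi dilated_kernel KQ n) k w|)
      (sp_l phi * 2 ^ n * sp_m phi) `^ p)%:E <= E `^ p)%E) ->
  (sup_norm P p convolution <= (KP / cQ * KQ)%:E * E)%E.
Proof.
move=> p1 E0 HE; have p0 : 0 < p by lra.
have [H [mH H0 HI Hsup]] := limit_sup_moment HN Hphi mB KQ0 dilated_kernel_bound
  (@dilated_kernel_cvg) dilated_kernel_linear p1 HE.
have k0 : 0 < KP / cQ by rewrite divr_gt0.
have kK0 : 0 <= KP / cQ * KQ by rewrite mulr_ge0// ltW.
rewrite /sup_norm.
have -> : ((KP / cQ * KQ)%:E * E = (((KP / cQ * KQ)%:E * E) `^ p) `^ p^-1)%E.
  by rewrite -poweRrM mulfV ?gt_eqF// poweRe1// mule_ge0// lee_fin.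
apply: le_poweR; first by rewrite invr_ge0 ltW.
  apply: integral_ge0 => w _.
  apply: (@le_trans _ _ (`|convolution 1 w| `^ p)%:E).
    by rewrite lee_fin powR_ge0.
  by apply: ereal_sup_ubound; exists 1 => /=.
rewrite poweRM ?lee_fin// poweR_EFin (powRM _ (ltW k0) (ltW KQ0)) EFinM -muleA.
apply: (@le_trans _ _ (\int[P]_w (((KP / cQ) `^ p)%:E * H w))%E).
  apply: le_lower_integral => w.
    apply: (@le_trans _ _ (`|convolution 1 w| `^ p)%:E).
      by rewrite lee_fin powR_ge0.
    by apply: ereal_sup_ubound; exists 1 => /=.
  apply: ub_ereal_sup => _ [t /= t0 <-].
  have [Goo|Goo] := boolP (N w (sp_domain phi) < +oo)%E; last first.
    rewrite /convolution /disc_limit (negbTE Goo) normr0 powR0 ?gt_eqF//.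
    by rewrite mule_ge0// lee_fin powR_ge0.
  apply: (@le_trans _ _ (((KP / cQ) `^ p)%:E * (`|I (D t) w| `^ p)%:E)%E).
    rewrite -EFinM lee_fin -(powRM _ (ltW k0) (normr_ge0 _)).
    by apply: le_powR => //; [exact: ltW|exact: convolution_norm].
  by apply: lee_wpmul2l; [rewrite lee_fin powR_ge0|exact: Hsup].
rewrite ge0_integralZl_EFin ?powR_ge0//.
by apply: lee_wpmul2l; [rewrite lee_fin powR_ge0|exact: HI].
Qed.

End dilated_convolution.

Theorem theorem3p3 (R : realType) (s : R) (hs : 1 < s <= 2)
    (X : completeNormedModType R) (hX : martingale_type s X)
    (S : R -> {linear X -> X}) (hS : bounded_C0_semigroup S)
    (Y : completeNormedModType R) (hY : martingale_type s Y)
    (hdil : isometric_dilation Y S) :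
  (forall p : R, s <= p ->
     exists C : R,
       forall (dO : measure_display) (O : measurableType dO)
         (P : probability O R)
         (dJ : measure_display) (J : measurableType dJ)
         (nu : {sigma_finite_measure set J -> \bar R})
         (N : O -> {measure set (measurableTypeR R * J)%type -> \bar R}),
       poisson_random_measure P (intensity nu) N ->
       forall (phi : step_process O J), simple_adapted P nu N phi ->
       forall (B : set J), measurable B ->
       exists2 Z : R -> O -> X,
         stoch_convolution P nu N p S (sp_fun phi) B Z &
         (sup_norm P p Z <=
            C%:E * Dnorm_cap P nu p s p (restrict_marks B (sp_fun phi)))%E) /\
  (forall p : R, 1 <= p < s ->
     exists C : R,
       forall (dO : measure_display) (O : measurableType dO)
         (P : probability O R)
         (dJ : measure_display) (J : measurableType dJ)
         (nu : {sigma_finite_measure set J -> \bar R})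
         (N : O -> {measure set (measurableTypeR R * J)%type -> \bar R}),
       poisson_random_measure P (intensity nu) N ->
       forall (phi : step_process O J), simple_adapted P nu N phi ->
       forall (B : set J), measurable B ->
       exists2 Z : R -> O -> X,
         stoch_convolution P nu N p S (sp_fun phi) B Z &
         (sup_norm P p Z <=
            C%:E * Dnorm_sum P nu p s p (restrict_marks B (sp_fun phi)))%E).
Proof.
have /andP[s1 _] := hs; have [HS [M0 SM0]] := hS.
have SM t x : 0 <= t -> `|S t x| <= `|M0| * `|x|.
  by move=> t0; apply: (le_trans (SM0 t x t0)); apply: ler_wpM2r => //; exact: ler_norm.
have [Q [Pj [U [[Qcont [cQ cQ0 Qc]] [Pcont PP PQ] HU dil]]]] := hdil.
have [KQ KQ0 QK] := continuous_linear_bound Qcont.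
have [KP KP0 PK] := continuous_linear_bound Pcont.
have k0 : 0 <= KP / cQ * KQ by rewrite mulr_ge0// ?divr_ge0// ltW.
split=> p hp.
- have p1 : 1 <= p by lra.
  have [C C0 HC] := cell_bound_cap s1 hp hY.
  exists (KP / cQ * KQ * C) => dO O P dJ J nu N HN phi Hphi B mB.
  exists (convolution S nu N phi B).
    exact: (convolution_stoch HS (normr_ge0 M0) SM KQ0 QK KP0 PK cQ0 Qc Qcont PP
      PQ HU dil HN Hphi mB p1).
  rewrite EFinM -muleA.
  apply: (convolution_sup_norm HS (normr_ge0 M0) SM KQ0 QK KP0 PK cQ0 Qc Qcont PP
    PQ HU dil HN Hphi mB p1) => [|n mesh].
    by rewrite mule_ge0 ?lee_fin// le_max poweR_ge0.
  apply: HC; exact: (lex_cell_integrand HN Hphi mB KQ0 (dilated_kernel_bound QK HU)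
    (@dilated_kernel_linear _ _ _ Q U) mesh).
- have /andP[p1 _] := hp; have p0 : 0 < p by lra.
  have pV0 : p^-1 != 0 by rewrite invr_neq0// gt_eqF.
  have [C C0 HC] := cell_bound_sum s1 hp hY.
  have C1 : 0 < KP / cQ * KQ * C + 1 by rewrite ltr_wpDl// mulr_ge0.
  exists (KP / cQ * KQ * C + 1) => dO O P dJ J nu N HN phi Hphi B mB.
  exists (convolution S nu N phi B).
    exact: (convolution_stoch HS (normr_ge0 M0) SM KQ0 QK KP0 PK cQ0 Qc Qcont PP
      PQ HU dil HN Hphi mB p1).
  rewrite -lee_pdivrMl//; apply: le_ereal_inf_tmp => _ [psi0 [psi1 [[sp0 f0] [sp1 f1] psiE ->]]].
  rewrite lee_pdivrMl//; set r := (_ + _)%E.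
  have r0 : (0 <= r)%E by rewrite adde_ge0// poweR_ge0.
  apply: (@le_trans _ _ ((KP / cQ * KQ * C)%:E * r)%E); last first.
    by apply: lee_wpmul2r => //; rewrite lee_fin lerDl.
  rewrite EFinM -muleA.
  apply: (convolution_sup_norm HS (normr_ge0 M0) SM KQ0 QK KP0 PK cQ0 Qc Qcont PP
    PQ HU dil HN Hphi mB p1) => [|n mesh].
    by rewrite mule_ge0 ?lee_fin.
  apply: (HC _ _ _ _ _ _ _ _ _ _ _ _ _ psi0 psi1 sp0 sp1) => //.
  + exact: (lex_cell_integrand HN Hphi mB KQ0 (dilated_kernel_bound QK HU)
      (@dilated_kernel_linear _ _ _ Q U) mesh).
  + exact: (lty_poweRy pV0 f0).
  + exact: (lty_poweRy pV0 f1).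
  + exact: psiE.
Qed.
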